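(* Let $C$ be a context with hole $\xi$. For all $\lambda\mu$-terms $M,N$, if $M\le N$ then $C[M]\le C[N]$; that is, the map $M\mapsto C[M]$ is monotone with respect to $\le$.
   Context: Fix disjoint countably infinite sets of variables and names. $\lambda\mu$-terms and contexts. - $\lambda\mu$-terms: $M::=x\mid\lambda x.M\mid MM\mid\mu\alpha.{}_\beta|M|$, where $\lambda$ binds $x$ and $\mu$ binds $\alpha$; terms are taken up to renaming of bound variables and names. - Contexts: $C::=x\mid\xi\mid\lambda x.C\mid CC\mid\mu\alpha.{}_\beta|C|$, where $\xi$ is a hole. $C[M]$ is obtained by replacing every occurrence of $\xi$ by $M$. Resource terms and sums. - Resource terms: $t::=x\mid\lambda x.t\mid t[t_1,\dots,t_n]\mid\mu\alpha.{}_\beta|t|$, with $[t_1,\dots,t_n]$ a finite multiset (bag); $1$ is the empty bag and $*$ is multiset union. - Sums are finite sets of resource terms, written with idempotent $+$ and empty sum $0$. Constructors extend multilinearly to sums, and $0$ annihilates. - A weak composition (w.c.) of a bag $B$ is a tuple $(B_0,\dots,B_k)$ of possibly empty bags with $B_0*\dots*B_k=B$. Linear substitution $t\langle B/x\rangle$: - $x\langle[v]/x\rangle=v$, and $x\langle B/x\rangle=0$ otherwise. - For $y\neq x$: $y\langle1/x\rangle=y$, and $y\langle B/x\rangle=0$ if $B\neq1$. - It commutes with $\lambda y$ and with $\mu\alpha.{}_\beta|\cdot|$. - $(t[v_1..v_n])\langle B/x\rangle=\sum_{(B_0..B_n)\text{ w.c. of }B}t\langle B_0/x\rangle[v_1\langle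 B_1/x\rangle,\dots,v_n\langle B_n/x\rangle]$. Linear named application $\langle t\rangle_\alpha B$: - $\langle x\rangle_\alpha1=x$, and $\langle x\rangle_\alpha B=0$ if $B\neq1$. - It commutes with $\lambda y$, and $\langle\mu\gamma.{}_\eta|t|\rangle_\alpha B=\mu\gamma.\langle{}_\eta|t|\rangle_\alpha B$. - $\langle{}_\eta|t|\rangle_\alpha B={}_\eta|\langle t\rangle_\alpha B|$ for $\eta\neq\alpha$. - $\langle{}_\alpha|t|\rangle_\alpha B=\sum_{(B_1,B_2)\text{ w.c. of }B}{}_\alpha|(\langle t\rangle_\alpha B_1)B_2|$. - $\langle t[v_1..v_n]\rangle_\alpha B=\sum_{(B_0..B_n)}(\langle t\rangle_\alpha B_0)[\langle v_1\rangle_\alpha B_1,\dots,\langle v_n\rangle_\alpha B_n]$. Resource reduction. $\to_r$ is the closure under single-hole resource contexts of the rules $(\lambda x.t)B\to t\langle B/x\rangle$, $(\mu\alpha.{}_\beta|t|)B\to\mu\alpha.\langle{}_\beta|t|\rangle_\alpha B$, and $\mu\gamma.{}_\alpha|\mu\beta.{}_\eta|t||\to\mu\gamma.({}_\eta|t|)\{\alpha/\beta\}$ (renaming of free $\beta$ into $\alpha$). It is extended to sums by $t+\mathcal S\to_r\mathcal T+\mathcal S$ when $t\to_r\mathcal T$ and $t\notin\mathcal S$. This reduction is confluent and strongly normalising on sums, so each resource term $t$ has a unique normal form $\mathrm{nf}_r(t)$ (a sum, possibly $0$). Taylor expansion. - $\mathcal T(x)=\{x\}$, $\mathcal T(\lambda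 x.M)=\{\lambda x.t\mid t\in\mathcal T(M)\}$, $\mathcal T(\mu\alpha.{}_\beta|M|)=\{\mu\alpha.{}_\beta|t|\mid t\in\mathcal T(M)\}$. - $\mathcal T(MN)=\{t[u_1,\dots,u_n]\mid t\in\mathcal T(M),n\ge0,u_i\in\mathcal T(N)\}$. - $\mathrm{NF}(\mathcal T(M)):=\bigcup_{t\in\mathcal T(M)}\mathrm{nf}_r(t)$. - $M\le N$ iff $\mathrm{NF}(\mathcal T(M))\subseteq\mathrm{NF}(\mathcal T(N))$. *)

(* Defs.v *)
From HB Require Import structures.
From mathcomp Require Import all_boot finmap generic_quotient.
From Stdlib Require Import Relation_Operators.

Set Implicit Arguments.
Unset Strict Implicit.
Unset Printing Implicit Defensive.

Local Open Scope quotient_scope.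
Local Open Scope fset_scope.

(* Variables and names are two separate copies of nat.  Terms up to renaming
   of bound variables and names are de Bruijn terms with one index space for
   variables and another for names: under p lambdas, the variable index k < p
   is bound, and k >= p is the free variable k - p; likewise for names under
   mu.  Every such term is thus meaningful, and equality is alpha-equivalence. *)

Definition up (f : nat -> nat) (n : nat) : nat :=
  if n is m.+1 then (f m).+1 else 0.

(* The renaming that captures x by a new innermost binder. *)
Definition bind (x y : nat) : nat := if y == x then 0 else y.+1.

(* The renaming {a/b} where b is the innermost binder, which disappears. *)
Definition unbind (a n : nat) : nat := if n is m.+1 then m else a.

(* [Mu b M] is "mu alpha. _b | M |": both b and M are in the scope of alpha,
   which has index 0 there. *)
Inductive term : Type :=
| Var of nat
| Lam of term
| App of term & term
| Mu of nat & term.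

(* f acts on the free variables, g on the free names. *)
Fixpoint ren (f g : nat -> nat) (M : term) : term :=
  match M with
  | Var x => Var (f x)
  | Lam M => Lam (ren (up f) g M)
  | App M N => App (ren f g M) (ren f g N)
  | Mu b M => Mu (up g b) (ren f (up g) M)
  end.

(* Unlike terms, contexts are not taken up to renaming: they carry the actual
   variables and names they bind, since filling the hole may capture. *)
Inductive ctx : Type :=
| CVar of nat
| CHole
| CLam of nat & ctx
| CApp of ctx & ctx
| CMu of nat & nat & ctx.

Fixpoint fill (C : ctx) (M : term) : term :=
  match C with
  | CVar x => Var x
  | CHole => M
  | CLam x C => Lam (ren (bind x) id (fill C M))
  | CApp C D => App (fill C M) (fill D M)
  | CMu a b C => Mu (bind a b) (ren id (bind a) (fill C M))
  end.

(* Resource terms in which bags are lists; the quotient is [rterm] below. *)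
Inductive rawterm : Type :=
| RVar of nat
| RLam of rawterm
| RApp of rawterm & seq rawterm
| RMu of nat & rawterm.

Fixpoint rawterm_nested_ind (P : rawterm -> Prop)
    (HVar : forall x, P (RVar x))
    (HLam : forall t, P t -> P (RLam t))
    (HApp : forall t B, P t -> foldr (fun u Q => P u /\ Q) True B ->
              P (RApp t B))
    (HMu : forall b t, P t -> P (RMu b t)) (t : rawterm) : P t :=
  let rec := rawterm_nested_ind HVar HLam HApp HMu in
  match t with
  | RVar x => HVar x
  | RLam t => HLam t (rec t)
  | RApp t B => HApp t B (rec t)
      ((fix recs B : foldr (fun u Q => P u /\ Q) True B :=
          if B is u :: B' then conj (rec u) (recs B') else I) B)
  | RMu b t => HMu b t (rec t)
  end.

Fixpoint rawterm_encode (t : rawterm) : GenTree.tree nat :=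
  match t with
  | RVar x => GenTree.Node 0 [:: GenTree.Leaf x]
  | RLam t => GenTree.Node 1 [:: rawterm_encode t]
  | RApp t B => GenTree.Node 2 (rawterm_encode t :: map rawterm_encode B)
  | RMu b t => GenTree.Node 3 [:: GenTree.Leaf b; rawterm_encode t]
  end.

Fixpoint rawterm_decode (e : GenTree.tree nat) : option rawterm :=
  match e with
  | GenTree.Node 0 [:: GenTree.Leaf x] => Some (RVar x)
  | GenTree.Node 1 [:: e] => omap RLam (rawterm_decode e)
  | GenTree.Node 2 (e :: es) =>
      omap (fun t => RApp t (pmap id (map rawterm_decode es)))
           (rawterm_decode e)
  | GenTree.Node 3 [:: GenTree.Leaf b; e] => omap (RMu b) (rawterm_decode e)
  | _ => None
  end.

Lemma rawterm_encodeK : pcancel rawterm_encode rawterm_decode.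
Proof.
elim/rawterm_nested_ind => //= [t -> //|t B -> IHB|b t -> //] /=.
congr (Some (RApp t _)).
by elim: B IHB => //= u B IH [-> /IH ->].
Qed.

HB.instance Definition _ := Countable.copy rawterm (pcan_type rawterm_encodeK).

Fixpoint rren (f g : nat -> nat) (t : rawterm) : rawterm :=
  match t with
  | RVar x => RVar (f x)
  | RLam t => RLam (rren (up f) g t)
  | RApp t B => RApp (rren f g t) (map (rren f g) B)
  | RMu b t => RMu (up g b) (rren f (up g) t)
  end.

(* Weak compositions; a finite sum of raw terms is a list, in which order and
   multiplicity are irrelevant. *)
Fixpoint splits (T : Type) (B : seq T) : seq (seq T * seq T) :=
  if B is v :: B' then
    [seq (v :: p.1, p.2) | p <- splits B'] ++
    [seq (p.1, v :: p.2) | p <- splits B']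
  else [:: ([::], [::])].

Fixpoint wcs (T : Type) (n : nat) (B : seq T) : seq (seq (seq T)) :=
  if n is n'.+1 then [seq p.1 :: Bs | p <- splits B, Bs <- wcs n' p.2]
  else if B is [::] then [:: [::]] else [::].

(* The bags with one item from each sum: multilinearity of [_, ..., _]. *)
Fixpoint bags_of (T : Type) (Ss : seq (seq T)) : seq (seq T) :=
  if Ss is U :: Ss' then [seq v :: B | v <- U, B <- bags_of Ss']
  else [:: [::]].

(* The sum over all (B_0, ..., B_n) of F_0(B_0) [F_1(B_1), ..., F_n(B_n)]. *)
Definition distribute (F0 : seq rawterm -> seq rawterm)
    (Fs : seq (seq rawterm -> seq rawterm)) (B : seq rawterm) : seq rawterm :=
  flatten [seq [seq RApp u D
               | u <- F0 (head [::] Bs),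
                 D <- bags_of [seq p.1 p.2 | p <- zip Fs (behead Bs)]]
          | Bs <- wcs (size Fs).+1 B].

(* Linear substitution t<B/x>. *)
Fixpoint lsub (x : nat) (t : rawterm) (B : seq rawterm) : seq rawterm :=
  match t with
  | RVar y =>
      if y == x then (if B is [:: v] then [:: v] else [::])
      else (if B is [::] then [:: RVar y] else [::])
  | RLam t => [seq RLam u | u <- lsub x.+1 t (map (rren succn id) B)]
  | RApp t vs => distribute (lsub x t) [seq lsub x v | v <- vs] B
  | RMu b t => [seq RMu b u | u <- lsub x t (map (rren id succn) B)]
  end.

(* <_h|t|>_a B, as the sum of the bodies u of its summands _h|u|, given the
   function F = <t>_a. *)
Definition nap_named (F : seq rawterm -> seq rawterm) (a h : nat)
    (B : seq rawterm) : seq rawterm :=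
  if h == a then [seq RApp u p.2 | p <- splits B, u <- F p.1] else F B.

(* Linear named application <t>_a B. *)
Fixpoint nap (a : nat) (t : rawterm) (B : seq rawterm) : seq rawterm :=
  match t with
  | RVar y => if B is [::] then [:: RVar y] else [::]
  | RLam t => [seq RLam u | u <- nap a t (map (rren succn id) B)]
  | RApp t vs => distribute (nap a t) [seq nap a v | v <- vs] B
  | RMu h t =>
      [seq RMu h u
      | u <- nap_named (nap a.+1 t) a.+1 h (map (rren id succn) B)]
  end.

(* In the first rule, the substituted variable 0 does not occur in the shifted
   bag, hence not in the result, so that [predn] only closes the gap left by
   the erased binder. *)
Inductive raw_step : rawterm -> seq rawterm -> Prop :=
| step_lam t B :
    raw_step (RApp (RLam t) B)
      [seq rren predn id u | u <- lsub 0 t (map (rren succn id) B)]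
| step_mu b t B :
    raw_step (RApp (RMu b t) B)
      [seq RMu b u | u <- nap_named (nap 0 t) 0 b (map (rren id succn) B)]
| step_rho a h t :
    raw_step (RMu a (RMu h t)) [:: RMu (unbind a h) (rren id (unbind a) t)]
| step_in_lam t T : raw_step t T -> raw_step (RLam t) [seq RLam u | u <- T]
| step_in_fun t T B :
    raw_step t T -> raw_step (RApp t B) [seq RApp u B | u <- T]
| step_in_bag t B1 v V B2 :
    raw_step v V ->
    raw_step (RApp t (B1 ++ v :: B2)) [seq RApp t (B1 ++ u :: B2) | u <- V]
| step_in_mu b t T : raw_step t T -> raw_step (RMu b t) [seq RMu b u | u <- T].

(* Bags are multisets: resource terms are raw terms up to permutation of the
   bags at any depth, i.e. up to equality after hereditarily sorting all bags
   along an arbitrary total order; see [cls_RApp]. *)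
Definition raw_le : rel rawterm := relpre choice.pickle leq.

Fixpoint canon (t : rawterm) : rawterm :=
  match t with
  | RVar x => RVar x
  | RLam t => RLam (canon t)
  | RApp t B => RApp (canon t) (sort raw_le (map canon B))
  | RMu b t => RMu b (canon t)
  end.

Definition bag_equiv : rel rawterm := fun t u => canon t == canon u.

Lemma bag_equiv_refl : reflexive bag_equiv.
Proof. by move=> t; exact: eqxx. Qed.

Lemma bag_equiv_sym : symmetric bag_equiv.
Proof. by move=> t u; exact: eq_sym. Qed.

Lemma bag_equiv_trans : transitive bag_equiv.
Proof. by move=> u t v /eqP tu /eqP uv; apply/eqP; rewrite tu. Qed.

Canonical bag_equiv_equivRel :=
  EquivRel bag_equiv bag_equiv_refl bag_equiv_sym bag_equiv_trans.

Definition rterm : Type := {eq_quot bag_equiv}.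
HB.instance Definition _ := Choice.on rterm.
HB.instance Definition _ := EqQuotient.on rterm.

Definition cls (t : rawterm) : rterm := \pi_rterm t.

Lemma cls_eqP (t u : rawterm) : cls t = cls u <-> canon t = canon u.
Proof. by split=> [/eqmodP/eqP|tu]; last by apply/eqmodP/eqP. Qed.

Lemma cls_RApp (t u : rawterm) (B D : seq rawterm) :
  cls (RApp t B) = cls (RApp u D) <->
  cls t = cls u /\ perm_eq (map cls B) (map cls D).
Proof.
have tot : total raw_le by move=> x y; exact: leq_total.
have tr : transitive raw_le by move=> y x z; exact: leq_trans.
have anti : antisymmetric raw_le.
  move=> x y le_xy; apply: (pcan_inj (@choice.pickleK rawterm)).
  by apply/eqP; rewrite eqn_leq.
pose r (c : rterm) := canon (repr c).
have rK v : r (cls v) = canon v by apply/cls_eqP; rewrite /cls reprK.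
have r_inj : injective r by move=> c d /cls_eqP; rewrite /cls !reprK.
have mapr E : map canon E = map r (map cls E).
  by rewrite -map_comp; apply: eq_map => v /=; rewrite rK.
rewrite !cls_eqP /=; split=> [[-> /(perm_sortP tot tr anti)]|[-> pBD]].
  by rewrite !mapr => /(perm_map_inj r_inj).
by congr RApp; apply/(perm_sortP tot tr anti); rewrite !mapr perm_map.
Qed.

Definition rsum : Type := {fset rterm}.

Definition res_step (t : rterm) (T : rsum) : Prop :=
  exists (t0 : rawterm) (T0 : seq rawterm),
    [/\ t = cls t0, raw_step t0 T0 & T = [fset cls u | u in T0]].

Inductive sum_step : rsum -> rsum -> Prop :=
| SumStep (t : rterm) (T S : rsum) :
    res_step t T -> t \notin S -> sum_step (t |` S) (T `|` S).

Definition sum_normal (S : rsum) : Prop := forall S', ~ sum_step S S'.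

(* [is_nf t S] is "S = nf_r(t)"; S is unique as the reduction of sums is
   confluent, and exists as it is strongly normalising. *)
Definition is_nf (t : rterm) (S : rsum) : Prop :=
  clos_refl_trans rsum sum_step [fset t] S /\ sum_normal S.

(* The Taylor expansion, as a set of raw representatives. *)
Fixpoint taylor (M : term) (t : rawterm) : Prop :=
  match M with
  | Var x => t = RVar x
  | Lam M => exists2 u, taylor M u & t = RLam u
  | App M N => exists (u : rawterm) (B : seq rawterm),
      [/\ taylor M u, (forall v, v \in B -> taylor N v) & t = RApp u B]
  | Mu b M => exists2 u, taylor M u & t = RMu b u
  end.

Definition NFT (M : term) (s : rterm) : Prop :=
  exists (t : rawterm) (S : rsum), [/\ taylor M t, is_nf (cls t) S & s \in S].

Definition taylor_le (M N : term) : Prop := forall s, NFT M s -> NFT N s.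

(* Main.v *)
From Stdlib Require Import Setoid Relation_Operators Operators_Properties Classical.
From mathcomp Require Import all_boot finmap generic_quotient zify.
Require Import Defs.

Set Implicit Arguments.
Unset Strict Implicit.
Unset Printing Implicit Defensive.

(** By strong normalisation and confluence, nf(K[t]) is the union of the nf(K[t'])
    for t' in nf(t), for every context K with one hole for a resource term, even if
    K renames variables or names.  A summand of nf(C[M]) thus depends on the
    approximants of M only through their normal forms, which are also reached from
    approximants of N.

    For confluence, linear substitution, linear named application and renaming are
    instances of one simultaneous substitution, given by a relation [sub s t E u]
    in which the multiset of items E is consumed linearly.  A single composition
    law, in its two directions [sub_fwd] and [sub_bwd], then closes all critical
    pairs.  As sums are idempotent, only membership matters: instead of joining two
    reducts of t, one shows that every predicate N which is invariant under the
    reduction of the strict reducts of t holds somewhere in one reduct iff it does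
    in the other; at the end N is "s belongs to the normal form". *)


(** * Resource terms modulo permutation of bags *)

(** Joining two reducts directly would mean reducing several summands in step, while the idempotent
    sum may merge summands, and one of them may be reduced only if it is absent from the rest.
    Testing with an arbitrary predicate [N] avoids this bookkeeping: a sum is tested by an
    existential, and passing under a context [K] is composing [N] with [K]. Invariance at the strict
    reducts is what a well-founded induction supplies; the induction itself rests on a measure that
    exploits linearity, since substitution neither copies nor erases an item.

    The delicate rule is the one for two nested mu abstractions. Named application can insert an
    application between them, which hides the redex until a mu step has been made. The rule also
    merges two names, so the items for one name have to be shared out between the occurrences of
    both. *)

Definition qVar (x : nat) : rterm := cls (RVar x).
Definition qLam (t : rterm) : rterm := cls (RLam (repr t)).
Definition qApp (t : rterm) (B : seq rterm) : rterm :=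
  cls (RApp (repr t) (map (@repr _ rterm) B)).
Definition qMu (b : nat) (t : rterm) : rterm := cls (RMu b (repr t)).

Lemma clsK (t : rterm) : cls (repr t) = t.
Proof. exact: reprK. Qed.

Lemma canon_repr t : canon (repr (cls t)) = canon t.
Proof. by apply/cls_eqP; rewrite clsK. Qed.

Lemma cls_qLam t : cls (RLam t) = qLam (cls t).
Proof. by apply/cls_eqP; rewrite /= canon_repr. Qed.

Lemma cls_qMu b t : cls (RMu b t) = qMu b (cls t).
Proof. by apply/cls_eqP; rewrite /= canon_repr. Qed.

Lemma map_clsK (B : seq rterm) : map cls (map (@repr _ rterm) B) = B.
Proof. by rewrite -map_comp map_id_in // => t _; exact: clsK. Qed.

Lemma cls_qApp t B : cls (RApp t B) = qApp (cls t) (map cls B).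
Proof. by apply/cls_RApp; rewrite clsK map_clsK. Qed.

Lemma qApp_eq t u B D : qApp t B = qApp u D <-> t = u /\ perm_eq B D.
Proof. by rewrite cls_RApp !clsK !map_clsK. Qed.

Lemma qApp_perm t B D : perm_eq B D -> qApp t B = qApp t D.
Proof. by move=> p; apply/qApp_eq. Qed.

(** An observation that is well defined on classes, to discriminate and invert the quotient
    constructors. [ShApp] carries nothing, because an application determines its bag only up to
    permutation; [qApp_eq] deals with it. *)
Variant shape := ShVar of nat | ShLam of rterm | ShApp | ShMu of nat & rterm.

Definition shape_of (t : rterm) : shape :=
  match repr t with
  | RVar x => ShVar x
  | RLam t => ShLam (cls t)
  | RApp _ _ => ShApp
  | RMu b t => ShMu b (cls t)
  end.

Lemma shape_cls t : shape_of (cls t) =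
  match t with
  | RVar x => ShVar x
  | RLam t => ShLam (cls t)
  | RApp _ _ => ShApp
  | RMu b t => ShMu b (cls t)
  end.
Proof.
rewrite /shape_of; move: (canon_repr t).
case: (repr _) => [x|u|u B|b u]; case: t => [y|v|v D|c v] //=.
- by case=> ->.
- by case=> /cls_eqP ->.
- by case=> -> /cls_eqP ->.
Qed.

Lemma shapeE :
  (forall x, shape_of (qVar x) = ShVar x) *
  (forall t, shape_of (qLam t) = ShLam t) *
  (forall t B, shape_of (qApp t B) = ShApp) *
  (forall b t, shape_of (qMu b t) = ShMu b t).
Proof. by do !split=> *; rewrite shape_cls ?clsK. Qed.

Ltac shape_discr := by move/(congr1 shape_of); rewrite !shapeE.

Lemma qVar_inj x y : qVar x = qVar y -> x = y.
Proof. by move/(congr1 shape_of); rewrite !shapeE => -[]. Qed.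

Lemma qLam_inj t u : qLam t = qLam u -> t = u.
Proof. by move/(congr1 shape_of); rewrite !shapeE => -[]. Qed.

Lemma qMu_inj b c t u : qMu b t = qMu c u -> b = c /\ t = u.
Proof. by move/(congr1 shape_of); rewrite !shapeE => -[]. Qed.

Lemma rterm_ind (P : rterm -> Prop) :
  (forall x, P (qVar x)) ->
  (forall t, P t -> P (qLam t)) ->
  (forall t B, P t -> (forall v, v \in B -> P v) -> P (qApp t B)) ->
  (forall b t, P t -> P (qMu b t)) ->
  forall t, P t.
Proof.
move=> HV HL HA HM t; rewrite -(clsK t); move: (repr t) => {}t.
elim/rawterm_nested_ind: t => [x|t IH|t B IH IHB|b t IH]; first exact: HV.
- by rewrite cls_qLam; apply: HL.
- rewrite cls_qApp; apply: HA => // v /mapP[u uB ->].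
  elim: B IHB uB => //= w B IHB [Pw /IHB{}IHB].
  by rewrite in_cons => /predU1P[->|/IHB].
- by rewrite cls_qMu; apply: HM.
Qed.

Lemma perm_sort_raw_le (A B : seq rawterm) :
  (sort raw_le A = sort raw_le B) <-> perm_eq A B.
Proof.
have tot : total raw_le by move=> x y; exact: leq_total.
have tr : transitive raw_le by move=> y x z; exact: leq_trans.
have anti : antisymmetric raw_le.
  move=> x y le_xy; apply: (pcan_inj (@choice.pickleK rawterm)).
  by apply/eqP; rewrite eqn_leq.
by split=> /(perm_sortP tot tr anti).
Qed.

Lemma eq_foldr_map (A : Type) (h k : rawterm -> A) B :
  foldr (fun u Q => h u = k u /\ Q) True B -> map h B = map k B.
Proof. by elim: B => //= u B IH [-> /IH ->]. Qed.

Lemma foldr_conj_mono (P Q : rawterm -> Prop) B :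
  (forall u, P u -> Q u) ->
  foldr (fun u X => P u /\ X) True B -> foldr (fun u X => Q u /\ X) True B.
Proof. by move=> PQ; elim: B => //= u B IH [/PQ ? /IH]. Qed.

(** Renaming may disturb the order along which bags are sorted, so it commutes with [canon] only up
    to a second sorting. This is what makes [qren] well defined on classes. *)
Lemma canon_rren f g t : canon (rren f g (canon t)) = canon (rren f g t).
Proof.
elim/rawterm_nested_ind: t f g => //= [t IH f g|t B IH IHB f g|b t IH f g];
  rewrite IH //.
congr RApp; apply/perm_sort_raw_le; rewrite -!map_comp.
have -> : [seq (canon \o rren f g) i | i <- B] =
          [seq (canon \o rren f g \o canon) i | i <- B].
  apply/esym/eq_foldr_map.
  by apply: foldr_conj_mono IHB => u /(_ f g).
by rewrite [X in perm_eq _ X](map_comp (canon \o rren f g) canon); apply: perm_map; rewrite perm_sort.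
Qed.

Definition qren (f g : nat -> nat) (t : rterm) : rterm := cls (rren f g (repr t)).

Lemma cls_rren f g t : cls (rren f g t) = qren f g (cls t).
Proof.
by apply/cls_eqP; rewrite -canon_rren -[RHS]canon_rren canon_repr.
Qed.

Lemma qren_var f g x : qren f g (qVar x) = qVar (f x).
Proof. by rewrite -cls_rren. Qed.

Lemma qren_lam f g t : qren f g (qLam t) = qLam (qren (up f) g t).
Proof. by rewrite -{1}(clsK t) -cls_qLam -cls_rren cls_qLam. Qed.

Lemma qren_app f g t B : qren f g (qApp t B) = qApp (qren f g t) (map (qren f g) B).
Proof.
rewrite -cls_rren cls_qApp -!map_comp; congr qApp.
Qed.

Lemma qren_mu f g b t : qren f g (qMu b t) = qMu (up g b) (qren f (up g) t).
Proof. by rewrite -{1}(clsK t) -cls_qMu -cls_rren cls_qMu. Qed.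

Definition qrenE := (qren_var, qren_lam, qren_app, qren_mu).

Lemma up_ext f f' : f =1 f' -> up f =1 up f'.
Proof. by move=> e [|x] //=; rewrite e. Qed.

Lemma up_comp f f' x : up f (up f' x) = up (f \o f') x.
Proof. by case: x. Qed.

Lemma up_inj f : injective f -> injective (up f).
Proof. by move=> i [|x] [|y] //= [/i ->]. Qed.

Lemma qren_ext f f' g g' t : f =1 f' -> g =1 g' -> qren f g t = qren f' g' t.
Proof.
elim/rterm_ind: t f f' g g' => [x|t IH|t B IH IHB|b t IH] f f' g g' ef eg;
  rewrite !qrenE.
- by rewrite ef.
- by congr qLam; apply: IH => //; apply: up_ext.
- by congr qApp; [apply: IH | apply/eq_in_map => v vB; apply: IHB].
- by rewrite (up_ext eg); congr qMu; apply: IH => //; apply: up_ext.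
Qed.

Lemma qren_id f g t : f =1 id -> g =1 id -> qren f g t = t.
Proof.
have upid h : h =1 id -> up h =1 id by move=> e [|x] //=; rewrite e.
elim/rterm_ind: t f g => [x|t IH|t B IH IHB|b t IH] f g ef eg; rewrite !qrenE.
- by rewrite ef.
- by rewrite IH //; apply: upid.
- by rewrite IH // map_id_in // => v vB; apply: IHB.
- by rewrite upid // IH //; apply: upid.
Qed.

Lemma qren_comp f g f' g' t :
  qren f g (qren f' g' t) = qren (f \o f') (g \o g') t.
Proof.
elim/rterm_ind: t f g f' g' => [x|t IH|t B IH IHB|b t IH] f g f' g'; rewrite !qrenE //.
- by rewrite IH; congr qLam; apply: qren_ext => // x; exact: up_comp.
- by rewrite IH -map_comp; congr qApp; apply/eq_in_map => v vB; apply: IHB.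
- by rewrite IH up_comp; congr qMu; apply: qren_ext => // x; exact: up_comp.
Qed.


(** * Simultaneous linear substitution *)

(** Permutations are compared through the counts of an arbitrary predicate, which leaves linear
    arithmetic. *)
Ltac perm_solve :=
  let p := fresh "p" in
  apply/permP => p;
  repeat match goal with
  | H : is_true (perm_eq _ _) |- _ => move/permP/(_ p): H
  end;
  rewrite /= ?(count_cat, map_cat, addn0) /=; lia.

Section Seq.
Variables (T U : eqType) (f : T -> U).
Implicit Types (X : seq T) (Y : seq U).

Lemma map_eq_cat X (A B : seq U) : map f X = A ++ B ->
  exists A' B', [/\ X = A' ++ B', A = map f A' & B = map f B'].
Proof.
move=> e; exists (take (size A) X), (drop (size A) X).
by rewrite cat_take_drop map_take map_drop e take_size_cat // drop_size_cat.
Qed.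

(** Permutations lift along any f, injective or not: it suffices to lift an exchange of adjacent
    blocks. *)
Lemma perm_map_eq X Y : perm_eq (map f X) Y ->
  exists2 X', perm_eq X X' & Y = map f X'.
Proof.
move=> pXY.
apply: (@catCA_perm_ind _ (fun Y => exists2 X', perm_eq X X' & Y = map f X') _
  _ _ pXY); last by exists X.
move=> s1 s2 s3 [X' pX /esym/map_eq_cat[A [D [? -> /esym/map_eq_cat[B [C [? -> ->]]]]]]].
exists (B ++ A ++ C); last by rewrite !map_cat.
by subst; perm_solve.
Qed.

Lemma perm_cons_cat (x : T) (X A B : seq T) : perm_eq (x :: X) (A ++ B) ->
  (exists2 A', perm_eq A (x :: A') & perm_eq X (A' ++ B)) \/
  (exists2 B', perm_eq B (x :: B') & perm_eq X (A ++ B')).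
Proof.
move=> p; have : x \in A ++ B by rewrite -(perm_mem p) mem_head.
rewrite mem_cat => /orP[/perm_to_rem pr|/perm_to_rem pr]; [left|right].
  by exists (rem x A) => //; perm_solve.
by exists (rem x B) => //; perm_solve.
Qed.

End Seq.

(** Variables and names share one type of keys, so that linear substitution and named application
    consume the same kind of multiset. *)
Definition key : Type := (nat + nat)%type.
Definition item : Type := (key * rterm)%type.

Definition kmap (f g : nat -> nat) (k : key) : key :=
  match k with inl x => inl (f x) | inr a => inr (g a) end.

Definition ritem (f g : nat -> nat) (e : item) : item :=
  (kmap f g e.1, qren f g e.2).

Notation ritems f g := (map (ritem f g)).
Notation tag k := (map (pair (k : key))).

(* The variable x becomes the variable [vr s x] or, if that is [None], has each
   occurrence replaced by one item of key [inl x].  The name a becomes [nr s a];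
   if [ap s a], every subterm named a is moreover applied to a bag of items of
   key [inr a]. *)
Record lsubst := LSubst { vr : nat -> option nat; nr : nat -> nat; ap : nat -> bool }.

Definition upv (s : lsubst) : lsubst :=
  LSubst (fun x => if x is y.+1 then omap succn (vr s y) else Some 0) (nr s) (ap s).

Definition upn (s : lsubst) : lsubst :=
  LSubst (vr s) (up (nr s)) (fun a => if a is b.+1 then ap s b else false).

(* [sub s t E u]: u is a summand of the substitution of t along s which
   consumes the multiset of items E. *)
Inductive sub : lsubst -> rterm -> seq item -> rterm -> Prop :=
| sub_keep s x y : vr s x = Some y -> sub s (qVar x) [::] (qVar y)
| sub_hit s x v : vr s x = None -> sub s (qVar x) [:: (inl x, v)] v
| sub_lam s t E u :
    sub (upv s) t (ritems succn id E) u -> sub s (qLam t) E (qLam u)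
| sub_app s t B E E0 E1 u D :
    perm_eq E (E0 ++ E1) -> sub s t E0 u -> subs s B E1 D ->
    sub s (qApp t B) E (qApp u D)
| sub_mu s h t E u :
    subn (upn s) h t (ritems id succn E) u ->
    sub s (qMu h t) E (qMu (nr (upn s) h) u)
with subs : lsubst -> seq rterm -> seq item -> seq rterm -> Prop :=
| subs_nil s : subs s [::] [::] [::]
| subs_cons s v B E E0 E1 u D :
    perm_eq E (E0 ++ E1) -> sub s v E0 u -> subs s B E1 D ->
    subs s (v :: B) E (u :: D)
(* [subn s h t E u]: the named term _(nr s h)|u| is a summand of _h|t|. *)
with subn : lsubst -> nat -> rterm -> seq item -> rterm -> Prop :=
| subn_keep s h t E u : ap s h = false -> sub s t E u -> subn s h t E u
| subn_app s h t E E0 D u :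
    ap s h -> perm_eq E (E0 ++ tag (inr h) D) -> sub s t E0 u ->
    subn s h t E (qApp u D).

Lemma subs_inv_nil s E D : subs s [::] E D -> E = [::] /\ D = [::].
Proof. by move=> H; inversion H. Qed.

Lemma subs_inv_cons s v B E D : subs s (v :: B) E D ->
  exists E0 E1 u D', [/\ perm_eq E (E0 ++ E1), sub s v E0 u, subs s B E1 D'
    & D = u :: D'].
Proof.
move eB: (v :: B) => B0 H; case: H eB => // {}s w B' {}E E0 E1 u D' pE H1 H2 [-> ->].
by exists E0, E1, u, D'.
Qed.

Lemma subn_inv s h t E u : subn s h t E u ->
  if ap s h then exists E0 D u', [/\ perm_eq E (E0 ++ tag (inr h) D),
      sub s t E0 u' & u = qApp u' D]
  else sub s t E u.
Proof. by case=> [{}s {}h {}t {}E {}u -> |{}s {}h {}t {}E E0 D {}u -> pE H] //; exists E0, D, u. Qed.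

Lemma subs_perm_items s B E E' D : perm_eq E E' -> subs s B E D -> subs s B E' D.
Proof.
move=> p; case: B => [|v B].
  by move=> /subs_inv_nil[? ?]; subst; rewrite perm_sym in p; move/perm_nilP: p => ->; constructor.
move=> /subs_inv_cons[E0 [E1 [u [D' [pE H1 H2 ->]]]]].
by apply: subs_cons H1 H2; rewrite -(permPr pE) perm_sym.
Qed.

Lemma subs_cat s B1 B2 E1 E2 D1 D2 : subs s B1 E1 D1 -> subs s B2 E2 D2 ->
  subs s (B1 ++ B2) (E1 ++ E2) (D1 ++ D2).
Proof.
elim: B1 E1 D1 => [|v B1 IH] E1 D1; first by move=> /subs_inv_nil[-> ->].
move=> /subs_inv_cons[E0 [E' [u [D' [pE H1 H2 ->]]]]] H3.
apply: (subs_cons _ H1 (IH _ _ H2 H3)); perm_solve.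
Qed.

Lemma subs_cat_inv s B1 B2 E D : subs s (B1 ++ B2) E D ->
  exists E1 E2 D1 D2, [/\ perm_eq E (E1 ++ E2), subs s B1 E1 D1,
    subs s B2 E2 D2 & D = D1 ++ D2].
Proof.
elim: B1 E D => [|v B1 IH] E D /=.
  by move=> H; exists [::], E, [::], D; split=> //; constructor.
move=> /subs_inv_cons[E0 [E' [u [D' [pE H1 /IH[E1 [E2 [D1 [D2 [pE' H2 H3 ->]]]]] ->]]]]].
exists (E0 ++ E1), E2, (u :: D1), D2; split=> //; first by perm_solve.
by apply: subs_cons H1 H2; perm_solve.
Qed.

Lemma subs_perm s B B' E D : perm_eq B B' -> subs s B E D ->
  exists2 D', subs s B' E D' & perm_eq D D'.
Proof.
move=> p H.
apply: (@catCA_perm_ind _ (fun B' => exists2 D', subs s B' E D' & perm_eq D D') _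
  _ _ p); last by exists D.
move=> s1 s2 s3 [D' /subs_cat_inv[E1 [X [D1 [Y [pE H1 /subs_cat_inv]]]]]].
move=> [E2 [E3 [D2 [D3 [pX H2 H3 -> ->]]]]] pD.
exists (D2 ++ D1 ++ D3); last by perm_solve.
apply: subs_perm_items (subs_cat H2 (subs_cat H1 H3)).
by perm_solve.
Qed.

(** The quotient constructors are mere functions, out of reach of [inversion]: in these lemmas the
    equation between terms is kept aside and settled by [shape_of] or [qApp_eq]. *)
Lemma sub_inv_var s x E u : sub s (qVar x) E u ->
  match vr s x with
  | Some y => E = [::] /\ u = qVar y
  | None => E = [:: (inl x, u)]
  end.
Proof.
move et: (qVar x) => t H.
case: H et => {s t E u}.
- by move=> s y z e /qVar_inj ->; rewrite e.
- by move=> s y v e /qVar_inj ->; rewrite e.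
- by move=> s t E u _; shape_discr.
- by move=> s t B E E0 E1 u D _ _ _; shape_discr.
- by move=> s h t E u _; shape_discr.
Qed.

Lemma sub_inv_lam s t E u : sub s (qLam t) E u ->
  exists2 u', sub (upv s) t (ritems succn id E) u' & u = qLam u'.
Proof.
move et: (qLam t) => t0 H.
case: H et => {s t0 E u}.
- by move=> s y z e; shape_discr.
- by move=> s y v e; shape_discr.
- by move=> s t0 E u H /qLam_inj ->; exists u.
- by move=> s t0 B E E0 E1 u D _ _ _; shape_discr.
- by move=> s h t0 E u _; shape_discr.
Qed.

Lemma sub_inv_app s t B E u : sub s (qApp t B) E u ->
  exists E0 E1 u' D, [/\ perm_eq E (E0 ++ E1), sub s t E0 u', subs s B E1 D
    & u = qApp u' D].
Proof.
move et: (qApp t B) => t0 H.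
case: H et => {s t0 E u}.
- by move=> s y z e; shape_discr.
- by move=> s y v e; shape_discr.
- by move=> s t0 E u _; shape_discr.
- move=> s t0 B0 E E0 E1 u D pE H1 H2 /qApp_eq[e]; rewrite perm_sym => p.
  have [D' H3 pD] := subs_perm p H2.
  by exists E0, E1, u, D'; split; rewrite // ?e //; apply: qApp_perm.
- by move=> s h t0 E u _; shape_discr.
Qed.

Lemma sub_inv_mu s h t E u : sub s (qMu h t) E u ->
  exists2 u', subn (upn s) h t (ritems id succn E) u' & u = qMu (nr (upn s) h) u'.
Proof.
move et: (qMu h t) => t0 H.
case: H et => {s t0 E u}.
- by move=> s y z e; shape_discr.
- by move=> s y v e; shape_discr.
- by move=> s t0 E u _; shape_discr.
- by move=> s t0 B E E0 E1 u D _ _ _; shape_discr.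
- by move=> s h0 t0 E u H /qMu_inj[-> ->]; exists u.
Qed.

Lemma subn_perm_aux s h t E E' u :
  (forall s E E' u, perm_eq E E' -> sub s t E u -> sub s t E' u) ->
  perm_eq E E' -> subn s h t E u -> subn s h t E' u.
Proof.
move=> IH p /subn_inv; case: ifP => e; last first.
  by move=> H; apply: subn_keep => //; apply: IH H.
move=> [E0 [D [u' [pE H ->]]]]; apply: subn_app H => //.
by rewrite -(permPr pE) perm_sym.
Qed.

(** Only [sub_keep] and [sub_hit] fix the list of items, and a list of at most one item has no other
    permutation. *)
Lemma sub_perm s t E E' u : perm_eq E E' -> sub s t E u -> sub s t E' u.
Proof.
elim/rterm_ind: t s E E' u => [x|t IH|t B IH IHB|b t IH] s E E' u p.
- move=> /sub_inv_var; case e: (vr s x) => [y|].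
    by move=> [? ->]; subst; rewrite perm_sym in p; move/perm_nilP: p => ->; constructor.
  move=> eE; subst; rewrite perm_sym in p.
  by rewrite (perm_small_eq _ p) //; constructor.
- move=> /sub_inv_lam[u' H ->]; constructor.
  by apply: IH H; apply: perm_map.
- move=> /sub_inv_app[E0 [E1 [u' [D [pE H1 H2 ->]]]]].
  by apply: sub_app H1 H2; rewrite -(permPr pE) perm_sym.
- move=> /sub_inv_mu[u' H ->]; constructor.
  by apply: (subn_perm_aux IH) H; apply: perm_map.
Qed.

Lemma subn_perm s h t E E' u : perm_eq E E' -> subn s h t E u -> subn s h t E' u.
Proof. by apply: subn_perm_aux => *; apply: sub_perm; eassumption. Qed.

(** * Substitution and renaming *)

(** A commuting square: renaming and then substituting along s' acts on variables and names as
    substituting along s and then renaming. The shifts under binders are instances. *)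
Definition sq (f g : nat -> nat) (s s' : lsubst) : Prop :=
  [/\ forall x, vr s' (f x) = omap f (vr s x),
      forall a, nr s' (g a) = g (nr s a)
    & forall a, ap s' (g a) = ap s a].

Lemma sq_upv f g s s' : sq f g s s' -> sq (up f) g (upv s) (upv s').
Proof. by case=> H1 H2 H3; split=> // -[|x] //=; rewrite H1; case: (vr s x). Qed.

Lemma sq_upn f g s s' : sq f g s s' -> sq f (up g) (upn s) (upn s').
Proof. by case=> H1 H2 H3; split=> // -[|x] //=; rewrite H2. Qed.

Lemma sq_succ_upv s : sq succn id s (upv s).
Proof. by []. Qed.

Lemma sq_succ_upn s : sq id succn s (upn s).
Proof. by split=> //= x; case: (vr s x). Qed.

Lemma ritems_upv f g E :
  ritems (up f) g (ritems succn id E) = ritems succn id (ritems f g E).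
Proof.
rewrite -!map_comp; apply: eq_map => -[k v]; rewrite /ritem /= !qren_comp.
by case: k.
Qed.

Lemma ritems_upn f g E :
  ritems f (up g) (ritems id succn E) = ritems id succn (ritems f g E).
Proof.
rewrite -!map_comp; apply: eq_map => -[k v]; rewrite /ritem /= !qren_comp.
by case: k.
Qed.

Lemma ritems_tag f g k D : ritems f g (tag k D) = tag (kmap f g k) (map (qren f g) D).
Proof. by rewrite -!map_comp. Qed.

Lemma subs_ren_aux f g s s' B E D :
  (forall v, v \in B -> forall E u, sub s v E u ->
     sub s' (qren f g v) (ritems f g E) (qren f g u)) ->
  subs s B E D -> subs s' (map (qren f g) B) (ritems f g E) (map (qren f g) D).
Proof.
elim: B E D => [|v B IH] E D H; first by move=> /subs_inv_nil[-> ->]; constructor.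
move=> /subs_inv_cons[E0 [E1 [u [D' [pE H1 H2 ->]]]]] /=.
apply: (subs_cons (E0 := ritems f g E0) (E1 := ritems f g E1)).
- by rewrite -map_cat; apply: perm_map.
- by apply: H => //; rewrite mem_head.
- by apply: IH => // w wB; apply: H; rewrite in_cons wB orbT.
Qed.

Lemma sub_ren f g s s' t E u : sq f g s s' -> sub s t E u ->
  sub s' (qren f g t) (ritems f g E) (qren f g u).
Proof.
elim/rterm_ind: t f g s s' E u => [x|t IH|t B IH IHB|h t IH] f g s s' E u q.
- move=> /sub_inv_var; case: (q) => H1 _ _; move: (H1 x); rewrite qren_var.
  case e: (vr s x) => [y|] /= e'.
    by move=> [-> ->]; rewrite qren_var; constructor.
  by move=> ->; constructor.
- move=> /sub_inv_lam[u' H ->]; rewrite !qrenE; constructor.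
  by rewrite -ritems_upv; apply: IH H; apply: sq_upv.
- move=> /sub_inv_app[E0 [E1 [u' [D [pE H1 H2 ->]]]]]; rewrite !qrenE.
  apply: (sub_app (E0 := ritems f g E0) (E1 := ritems f g E1)).
  + by rewrite -map_cat; apply: perm_map.
  + exact: IH H1.
  + by apply: subs_ren_aux H2 => v vB E' u''; apply: IHB.
- move=> /sub_inv_mu[u' H ->]; rewrite !qrenE.
  have q' := sq_upn q; case: (q') => _ Hn Ha; rewrite -Hn; constructor.
  rewrite -ritems_upn; move/subn_inv: H; case: ifP => e.
    move=> [E0 [D [u'' [pE H ->]]]]; rewrite qren_app.
    apply: (subn_app (E0 := ritems f (up g) E0)); first by rewrite Ha.
      by rewrite -(ritems_tag _ _ (inr h)) -map_cat; apply: perm_map.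
    exact: IH H.
  by move=> H; apply: subn_keep; [rewrite Ha | apply: IH H].
Qed.

Lemma ritems_tag_inv f g h E D : injective g ->
  ritems f g E = tag (inr (g h)) D ->
  exists2 D', E = tag (inr h) D' & D = map (qren f g) D'.
Proof.
move=> gi; elim: E D => [|[k v] E IH] [|d D] //=; first by exists [::].
move=> [ek <- /IH[D' -> ->]]; exists (v :: D') => //=.
by case: k ek => //= a [/gi ->].
Qed.

(** Injectivity recovers the key of an item from its renamed key; the terms in the items are already
    given as renamed ones. *)
Lemma sub_ren_inv f g s s' t E w : injective f -> injective g -> sq f g s s' ->
  sub s' (qren f g t) (ritems f g E) w -> exists2 u, sub s t E u & w = qren f g u.
Proof.
elim/rterm_ind: t f g s s' E w => [x|t IH|t B IH IHB|h t IH] f g s s' E w fi gi q.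
- rewrite qren_var => /sub_inv_var; case: (q) => -> _ _.
  case e: (vr s x) => [y|] /=.
    case: E => [|? ?] [] // _ ->; exists (qVar y); rewrite ?qren_var //.
    by constructor.
  case: E => [|[k v] [|? ?]] //= [ek <-]; exists v => //.
  by case: k ek => //= z [/fi ->]; constructor.
- rewrite qrenE => /sub_inv_lam[u']; rewrite -ritems_upv => H ->.
  have [u Hu ->] := IH _ _ _ _ _ _ (up_inj fi) gi (sq_upv q) H.
  by exists (qLam u); rewrite ?qrenE //; constructor.
- rewrite qrenE => /sub_inv_app[X [Y [u' [D [/perm_map_eq[E' pE]]]]]].
  move=> /esym/map_eq_cat[E0 [E1 [? -> ->]]] H1 H2 ->; subst E'.
  have [u Hu ->] := IH _ _ _ _ _ _ fi gi q H1.
  suff [D' HD ->] : exists2 D', subs s B E1 D' & D = map (qren f g) D'.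
    by exists (qApp u D'); rewrite ?qrenE //; apply: sub_app Hu HD.
  elim: B IHB {pE H1} E1 D H2 => [|v B IHB'] IHB E1 D /=.
    move=> /subs_inv_nil[eE ->]; exists [::] => //.
    by case: E1 eE => // _; constructor.
  move=> /subs_inv_cons[X0 [Y0 [u1 [D' [/perm_map_eq[E' pE]]]]]].
  move=> /esym/map_eq_cat[E2 [E3 [? -> ->]]] H1 H2 ->; subst E'.
  have [|D1 HD ->] := IHB' _ E3 D' H2.
    by move=> z zB; apply: IHB; rewrite in_cons zB orbT.
  have [u2 Hu2 ->] := IHB v (mem_head _ _) _ _ _ _ _ _ fi gi q H1.
  by exists (u2 :: D1) => //; apply: subs_cons Hu2 HD.
- rewrite qrenE => /sub_inv_mu[u' /subn_inv]; have q' := sq_upn q.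
  case: (q') => _ Hn Ha; rewrite Ha Hn -ritems_upn.
  case: ifP => e.
    move=> [X [D [u'' [/perm_map_eq[E' pE]]]]].
    move=> /esym/map_eq_cat[E0 [E1 [? -> ]]].
    move=> /esym/ritems_tag_inv -/(_ (up_inj gi))[D' ? ->] H -> ->; subst.
    have [u Hu ->] := IH _ _ _ _ _ _ fi (up_inj gi) q' H.
    exists (qMu (nr (upn s) h) (qApp u D')); last by rewrite !qrenE.
    by constructor; apply: subn_app Hu.
  move=> H ->.
  have [u Hu ->] := IH _ _ _ _ _ _ fi (up_inj gi) q' H.
  exists (qMu (nr (upn s) h) u); last by rewrite !qrenE.
  by constructor; apply: subn_keep.
Qed.

Definition isren (f g : nat -> nat) (s : lsubst) : Prop :=
  [/\ forall x, vr s x = Some (f x), nr s =1 g & forall a, ap s a = false].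

Lemma isren_upv f g s : isren f g s -> isren (up f) g (upv s).
Proof. by case=> H1 H2 H3; split=> // -[|x] //=; rewrite H1. Qed.

Lemma isren_upn f g s : isren f g s -> isren f (up g) (upn s).
Proof. by case=> H1 H2 H3; split=> // -[|x] //=; rewrite H2. Qed.

Lemma perm_nil_cat (T : eqType) (A B : seq T) : perm_eq [::] (A ++ B) ->
  A = [::] /\ B = [::].
Proof. by rewrite perm_sym => /perm_nilP; case: A => //= ->. Qed.

Lemma subs_isren_aux f g s B :
  (forall v, v \in B -> forall E u, sub s v E u <-> E = [::] /\ u = qren f g v) ->
  forall E D, subs s B E D <-> E = [::] /\ D = map (qren f g) B.
Proof.
elim: B => [|v B IH] H E D.
  by split=> [/subs_inv_nil //|[-> ->]]; constructor.
have {}IH := IH (fun w wB => H w (mem_behead (s := v :: B) wB)).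
split=> [/subs_inv_cons[E0 [E1 [u [D' [pE]]]]]|[-> ->]].
  move=> /(H _ (mem_head _ _))[? ->] /IH[? ->] ->; subst.
  by rewrite (perm_nilP pE).
apply: (@subs_cons _ _ _ _ [::] [::]) => //; last exact/IH.
by apply/H => //; rewrite mem_head.
Qed.

(** Makes renaming a substitution without items, so that the composition law also covers shifts and
    the rule for nested mu abstractions. *)
Lemma sub_isren f g s t E u : isren f g s ->
  sub s t E u <-> E = [::] /\ u = qren f g t.
Proof.
elim/rterm_ind: t f g s E u => [x|t IH|t B IH IHB|h t IH] f g s E u r; rewrite qrenE.
- case: (r) => Hv _ _; split=> [/sub_inv_var|[-> ->]]; first by rewrite Hv.
  by constructor.
- split=> [/sub_inv_lam[u' /(IH _ _ _ _ _ (isren_upv r))[e ->] ->]|[-> ->]].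
    by case: E e.
  by constructor; apply/(IH _ _ _ _ _ (isren_upv r)).
- have HB := subs_isren_aux (fun v vB E u => IHB v vB f g s E u r).
  split=> [/sub_inv_app[E0 [E1 [u' [D [pE]]]]]|[-> ->]].
    move=> /(IH _ _ _ _ _ r)[? ->] /HB[? ->] ->; subst.
    by rewrite (perm_nilP pE).
  apply: (@sub_app _ _ _ _ [::] [::]) => //; last exact/HB.
  exact/(IH _ _ _ _ _ r).
- have r' := isren_upn r; case: (r') => _ Hn Ha; rewrite -Hn.
  split=> [/sub_inv_mu[u' /subn_inv]|[-> ->]].
    by rewrite Ha => /(IH _ _ _ _ _ r')[e ->] ->; case: E e.
  by constructor; apply: subn_keep => //; apply/(IH _ _ _ _ _ r').
Qed.


(** * Composition of substitutions *)

Definition valid (s : lsubst) (k : key) : Prop :=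
  match k with inl x => vr s x = None | inr a => ap s a end.

(** The alternative to [valid]: s does not consume items of key k but passes its occurrences on, as
    k', to the next substitution. The two exclude each other by [rekey_valid]. *)
Definition rekey (s : lsubst) (k k' : key) : Prop :=
  match k, k' with
  | inl x, inl y => vr s x = Some y
  | inr a, inr b => ap s a = false /\ nr s a = b
  | _, _ => False
  end.

Lemma rekey_valid s k k' : rekey s k k' -> ~ valid s k.
Proof. by case: k k' => [x|a] [y|b] //=; [move=> -> | move=> [->]]. Qed.

Lemma rekey_fun s k k1 k2 : rekey s k k1 -> rekey s k k2 -> k1 = k2.
Proof.
case: k k1 k2 => [x|a] [y1|b1] [y2|b2] //=; first by move=> -> [->].
by move=> [_ ->] [_ ->].
Qed.

(* Substituting along s1 with the items E1, then along s2 with the items E2,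
   amounts to substituting at once with the items E: those of E1, into which s2
   puts part of E2, and the rest of E2, each with the key that s1 turns into
   its own. *)
Inductive comp (s1 s2 : lsubst) : seq item -> seq item -> seq item -> Prop :=
| comp_nil : comp s1 s2 [::] [::] [::]
| comp_old k v w D E1 E2 E : valid s1 k -> sub s2 v D w -> comp s1 s2 E1 E2 E ->
    comp s1 s2 ((k, v) :: E1) (D ++ E2) ((k, w) :: E)
| comp_new k k' w E1 E2 E : rekey s1 k k' -> comp s1 s2 E1 E2 E ->
    comp s1 s2 E1 ((k', w) :: E2) ((k, w) :: E)
| comp_perm E1 E2 E E1' E2' E' : comp s1 s2 E1 E2 E ->
    perm_eq E1 E1' -> perm_eq E2 E2' -> perm_eq E E' -> comp s1 s2 E1' E2' E'.

(** The last clause forbids that both substitutions apply the same named subterm: this would give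
    two applications in a row, where [subn_app] creates a single one. *)
Definition iscomp (s1 s2 s : lsubst) : Prop :=
  [/\ forall x, vr s x = obind (vr s2) (vr s1 x),
      forall a, nr s a = nr s2 (nr s1 a),
      forall a, ap s a = ap s1 a || ap s2 (nr s1 a)
    & forall a, ap s1 a -> ap s2 (nr s1 a) = false].

Lemma iscomp_upv s1 s2 s : iscomp s1 s2 s -> iscomp (upv s1) (upv s2) (upv s).
Proof. by case=> H1 H2 H3 H4; split=> // -[|x] //=; rewrite H1; case: (vr s1 x). Qed.

Lemma iscomp_upn s1 s2 s : iscomp s1 s2 s -> iscomp (upn s1) (upn s2) (upn s).
Proof.
case=> H1 H2 H3 H4; split=> // -[|a] //=; rewrite ?H2 ?H3 //; exact: H4.
Qed.

Section Comp.
Variables s1 s2 : lsubst.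
Local Notation comp := (comp s1 s2).

Lemma comp_cat A1 A2 A B1 B2 B : comp A1 A2 A -> comp B1 B2 B ->
  comp (A1 ++ B1) (A2 ++ B2) (A ++ B).
Proof.
move=> H HB; elim: H => {A1 A2 A} //=.
- by move=> k v w D E1 E2 E Hk Hv _ IH; rewrite -catA; apply: comp_old.
- by move=> k k' w E1 E2 E Hk _ IH; apply: comp_new.
- move=> E1 E2 E E1' E2' E' _ IH p1 p2 p.
  by apply: comp_perm IH _ _ _; rewrite perm_cat2r.
Qed.

(** Because of [comp_perm], inverting a composition needs an induction, and any item of the
    composite may be singled out. It is either old, an item of E1 that has been substituted, or new,
    an item of E2. *)
Lemma comp_cons_inv E1 E2 E k w E' : comp E1 E2 E -> perm_eq E ((k, w) :: E') ->
  (exists v D E1' E2', [/\ perm_eq E1 ((k, v) :: E1'), perm_eq E2 (D ++ E2'),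
     valid s1 k, sub s2 v D w & comp E1' E2' E']) \/
  (exists k' E2', [/\ perm_eq E2 ((k', w) :: E2'), rekey s1 k k'
     & comp E1 E2' E']).
Proof.
move=> H; elim: H E' => {E1 E2 E}.
- by move=> E' /perm_size.
- move=> k0 v w0 D E1 E2 E Hk Hv HE IH E' p.
  case: (perm_cons_cat (A := [:: (k, w)]) (B := E') p) => [[A pA pE]|[A pA pE]].
    move: (perm_size pA); case: A pA pE => // pA pE _.
    have [ek ew] : (k, w) = (k0, w0) by apply/eqP; move/perm_mem: pA => /(_ (k, w)); rewrite !inE eqxx.
    subst; left; exists v, D, E1, E2; split=> //.
    exact: comp_perm HE _ _ pE.
  case: (IH A pE) => [[v' [D' [E1' [E2' [p1 p2 H1 H2 H3]]]]]|[k' [E2' [p2 H1 H3]]]].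
    left; exists v', D', ((k0, v) :: E1'), (D ++ E2'); split=> //.
    + by perm_solve.
    + by perm_solve.
    + apply: comp_perm (comp_old Hk Hv H3) _ _ _ => //.
      by rewrite perm_sym.
  right; exists k', (D ++ E2'); split=> //; first by perm_solve.
  apply: comp_perm (comp_old Hk Hv H3) _ _ _ => //.
  by rewrite perm_sym.
- move=> k0 k1 w0 E1 E2 E Hk HE IH E' p.
  case: (perm_cons_cat (A := [:: (k, w)]) (B := E') p) => [[A pA pE]|[A pA pE]].
    move: (perm_size pA); case: A pA pE => // pA pE _.
    have [ek ew] : (k, w) = (k0, w0) by apply/eqP; move/perm_mem: pA => /(_ (k, w)); rewrite !inE eqxx.
    subst; right; exists k1, E2; split=> //.
    exact: comp_perm HE _ _ pE.
  case: (IH A pE) => [[v' [D' [E1' [E2' [p1 p2 H1 H2 H3]]]]]|[k' [E2' [p2 H1 H3]]]].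
    left; exists v', D', E1', ((k1, w0) :: E2'); split=> //.
    + by perm_solve.
    + apply: comp_perm (comp_new w0 Hk H3) _ _ _ => //.
      by rewrite perm_sym.
  right; exists k', ((k1, w0) :: E2'); split=> //; first by perm_solve.
  apply: comp_perm (comp_new w0 Hk H3) _ _ _ => //.
  by rewrite perm_sym.
- move=> E1 E2 E E1' E2' E' _ IH p1 p2 p E'' p'.
  have pE : perm_eq E ((k, w) :: E'') by rewrite (permPl p).
  case: (IH _ pE) => [[v' [D' [E1'' [E2'' [q1 q2 H1 H2 H3]]]]]|[k' [E2'' [q2 H1 H3]]]].
    by left; exists v', D', E1'', E2''; split=> //; perm_solve.
  right; exists k', E2''; split=> //; first by perm_solve.
  exact: comp_perm H3 p1 _ _.
Qed.

Lemma comp_nil_inv E1 E2 E : comp E1 E2 E -> E = [::] -> E1 = [::] /\ E2 = [::].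
Proof.
elim=> {E1 E2 E} // E1 E2 E E1' E2' E' _ IH p1 p2 p e; subst.
move/perm_nilP: p => /IH[? ?]; subst.
by rewrite perm_sym in p1; rewrite perm_sym in p2; rewrite (perm_nilP p1) (perm_nilP p2).
Qed.

(** Lets a weak composition of the composite items be pulled back to both factors, as an application
    requires in the backward direction. *)
Lemma comp_split E1 E2 E A B : comp E1 E2 E -> perm_eq E (A ++ B) ->
  exists A1 B1 A2 B2, [/\ perm_eq E1 (A1 ++ B1), perm_eq E2 (A2 ++ B2),
    comp A1 A2 A & comp B1 B2 B].
Proof.
elim: A E1 E2 E => [|[k w] A IH] E1 E2 E HE p.
  exists [::], E1, [::], E2; split=> //; first exact: comp_nil.
  exact: comp_perm HE _ _ p.
case: (comp_cons_inv HE p) =>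
    [[v [D [E1' [E2' [p1 p2 H1 H2 H3]]]]]|[k' [E2' [p2 H1 H3]]]].
  have [A1 [B1 [A2 [B2 [q1 q2 HA HB]]]]] := IH _ _ _ H3 (perm_refl _).
  exists ((k, v) :: A1), B1, (D ++ A2), B2; split=> //; [perm_solve|perm_solve|].
  exact: comp_old.
have [A1 [B1 [A2 [B2 [q1 q2 HA HB]]]]] := IH _ _ _ H3 (perm_refl _).
exists A1, B1, ((k', w) :: A2), B2; split=> //; first by perm_solve.
exact: comp_new.
Qed.

(** On a bag of items of a single key, [comp] amounts to [subs] if s1 consumes the key, and to a
    change of key if s1 passes it on. This describes the bag to which a named subterm is applied. *)
Lemma comp_tag_old k B E2 D : valid s1 k -> subs s2 B E2 D ->
  comp (tag k B) E2 (tag k D).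
Proof.
move=> Hk; elim: B E2 D => [|v B IH] E2 D.
  by move=> /subs_inv_nil[-> ->]; constructor.
move=> /subs_inv_cons[E0 [E1 [u [D' [pE H1 H2 ->]]]]] /=.
apply: comp_perm (comp_old Hk H1 (IH _ _ H2)) _ _ _ => //.
by rewrite perm_sym.
Qed.

Lemma comp_tag_old_inv k E1 E2 D : valid s1 k -> comp E1 E2 (tag k D) ->
  exists2 B, perm_eq E1 (tag k B) & subs s2 B E2 D.
Proof.
move=> Hk; elim: D E1 E2 => [|w D IH] E1 E2 H /=.
  by have [-> ->] := comp_nil_inv H erefl; exists [::] => //; constructor.
case: (comp_cons_inv H (perm_refl _)) =>
    [[v [X [E1' [E2' [p1 p2 _ H2 /IH[B pB HB]]]]]]|[k' [E2' [_ /rekey_valid]]]] //.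
exists (v :: B); first by rewrite (permPl p1) perm_cons.
exact: subs_cons H2 HB.
Qed.

Lemma comp_tag_new k k' D : rekey s1 k k' -> comp [::] (tag k' D) (tag k D).
Proof. by move=> Hk; elim: D => [|w D IH] /=; constructor. Qed.

Lemma comp_tag_new_inv k k' E1 E2 D : rekey s1 k k' -> comp E1 E2 (tag k D) ->
  E1 = [::] /\ perm_eq E2 (tag k' D).
Proof.
move=> Hk; elim: D E1 E2 => [|w D IH] E1 E2 H /=.
  by have [-> ->] := comp_nil_inv H erefl.
case: (comp_cons_inv H (perm_refl _)) =>
    [[v [X [E1' [E2' [_ _ /(rekey_valid Hk)]]]]]|[k2 [E2' [p2 H1 /IH[-> p]]]]] //.
by split=> //; rewrite (permPl p2) (rekey_fun Hk H1) perm_cons -(rekey_fun Hk H1).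
Qed.

End Comp.

Lemma valid_sq f g s s' k : sq f g s s' -> valid s' (kmap f g k) <-> valid s k.
Proof.
case=> H1 H2 H3; case: k => [x|a] /=; last by rewrite H3.
by rewrite H1; case: (vr s x).
Qed.

Lemma comp_ren f g s1 s1' s2 s2' E1 E2 E : sq f g s1 s1' -> sq f g s2 s2' ->
  comp s1 s2 E1 E2 E -> comp s1' s2' (ritems f g E1) (ritems f g E2) (ritems f g E).
Proof.
move=> q1 q2; elim=> {E1 E2 E} /=.
- exact: comp_nil.
- move=> k v w D E1 E2 E Hk Hv _ IH; rewrite map_cat; apply: comp_old => //.
    exact/(valid_sq _ q1).
  exact: sub_ren Hv.
- move=> k k' w E1 E2 E Hk _ IH; apply: comp_new => //.
  case: q1 => Hv Hn Ha; case: k k' Hk => [x|a] [y|b] //=.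
    by rewrite Hv => ->.
  by rewrite Ha Hn => -[-> ->].
- move=> E1 E2 E E1' E2' E' _ IH p1 p2 p.
  by apply: comp_perm IH _ _ _; apply: perm_map.
Qed.

(** The key of a new item in the composite is only known through its image under s1'; the hypothesis
    on [rekey] says that it is a renamed key too. For a shift this holds because the bound index is
    sent to itself. *)
Lemma comp_ren_inv f g s1 s1' s2 s2' E1 E2 X :
  injective f -> injective g -> sq f g s1 s1' -> sq f g s2 s2' ->
  (forall k k', rekey s1' k (kmap f g k') ->
     exists2 k0, k = kmap f g k0 & rekey s1 k0 k') ->
  comp s1' s2' (ritems f g E1) (ritems f g E2) X ->
  exists2 E, X = ritems f g E & comp s1 s2 E1 E2 E.
Proof.
move=> fi gi q1 q2 Hr; move e1: (ritems f g E1) => X1; move e2: (ritems f g E2) => X2 H.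
elim: H E1 E2 e1 e2 => {X1 X2 X}.
- by move=> [|//] [|//] _ _; exists [::] => //; exact: comp_nil.
- move=> k v w D X1 X2 X Hk Hv _ IH [|[k0 v0] E1] //= E2 [? ? e1]; subst.
  move=> /map_eq_cat[D0 [E2' [? ? ?]]]; subst.
  have [E -> HE] := IH E1 E2' erefl erefl.
  have [u Hu ->] := sub_ren_inv fi gi q2 Hv.
  exists ((k0, u) :: E) => //; apply: comp_old => //.
  exact/(valid_sq _ q1).
- move=> k k' w X1 X2 X Hk _ IH E1 [|[k0 v0] E2] //= e1 [? ? ?]; subst.
  have [E -> HE] := IH E1 E2 erefl erefl.
  have [k1 -> Hk1] := Hr _ _ Hk.
  by exists ((k1, v0) :: E) => //; apply: comp_new.
- move=> X1 X2 X X1' X2' X' _ IH p1 p2 p E1 E2 ? ?; subst.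
  rewrite perm_sym in p1; rewrite perm_sym in p2.
  have [E1' p1' e1'] := perm_map_eq p1; have [E2' p2' e2'] := perm_map_eq p2.
  have [E ? HE] := IH _ _ (esym e1') (esym e2'); subst.
  have [E' pE ->] := perm_map_eq p; exists E' => //.
  by apply: comp_perm HE _ _ pE; rewrite perm_sym.
Qed.

Lemma comp_upv_inv s1 s2 E1 E2 X :
  comp (upv s1) (upv s2) (ritems succn id E1) (ritems succn id E2) X ->
  exists2 E, X = ritems succn id E & comp s1 s2 E1 E2 E.
Proof.
apply: comp_ren_inv => //; try exact: succn_inj; try exact: sq_succ_upv.
move=> [[|x]|a] [y|b] //=.
  by case e: (vr s1 x) => [z|] //= [<-]; exists (inl x).
by exists (inr a).
Qed.

Lemma comp_upn_inv s1 s2 E1 E2 X :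
  comp (upn s1) (upn s2) (ritems id succn E1) (ritems id succn E2) X ->
  exists2 E, X = ritems id succn E & comp s1 s2 E1 E2 E.
Proof.
apply: comp_ren_inv => //; try exact: succn_inj; try exact: sq_succ_upn.
move=> [x|[|a]] [y|b] //=; [by exists (inl x)|by case|].
by move=> [e [<-]]; exists (inr a).
Qed.

Definition comp_upv s1 s2 E1 E2 E :=
  @comp_ren succn id s1 (upv s1) s2 (upv s2) E1 E2 E (sq_succ_upv s1) (sq_succ_upv s2).

Definition comp_upn s1 s2 E1 E2 E :=
  @comp_ren id succn s1 (upn s1) s2 (upn s2) E1 E2 E (sq_succ_upn s1) (sq_succ_upn s2).

Definition fwd_for (t : rterm) : Prop := forall s1 s2 s E1 t1 E2 u,
  iscomp s1 s2 s -> sub s1 t E1 t1 -> sub s2 t1 E2 u ->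
  exists2 E, comp s1 s2 E1 E2 E & sub s t E u.

Lemma subs_fwd_aux B : (forall v, v \in B -> fwd_for v) ->
  forall s1 s2 s E1 B1 E2 D,
  iscomp s1 s2 s -> subs s1 B E1 B1 -> subs s2 B1 E2 D ->
  exists2 E, comp s1 s2 E1 E2 E & subs s B E D.
Proof.
elim: B => [|v B IH] HB s1 s2 s E1 B1 E2 D c.
  move=> /subs_inv_nil[-> ->] /subs_inv_nil[-> ->].
  by exists [::]; constructor.
move=> /subs_inv_cons[X1 [Y1 [v1 [B1' [p1 H1 H2 ->]]]]].
move=> /subs_inv_cons[X2 [Y2 [v2 [B2' [p2 H3 H4 ->]]]]].
have [X cX sX] := HB v (mem_head _ _) _ _ _ _ _ _ _ c H1 H3.
have [Y cY sY] := IH (fun w wB => HB w (mem_behead (s := v :: B) wB)) _ _ _ _ _ _ _ c H2 H4.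
exists (X ++ Y); last by apply: subs_cons sX sY.
by apply: comp_perm (comp_cat cX cY) _ _ _; rewrite // perm_sym.
Qed.

(** Three cases: h is applied by s1, and s2 then works inside the new bag; or its image is applied
    by s2; or neither happens. The fourth case is excluded by [iscomp]. *)
Lemma subn_fwd_aux t : fwd_for t -> forall s1 s2 s h E1 t1 E2 u,
  iscomp s1 s2 s -> subn s1 h t E1 t1 -> subn s2 (nr s1 h) t1 E2 u ->
  exists2 E, comp s1 s2 E1 E2 E & subn s h t E u.
Proof.
move=> IH s1 s2 s h E1 t1 E2 u c /subn_inv.
have [_ _ /(_ h) Ha /(_ h) Hn] := c.
case: ifP Ha Hn => e1 Ha Hn.
  move=> [X1 [B [t1' [p1 H1 ->]]]] /subn_inv; rewrite (Hn isT).
  move=> /sub_inv_app[X2 [Y2 [u' [D [p2 H2 H3 ->]]]]].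
  have [X cX sX] := IH _ _ _ _ _ _ _ c H1 H2.
  exists (X ++ tag (inr h) D); last by apply: subn_app sX.
  apply: comp_perm (comp_cat cX (comp_tag_old (k := inr h) e1 H3)) _ _ _ => //;
    by rewrite perm_sym.
move=> H1 /subn_inv; case: ifP Ha => e2 Ha.
  move=> [X2 [D [u' [p2 H2 ->]]]].
  have [X cX sX] := IH _ _ _ _ _ _ _ c H1 H2.
  exists (X ++ tag (inr h) D); last by apply: subn_app sX.
  have r : rekey s1 (inr h) (inr (nr s1 h)) by [].
  apply: comp_perm (comp_cat cX (comp_tag_new s2 D r)) _ _ _; rewrite ?cats0 //.
  by rewrite perm_sym.
move=> H2; have [X cX sX] := IH _ _ _ _ _ _ _ c H1 H2.
by exists X => //; apply: subn_keep.
Qed.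

Lemma sub_fwd t : fwd_for t.
Proof.
elim/rterm_ind: t => [x|t IH|t B IH IHB|h t IH] s1 s2 s E1 t1 E2 u c.
- have [/(_ x) Hv _ _ _] := c; move=> /sub_inv_var.
  case e: (vr s1 x) Hv => [y|] /= Hv.
    move=> [-> ->] /sub_inv_var; case e': (vr s2 y) Hv => [z|] Hv.
      by move=> [-> ->]; exists [::]; constructor.
    move=> ->; exists [:: (inl x, u)]; last by constructor.
    by apply: comp_new; last exact: comp_nil.
  move=> -> H; exists [:: (inl x, u)]; last by constructor.
  by rewrite -[E2]cats0; apply: comp_old => //; exact: comp_nil.
- move=> /sub_inv_lam[t1' H1 ->] /sub_inv_lam[u' H2 ->].
  have [X /comp_upv_inv[E -> cE] sX] := IH _ _ _ _ _ _ _ (iscomp_upv c) H1 H2.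
  by exists E => //; constructor.
- move=> /sub_inv_app[X1 [Y1 [v1 [B1 [p1 H1 H2 ->]]]]].
  move=> /sub_inv_app[X2 [Y2 [v2 [B2 [p2 H3 H4 ->]]]]].
  have [X cX sX] := IH _ _ _ _ _ _ _ c H1 H3.
  have [Y cY sY] := subs_fwd_aux IHB c H2 H4.
  exists (X ++ Y); last by apply: sub_app sX sY.
  by apply: comp_perm (comp_cat cX cY) _ _ _; rewrite // perm_sym.
- move=> /sub_inv_mu[t1' H1 ->] /sub_inv_mu[u' H2 ->].
  have c' := iscomp_upn c.
  have [X /comp_upn_inv[E -> cE] sX] := subn_fwd_aux IH c' H1 H2.
  by exists E => //; case: c' => _ <- _ _; constructor.
Qed.

Lemma subn_fwd t s1 s2 s h E1 t1 E2 u :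
  iscomp s1 s2 s -> subn s1 h t E1 t1 -> subn s2 (nr s1 h) t1 E2 u ->
  exists2 E, comp s1 s2 E1 E2 E & subn s h t E u.
Proof. exact: (subn_fwd_aux (@sub_fwd t)). Qed.

Definition bwd_for (t : rterm) : Prop := forall s1 s2 s E1 E2 E u,
  iscomp s1 s2 s -> comp s1 s2 E1 E2 E -> sub s t E u ->
  exists2 t1, sub s1 t E1 t1 & sub s2 t1 E2 u.

Lemma subs_bwd_aux B : (forall v, v \in B -> bwd_for v) ->
  forall s1 s2 s E1 E2 E D,
  iscomp s1 s2 s -> comp s1 s2 E1 E2 E -> subs s B E D ->
  exists2 B1, subs s1 B E1 B1 & subs s2 B1 E2 D.
Proof.
elim: B => [|v B IH] HB s1 s2 s E1 E2 E D c cE.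
  move=> /subs_inv_nil[e ->]; have [-> ->] := comp_nil_inv cE e.
  by exists [::]; constructor.
move=> /subs_inv_cons[X [Y [w [B' [p H1 H2 ->]]]]].
have [X1 [Y1 [X2 [Y2 [p1 p2 cX cY]]]]] := comp_split cE p.
have [v1 a1 a2] := HB v (mem_head _ _) _ _ _ _ _ _ _ c cX H1.
have [B1 b1 b2] := IH (fun w wB => HB w (mem_behead (s := v :: B) wB)) _ _ _ _ _ _ _ c cY H2.
by exists (v1 :: B1); [apply: subs_cons a1 b1|apply: subs_cons a2 b2].
Qed.

Lemma subn_bwd_aux t : bwd_for t -> forall s1 s2 s h E1 E2 E u,
  iscomp s1 s2 s -> comp s1 s2 E1 E2 E -> subn s h t E u ->
  exists2 t1, subn s1 h t E1 t1 & subn s2 (nr s1 h) t1 E2 u.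
Proof.
move=> IH s1 s2 s h E1 E2 E u c cE /subn_inv.
have [_ _ /(_ h) Ha /(_ h) Hn] := c.
case e1: (ap s1 h) Ha Hn => /= Ha Hn; rewrite Ha.
  move=> [X [D [u' [p H ->]]]].
  have [X1 [Y1 [X2 [Y2 [p1 p2 cX cY]]]]] := comp_split cE p.
  have [v1 a1 a2] := IH _ _ _ _ _ _ _ c cX H.
  have [B pB sB] := comp_tag_old_inv (k := inr h) e1 cY.
  exists (qApp v1 B); first by apply: subn_app a1 => //; perm_solve.
  by apply: subn_keep; [exact: Hn|apply: sub_app a2 sB].
case: ifP => e2.
  move=> [X [D [u' [p H ->]]]].
  have [X1 [Y1 [X2 [Y2 [p1 p2 cX cY]]]]] := comp_split cE p.
  have [v1 a1 a2] := IH _ _ _ _ _ _ _ c cX H.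
  have r : rekey s1 (inr h) (inr (nr s1 h)) by [].
  have [? pY] := comp_tag_new_inv r cY; subst.
  exists v1; last by apply: subn_app a2 => //; perm_solve.
  by apply: subn_keep => //; apply: sub_perm a1; rewrite perm_sym -(cats0 X1).
move=> H; have [v1 a1 a2] := IH _ _ _ _ _ _ _ c cE H.
by exists v1; apply: subn_keep.
Qed.

(** The composition of the items prescribes how each weak composition of E arises from one of E1 and
    one of E2, so the intermediate term can be built along t. *)
Lemma sub_bwd t : bwd_for t.
Proof.
elim/rterm_ind: t => [x|t IH|t B IH IHB|h t IH] s1 s2 s E1 E2 E u c cE.
- have [/(_ x) Hv _ _ _] := c; move=> /sub_inv_var.
  case e: (vr s1 x) Hv => [y|] /= Hv; rewrite Hv.
    case e': (vr s2 y) Hv => [z|] Hv.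
      move=> [e0 ->]; have [-> ->] := comp_nil_inv cE e0.
      by exists (qVar y); constructor.
    move=> eE; subst E.
    have r : rekey s1 (inl x) (inl y) by [].
    have [-> pE] := comp_tag_new_inv (D := [:: u]) r cE.
    exists (qVar y); first by constructor.
    by apply: sub_perm (sub_hit u e'); rewrite perm_sym.
  move=> eE; subst E.
  have [[|v [|? ?]] pE sE] := comp_tag_old_inv (k := inl x) (D := [:: u]) e cE.
  + by have [] := subs_inv_nil sE.
  + have [X [Y [w [D [pX H /subs_inv_nil[? ?] [?]]]]]] := subs_inv_cons sE; subst.
    exists v; first by apply: sub_perm (sub_hit v e); rewrite perm_sym.
    by apply: sub_perm H; rewrite perm_sym -(cats0 X).
  + have [X [Y [w [D [pX H /subs_inv_cons[? [? [? [? [_ _ _ ->]]]]]]]]]] := subs_inv_cons sE.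
    by [].
- move=> /sub_inv_lam[u' H ->].
  have [v a1 a2] := IH _ _ _ _ _ _ _ (iscomp_upv c) (comp_upv cE) H.
  by exists (qLam v); constructor.
- move=> /sub_inv_app[X [Y [w [B' [p H1 H2 ->]]]]].
  have [X1 [Y1 [X2 [Y2 [p1 p2 cX cY]]]]] := comp_split cE p.
  have [v1 a1 a2] := IH _ _ _ _ _ _ _ c cX H1.
  have [B1 b1 b2] := subs_bwd_aux IHB c cY H2.
  by exists (qApp v1 B1); [apply: sub_app a1 b1|apply: sub_app a2 b2].
- move=> /sub_inv_mu[u' H ->]; have c' := iscomp_upn c.
  have [v a1 a2] := subn_bwd_aux IH c' (comp_upn cE) H.
  exists (qMu (nr (upn s1) h) v); first by constructor.
  by case: c' => _ -> _ _; constructor.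
Qed.

Lemma subn_bwd t s1 s2 s h E1 E2 E u :
  iscomp s1 s2 s -> comp s1 s2 E1 E2 E -> subn s h t E u ->
  exists2 t1, subn s1 h t E1 t1 & subn s2 (nr s1 h) t1 E2 u.
Proof. exact: (subn_bwd_aux (@sub_bwd t)). Qed.


(** * Commuting a substitution with the reduction rules *)

Lemma sub_valid s t E u : sub s t E u -> forall e, e \in E -> valid s e.1.
Proof.
elim/rterm_ind: t s E u => [x|t IH|t B IH IHB|h t IH] s E u.
- move=> /sub_inv_var; case e: (vr s x) => [y|] => [[-> _] //|-> ?].
  by rewrite inE => /eqP ->.
- move=> /sub_inv_lam[u' H _] e eE.
  by apply/(valid_sq _ (sq_succ_upv s)); apply: (IH _ _ _ H (ritem _ _ e)); apply: map_f.
- move=> /sub_inv_app[E0 [E1 [u' [D [pE H1 H2 _]]]]] e.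
  rewrite (perm_mem pE) mem_cat => /orP[|]; first exact: IH H1 e.
  elim: B IHB {pE} E1 D H2 => [|v B IHB'] IHB E1 D.
    by move=> /subs_inv_nil[->].
  move=> /subs_inv_cons[X [Y [w [D' [p H3 H4 _]]]]].
  rewrite (perm_mem p) mem_cat => /orP[|]; first exact: (IHB v (mem_head _ _) _ _ _ H3 e).
  by apply: IHB' H4 => z zB; apply: IHB; rewrite in_cons zB orbT.
- move=> /sub_inv_mu[u' /subn_inv H _] e eE; apply/(valid_sq _ (sq_succ_upn s)).
  have {eE} : ritem id succn e \in ritems id succn E by apply: map_f.
  case: ifP H => [ah [E0 [D [u'' [p H _]]]]|_ H]; last exact: (IH _ _ _ H (ritem _ _ e)).
  rewrite (perm_mem p) mem_cat => /orP[/(IH _ _ _ H) //|/mapP[d _ [-> _]]].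
  exact: ah.
Qed.

Lemma subn_valid s h t E u : subn s h t E u -> forall e, e \in E -> valid s e.1.
Proof.
move=> /subn_inv; case: ifP => [ah [E0 [D [u'' [p H _]]]]|_ /sub_valid //] e.
rewrite (perm_mem p) mem_cat => /orP[/(sub_valid H) //|/mapP[d _ ->]].
exact: ah.
Qed.

Definition kitem (kk : key -> key) (phi : rterm -> rterm) (e : item) : item :=
  (kk e.1, phi e.2).

Section Inert.
Variables (s1 s2 : lsubst) (kk : key -> key) (phi phi' : rterm -> rterm).

(** The situation after a contraction: the terms of the first items have been shifted out of the
    reach of s2, which can only turn [phi v] into [phi' v], so all of [tag k' B] is new. The
    composite is thus determined up to permutation. *)
Lemma comp_inert_inv k k' E B X :
  (forall v D w, sub s2 (phi v) D w -> D = [::] /\ w = phi' v) ->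
  (forall k1, rekey s1 k1 k' -> k1 = k) ->
  comp s1 s2 (map (kitem kk phi) E) (tag k' B) X ->
  perm_eq X (map (kitem kk phi') E ++ tag k B).
Proof.
move=> Hphi Hk.
suff gen E1 E2 : comp s1 s2 E1 E2 X -> forall E B,
    perm_eq (map (kitem kk phi) E) E1 -> perm_eq (tag k' B) E2 ->
    perm_eq X (map (kitem kk phi') E ++ tag k B).
  by move=> H; apply: gen H _ _ _ _.
elim=> {E B E1 E2 X}.
- by move=> [|e E] [|b B] // /perm_size // _ /perm_size.
- move=> k0 v w D E1 E2 X _ Hv _ IH E B p1 p2.
  have : (k0, v) \in map (kitem kk phi) E by rewrite (perm_mem p1) mem_head.
  move=> /mapP[e eE [ek ev]]; subst; have [? ->] := Hphi _ _ _ Hv; subst D.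
  have pE := perm_to_rem eE.
  have p1' : perm_eq (map (kitem kk phi) (rem e E)) E1.
    by rewrite -(perm_cons (kk e.1, phi e.2)) -(permPr p1) perm_sym; apply: (perm_map _ pE).
  have pX := IH _ _ p1' p2.
  rewrite perm_sym (permPl (perm_cat (perm_map _ pE) (perm_refl _))) /= perm_sym.
  by rewrite perm_cons.
- move=> k0 k1 w E1 E2 X Hk0 _ IH E B p1 p2.
  have : (k1, w) \in tag k' B by rewrite (perm_mem p2) mem_head.
  move=> /mapP[b bB [? ?]]; subst; have ek := Hk _ Hk0; subst k0.
  have pB := perm_to_rem bB.
  have p2' : perm_eq (tag k' (rem b B)) E2.
    by rewrite -(perm_cons (k', b)) -(permPr p2) perm_sym; apply: (perm_map _ pB).
  have pX := IH _ _ p1 p2'.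
  rewrite perm_sym (permPl (perm_cat (perm_refl _) (perm_map _ pB))) /=.
  by rewrite perm_catC /= perm_cons perm_catC perm_sym.
- move=> E1 E2 X E1' E2' X' _ IH p1 p2 p E B q1 q2.
  rewrite -(permPl p); apply: IH; first by rewrite (permPl q1) perm_sym.
  by rewrite (permPl q2) perm_sym.
Qed.

Lemma comp_map_old E :
  (forall v, sub s2 (phi v) [::] (phi' v)) ->
  (forall e, e \in E -> valid s1 (kk e.1)) ->
  comp s1 s2 (map (kitem kk phi) E) [::] (map (kitem kk phi') E).
Proof.
move=> Hphi; elim: E => [|e E IH] HE /=; first exact: comp_nil.
apply: (@comp_old _ _ _ _ _ [::]); first by apply: HE; rewrite mem_head.
  exact: Hphi.
by apply: IH => z zE; apply: HE; rewrite in_cons zE orbT.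
Qed.

Lemma comp_inert k k' E B :
  (forall v, sub s2 (phi v) [::] (phi' v)) ->
  (forall e, e \in E -> valid s1 (kk e.1)) -> rekey s1 k k' ->
  comp s1 s2 (map (kitem kk phi) E) (tag k' B) (map (kitem kk phi') E ++ tag k B).
Proof.
move=> Hphi HE Hk.
have := comp_cat (comp_map_old Hphi HE) (comp_tag_new s2 B Hk).
by rewrite cats0.
Qed.

(** The situation before a contraction: the items of s1 are the bag B of the redex, and those of s2
    are shared between B, which receives Y, and the body, which receives R. The function [kk]
    inverts the change of keys made by s1. *)
Lemma comp_tag_rest_inv k E1 E2 X B :
  (forall k1 k', rekey s1 k1 k' -> k1 = kk k') ->
  comp s1 s2 E1 E2 X -> perm_eq E1 (tag k B) ->
  exists Y R D, [/\ subs s2 B Y D, perm_eq E2 (Y ++ R)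
    & perm_eq X (tag k D ++ map (kitem kk id) R)].
Proof.
move=> Hk H; elim: H B => {E1 E2 X}.
- move=> B; rewrite perm_sym => /perm_nilP; case: B => // _.
  by exists [::], [::], [::]; split=> //; constructor.
- move=> k0 v w D E1 E2 X _ Hv _ IH B p1.
  have : (k0, v) \in tag k B by rewrite -(perm_mem p1) mem_head.
  move=> /mapP[b bB [? ?]]; subst; have pB := perm_to_rem bB.
  have p1' : perm_eq E1 (tag k (rem b B)).
    by rewrite -(perm_cons (k, b)) (permPl p1); apply: (perm_map _ pB).
  have [Y [R [D' [sD p2 pX]]]] := IH _ p1'.
  rewrite perm_sym in pB.
  have [D'' sD'' pD] := subs_perm pB (subs_cons (perm_refl _) Hv sD).
  exists (D ++ Y), R, D''; split=> //; first by rewrite -catA perm_cat2l.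
  rewrite perm_sym -(permPl (perm_cat (perm_map _ pD) (perm_refl _))) /= perm_cons.
  by rewrite perm_sym.
- move=> k0 k1 w E1 E2 X /Hk -> _ IH B /IH[Y [R [D [sD p2 pX]]]].
  exists Y, ((k1, w) :: R), D; split=> //.
    by rewrite perm_sym perm_catC /= perm_cons perm_catC perm_sym.
  by rewrite /= perm_sym perm_catC /= perm_cons perm_catC perm_sym.
- move=> E1 E2 X E1' E2' X' _ IH p1 p2 p B q1.
  have {q1} q1 : perm_eq E1 (tag k B) by rewrite (permPl p1).
  have [Y [R [D [sD p2' pX]]]] := IH _ q1.
  exists Y, R, D; split=> //; first by rewrite -(permPl p2).
  by rewrite -(permPl p).
Qed.

Lemma comp_tag_rest k B Y R D :
  valid s1 k -> subs s2 B Y D -> (forall e, e \in R -> rekey s1 (kk e.1) e.1) ->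
  comp s1 s2 (tag k B) (Y ++ R) (tag k D ++ map (kitem kk id) R).
Proof.
move=> Hk sD HR; rewrite -(cats0 (tag k B)); apply: comp_cat; first exact: comp_tag_old.
elim: R HR => [|[k0 w] R IH] HR /=; first exact: comp_nil.
apply: comp_new; first exact: (HR _ (mem_head _ _)).
by apply: IH => z zR; apply: HR; rewrite in_cons zR orbT.
Qed.

End Inert.

Definition rens f g := LSubst (fun x => Some (f x)) g (fun=> false).

Lemma isren_rens f g : isren f g (rens f g).
Proof. by []. Qed.

(** If a renaming followed by s is again a renaming, s consumes nothing in renamed terms. This is
    how substitution is seen to be inert on shifted terms, by the composition law alone. *)
Lemma sub_after_ren f g f' g' s s' w D u :
  iscomp (rens f g) s s' -> isren f' g' s' ->
  sub s (qren f g w) D u <-> D = [::] /\ u = qren f' g' w.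
Proof.
move=> c r; split=> [H|[-> ->]].
  have H1 : sub (rens f g) w [::] (qren f g w).
    exact/(sub_isren _ _ _ (isren_rens f g)).
  have [E cE /(sub_isren _ _ _ r)[e ->]] := sub_fwd c H1 H; split=> //.
  by have [_ ->] := comp_nil_inv cE e.
have H : sub s' w [::] (qren f' g' w) by exact/(sub_isren _ _ _ r).
have [t1] := sub_bwd c (comp_nil _ _) H.
by move=> /(sub_isren _ _ _ (isren_rens f g))[_ ->].
Qed.

(** The contractions of the three rules as substitutions. [sbeta] removes the bound variable and
    closes the gap, [snap] keeps all names since the mu abstraction stays, and [srho] is a mere
    renaming. *)
Definition sbeta := LSubst (fun x => if x is y.+1 then Some y else None) id (fun=> false).
Definition snap a := LSubst Some id (fun b => b == a).
Definition srho a := LSubst Some (unbind a) (fun=> false).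

Notation qshv := (qren succn id).
Notation qshn := (qren id succn).

Lemma sub_sbeta_shift w D u : sub sbeta (qshv w) D u <-> D = [::] /\ u = w.
Proof.
rewrite (@sub_after_ren _ _ id id _ (rens id id)) //.
by rewrite qren_id.
Qed.

Lemma sub_snap_shift w D u : sub (snap 0) (qshn w) D u <-> D = [::] /\ u = qshn w.
Proof. exact: (@sub_after_ren _ _ id succn _ (rens id succn)). Qed.

Lemma sub_srho_shift a w D u : sub (srho a) (qshn w) D u <-> D = [::] /\ u = w.
Proof.
rewrite (@sub_after_ren _ _ id id _ (rens id id)) //.
by rewrite qren_id.
Qed.

Lemma sub_srho a t D u : sub (srho a) t D u <-> D = [::] /\ u = qren id (unbind a) t.
Proof. exact: sub_isren. Qed.

Lemma subn_srho a h t D u :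
  subn (srho a) h t D u <-> D = [::] /\ u = qren id (unbind a) t.
Proof.
split=> [/subn_inv /= /sub_srho //|H]; apply: subn_keep => //; exact/sub_srho.
Qed.

(* The composites of [upv s] with [sbeta], of [upn s] with [snap 0] and of s
   with [srho a]. *)
Definition sbeta_comp s :=
  LSubst (fun x => if x is y.+1 then vr s y else None) (nr s) (ap s).
Definition snap_comp s :=
  LSubst (vr s) (up (nr s)) (fun a => if a is b.+1 then ap s b else true).
Definition srho_comp a s :=
  LSubst (vr s) (fun b => nr s (unbind a b)) (fun b => ap s (unbind a b)).

(** Contracting after or before s has the same composite: this is the substitution lemma behind the
    critical pairs. *)
Lemma iscomp_beta_after s : iscomp (upv s) sbeta (sbeta_comp s).
Proof.
split=> //=; [by case=> // x; case: (vr s x)|by move=> a; rewrite orbF].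
Qed.

Lemma iscomp_beta_before s : iscomp sbeta s (sbeta_comp s).
Proof. by split=> // -[]. Qed.

Lemma iscomp_snap_after s : iscomp (upn s) (snap 0) (snap_comp s).
Proof.
split=> //=; [by move=> x; case: (vr s x)| |by case].
by case=> // a; rewrite orbF.
Qed.

Lemma iscomp_snap_before s : iscomp (snap 0) (upn s) (snap_comp s).
Proof. by split=> // -[]. Qed.

Lemma iscomp_rho_before a s : iscomp (srho a) s (srho_comp a s).
Proof. by []. Qed.

Lemma iscomp_rho_after a s : ap s a = false ->
  iscomp (upn s) (srho (nr s a)) (srho_comp a s).
Proof.
move=> ha; split=> //=; [by move=> x; case: (vr s x)|by case|].
by case=> [|b] /=; rewrite ?ha ?orbF.
Qed.

(** If s applies a, the name merged into a has to be applied as well. [upn s] never applies a bound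
    name, whereas [snap_comp s] applies the name 0; this accounts for the intermediate mu step. *)
Lemma iscomp_rho_after_snap a s : ap s a ->
  iscomp (snap_comp s) (srho (nr s a)) (srho_comp a s).
Proof.
move=> ha; split=> //=; [by move=> x; case: (vr s x)|by case|].
by case=> [|b] /=; rewrite ?ha ?orbF.
Qed.

Notation kshv := (kmap succn id).
Notation kshn := (kmap id succn).

Lemma map_kitem_id E : map (kitem id id) E = E.
Proof. by rewrite map_id_in // => -[]. Qed.

Lemma subs_ren f g s s' B E D : sq f g s s' -> subs s B E D ->
  subs s' (map (qren f g) B) (ritems f g E) (map (qren f g) D).
Proof. by move=> q; apply: subs_ren_aux => v _ E' u; apply: sub_ren. Qed.

Lemma subs_ren_inv f g s s' B E D : injective f -> injective g -> sq f g s s' ->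
  subs s' (map (qren f g) B) (ritems f g E) D ->
  exists2 D', subs s B E D' & D = map (qren f g) D'.
Proof.
move=> fi gi q; elim: B E D => [|v B IHB] E1 D /=.
  move=> /subs_inv_nil[eE ->]; exists [::] => //.
  by case: E1 eE => // _; constructor.
move=> /subs_inv_cons[X0 [Y0 [u1 [D' [/perm_map_eq[E' pE]]]]]].
move=> /esym/map_eq_cat[E2 [E3 [? -> ->]]] H1 H2 ->; subst E'.
have [D1 HD ->] := IHB E3 D' H2.
have [u2 Hu2 ->] := sub_ren_inv fi gi q H1.
by exists (u2 :: D1) => //; apply: subs_cons Hu2 HD.
Qed.

(** On the right the keys of E are shifted but its terms are not: both are shifted under the lambda,
    and the contraction undoes the shift of the terms. *)
Lemma beta_after s t E B v :
  (exists2 t1, sub (upv s) t (ritems succn id E) t1 & sub sbeta t1 (tag (inl 0) B) v)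
  <-> sub (sbeta_comp s) t (map (kitem kshv id) E ++ tag (inl 0) B) v.
Proof.
split=> [[t1 H1 H2]|H].
  have [X cX] := sub_fwd (iscomp_beta_after s) H1 H2; apply: sub_perm.
  apply: (comp_inert_inv (phi := qshv) _ _ cX) => [w D u /sub_sbeta_shift //|].
  by move=> [[|x]|a] //=; case: (vr s x).
apply: (sub_bwd (iscomp_beta_after s) _ H); apply: comp_inert => //.
  by move=> w; apply/sub_sbeta_shift.
move=> e eE; have /= : valid (sbeta_comp s) (kitem kshv id e).1.
  by apply: (sub_valid H); rewrite mem_cat map_f.
by case: e {eE} => -[x|a] w //= ->.
Qed.

Lemma beta_before s t E B v :
  (exists2 p, sub sbeta t (tag (inl 0) B) p & sub s p E v) <->
  (exists X R D, [/\ perm_eq E (X ++ R), subs s B X D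
     & sub (sbeta_comp s) t (map (kitem kshv id) R ++ tag (inl 0) D) v]).
Proof.
split=> [[p H1 H2]|[X [R [D [pE sD H]]]]].
  have [X cX sX] := sub_fwd (iscomp_beta_before s) H1 H2.
  have Hk k1 k' : rekey sbeta k1 k' -> k1 = kshv k'.
    by case: k1 k' => [[|x]|a] [y|b] //= => [[->]|[_ ->]].
  have [Y [R [D [sD pE pX]]]] := comp_tag_rest_inv Hk cX (perm_refl _).
  exists Y, R, D; split=> //; apply: sub_perm sX.
  by rewrite perm_sym perm_catC perm_sym.
rewrite perm_sym in pE.
have cX : comp sbeta s (tag (inl 0) B) (X ++ R)
    (tag (inl 0) D ++ map (kitem kshv id) R).
  by apply: comp_tag_rest => // -[[x|a] w].
have [|p a1 a2] := sub_bwd (t := t) (u := v) (iscomp_beta_before s) cX.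
  by apply: sub_perm H; rewrite perm_catC.
by exists p => //; apply: sub_perm a2.
Qed.

(** Here the terms of E and B stay shifted, since the mu abstraction survives its contraction. *)
Lemma snap_after s h t E B v :
  (exists2 t1, subn (upn s) h t (ritems id succn E) t1
     & subn (snap 0) (nr (upn s) h) t1 (tag (inr 0) (map qshn B)) v)
  <-> subn (snap_comp s) h t (ritems id succn E ++ tag (inr 0) (map qshn B)) v.
Proof.
split=> [[t1 H1 H2]|H].
  have [X cX] := subn_fwd (iscomp_snap_after s) H1 H2; apply: subn_perm.
  apply: (comp_inert_inv (phi := qshn) _ _ cX) => [w D u /sub_snap_shift //|].
  by move=> [x|[|a]] //= [].
apply: (subn_bwd (iscomp_snap_after s) _ H); apply: (comp_inert (phi := qshn)) => //.
  by move=> w; apply/sub_snap_shift.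
move=> e eE; have /= : valid (snap_comp s) (ritem id succn e).1.
  by apply: (subn_valid H); rewrite mem_cat map_f.
by case: e {eE} => -[x|a] w.
Qed.

Lemma snap_before s h t E B v :
  (exists2 p, subn (snap 0) h t (tag (inr 0) (map qshn B)) p
     & subn (upn s) h p (ritems id succn E) v) <->
  (exists X R D, [/\ perm_eq E (X ++ R), subs s B X D
     & subn (snap_comp s) h t (ritems id succn R ++ tag (inr 0) (map qshn D)) v]).
Proof.
split=> [[p H1 H2]|[X [R [D [pE sD H]]]]].
  have [X cX sX] := subn_fwd (iscomp_snap_before s) H1 H2.
  have Hk k1 k' : rekey (snap 0) k1 k' -> k1 = id k'.
    by case: k1 k' => [x|a] [y|b] //= => [[->]|[_ ->]].
  have [Y' [R' [D' [sD pE pX]]]] := comp_tag_rest_inv Hk cX (perm_refl _).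
  have [E' pE' /esym/map_eq_cat[Y [R [? ? ?]]]] := perm_map_eq pE; subst.
  have [D sD' ?] := subs_ren_inv (@inj_id _) succn_inj (sq_succ_upn s) sD; subst.
  exists Y, R, D; split=> //; apply: subn_perm sX.
  by rewrite (permPl pX) map_kitem_id perm_catC.
rewrite perm_sym in pE.
have cX : comp (snap 0) (upn s) (tag (inr 0) (map qshn B))
    (ritems id succn X ++ ritems id succn R)
    (tag (inr 0) (map qshn D) ++ map (kitem id id) (ritems id succn R)).
  apply: comp_tag_rest => //; first exact: subs_ren (sq_succ_upn s) sD.
  by move=> e /mapP[[[x|a] w] _ ->].
have [|p a1 a2] := subn_bwd (t := t) (u := v) (h := h) (iscomp_snap_before s) cX.
  by apply: subn_perm H; rewrite map_kitem_id perm_catC.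
by exists p => //; apply: subn_perm a2; rewrite -map_cat perm_map.
Qed.

Lemma rho_after a s h t E v : ap s a = false ->
  (exists2 t1, subn (upn s) h t (ritems id succn E) t1 & v = qren id (unbind (nr s a)) t1)
  <-> subn (srho_comp a s) h t (map (kitem kshn id) E) v.
Proof.
move=> ha; have c := iscomp_rho_after ha; split=> [[t1 H1 ->]|H].
  have H2 : subn (srho (nr s a)) (nr (upn s) h) t1 [::] (qren id (unbind (nr s a)) t1).
    exact/subn_srho.
  have [X cX] := subn_fwd c H1 H2; apply: subn_perm.
  rewrite -[X in perm_eq _ X]cats0.
  apply: (comp_inert_inv (phi := qshn) (k := inr 0) (k' := inr 0) (B := [::]) _ _ cX)
    => [w D u /sub_srho_shift //|].
  by move=> [x|[|b]] //= [].
have cX : comp (upn s) (srho (nr s a)) (ritems id succn E) [::] (map (kitem kshn id) E).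
  apply: (comp_map_old (phi := qshn)); first by move=> w; apply/sub_srho_shift.
  move=> e eE; have /= : valid (srho_comp a s) (kitem kshn id e).1.
    by apply: (subn_valid H); rewrite map_f.
  by case: e {eE} => -[x|b] w.
have [t1 a1 /subn_srho[_ ->]] := subn_bwd c cX H.
by exists t1.
Qed.

Lemma rho_after_snap a s h t E B v : ap s a ->
  (exists2 t1, subn (snap_comp s) h t (ritems id succn E ++ tag (inr 0) (map qshn B)) t1
     & v = qren id (unbind (nr s a)) t1)
  <-> subn (srho_comp a s) h t (map (kitem kshn id) E ++ tag (inr 0) B) v.
Proof.
move=> ha; have c := iscomp_rho_after_snap ha.
set E' := map (kitem kshn id) E ++ _.
have -> : ritems id succn E ++ tag (inr 0) (map qshn B) = map (kitem id qshn) E'.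
  by rewrite /E' map_cat -!map_comp.
split=> [[t1 H1 ->]|H].
  have H2 : subn (srho (nr s a)) (nr (snap_comp s) h) t1 [::]
              (qren id (unbind (nr s a)) t1) by exact/subn_srho.
  have [X cX] := subn_fwd c H1 H2; apply: subn_perm.
  rewrite -(map_kitem_id E') -[X in perm_eq _ X]cats0.
  apply: (comp_inert_inv (phi := qshn) (k := inr 0) (k' := inr 0) (B := [::]) _ _ cX)
    => [w D u /sub_srho_shift //|].
  by move=> [x|[|b]] //= [].
have cX : comp (snap_comp s) (srho (nr s a)) (map (kitem id qshn) E') [::] E'.
  rewrite -{2}(map_kitem_id E'); apply: comp_map_old => [w|e eE].
    by apply/sub_srho_shift.
  have := subn_valid H eE; case: e {eE} => -[x|[|b]] w //=.
have [t1 a1 /subn_srho[_ ->]] := subn_bwd c cX H.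
by exists t1.
Qed.

(** After the merge, an item of key [inr a] may serve an occurrence of a or one of the former name
    0; D collects the items of the latter kind. *)
Lemma comp_srho_inv a s E1 E X : comp (srho a) s E1 E X -> E1 = [::] ->
  exists E0 D, perm_eq E (E0 ++ tag (inr a) D) /\
    perm_eq X (map (kitem kshn id) E0 ++ tag (inr 0) D).
Proof.
elim=> {E1 E X} //.
- by move=> _; exists [::], [::].
- move=> k k' w E1 E X Hk _ IH /IH[E0 [D [pE pX]]].
  have [->|[-> ->]] : k = kshn k' \/ k = inr 0 /\ k' = inr a.
    case: k k' Hk => [x|[|b]] [y|c] //=; first by case=> ->; left.
      by move=> [_ ->]; right.
    by move=> [_ ->]; left.
    by exists ((k', w) :: E0), D; rewrite /= !perm_cons.
  exists E0, (w :: D); split; rewrite /= perm_sym perm_catC /= perm_cons perm_catC perm_sym //.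
- move=> E1 E X E1' E' X' _ IH p1 p2 p e; subst.
  move/perm_nilP: p1 => /IH[E0 [D [pE pX]]].
  exists E0, D; split; first by rewrite -(permPl p2).
  by rewrite -(permPl p).
Qed.

Lemma rho_before a s h t E v :
  subn s (unbind a h) (qren id (unbind a) t) E v <->
  (exists E0 D, perm_eq E (E0 ++ tag (inr a) D) /\
     subn (srho_comp a s) h t (map (kitem kshn id) E0 ++ tag (inr 0) D) v).
Proof.
have c := iscomp_rho_before a s.
split=> [H|[E0 [D [pE H]]]].
  have H1 : subn (srho a) h t [::] (qren id (unbind a) t) by exact/subn_srho.
  have [X cX sX] := subn_fwd c H1 H.
  have [E0 [D [pE pX]]] := comp_srho_inv cX erefl.
  by exists E0, D; split=> //; apply: subn_perm sX.
have cX : comp (srho a) s [::] E (map (kitem kshn id) E0 ++ tag (inr 0) D).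
  rewrite perm_sym in pE.
  have r : rekey (srho a) (inr 0) (inr a) by [].
  have cR : comp (srho a) s [::] E0 (map (kitem kshn id) E0).
    elim: E0 {pE H} => [|[[x|b] w] E0 IH] /=; first exact: comp_nil.
      exact: comp_new.
    exact: comp_new.
  apply: comp_perm (comp_cat cR (comp_tag_new s D r)) _ pE _; rewrite //.
have [t1 /subn_srho[_ ->] //] := subn_bwd c cX H.
Qed.


(** * Reduction and local confluence *)

Definition img (K : rterm -> rterm) (P : rterm -> Prop) (u : rterm) : Prop :=
  exists2 v, P v & u = K v.

Definition beta_set (t : rterm) (B : seq rterm) (u : rterm) : Prop :=
  sub sbeta t (tag (inl 0) B) u.

Definition mu_set (h : nat) (t : rterm) (B : seq rterm) (u : rterm) : Prop :=
  exists2 w, subn (snap 0) h t (tag (inr 0) (map qshn B)) w & u = qMu h w.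

Definition rho_term (a h : nat) (t : rterm) : rterm :=
  qMu (unbind a h) (qren id (unbind a) t).

(** Since bags are taken up to permutation, a step inside a bag may be assumed to act on its head.
    The reduct is a predicate, as only membership of summands is tested. *)
Inductive qstep : rterm -> (rterm -> Prop) -> Prop :=
| qstep_beta t B : qstep (qApp (qLam t) B) (beta_set t B)
| qstep_mu h t B : qstep (qApp (qMu h t) B) (mu_set h t B)
| qstep_rho a h t : qstep (qMu a (qMu h t)) (eq^~ (rho_term a h t))
| qstep_in_lam t P : qstep t P -> qstep (qLam t) (img qLam P)
| qstep_in_fun t P B : qstep t P -> qstep (qApp t B) (img (qApp^~ B) P)
| qstep_in_bag t v P B : qstep v P ->
    qstep (qApp t (v :: B)) (img (fun x => qApp t (x :: B)) P)
| qstep_in_mu b t P : qstep t P -> qstep (qMu b t) (img (qMu b) P).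

Lemma qstep_inv_lam t P : qstep (qLam t) P ->
  exists2 P0, qstep t P0 & P = img qLam P0.
Proof.
move et: (qLam t) => t0 H; case: H et.
- by move=> t1 B; shape_discr.
- by move=> h t1 B; shape_discr.
- by move=> a h t1; shape_discr.
- by move=> t1 P1 H /qLam_inj ->; exists P1.
- by move=> t1 P1 B _; shape_discr.
- by move=> t1 v P1 B _; shape_discr.
- by move=> b t1 P1 _; shape_discr.
Qed.

Lemma qstep_inv_mu b t P : qstep (qMu b t) P ->
  (exists h t', t = qMu h t' /\ P = eq^~ (rho_term b h t')) \/
  (exists2 P0, qstep t P0 & P = img (qMu b) P0).
Proof.
move et: (qMu b t) => t0 H; case: H et.
- by move=> t1 B; shape_discr.
- by move=> h t1 B; shape_discr.
- by move=> a h t1 /qMu_inj[-> ->]; left; exists h, t1.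
- by move=> t1 P1 _; shape_discr.
- by move=> t1 P1 B _; shape_discr.
- by move=> t1 v P1 B _; shape_discr.
- by move=> b0 t1 P1 H /qMu_inj[-> ->]; right; exists P1.
Qed.

Lemma qstep_inv_app t B P : qstep (qApp t B) P ->
  [\/ exists t0 B', [/\ t = qLam t0, perm_eq B B' & P = beta_set t0 B'],
      exists h t0 B', [/\ t = qMu h t0, perm_eq B B' & P = mu_set h t0 B'],
      exists P0 B', [/\ qstep t P0, perm_eq B B' & P = img (qApp^~ B') P0]
    | exists v B' P0, [/\ qstep v P0, perm_eq B (v :: B')
        & P = img (fun x => qApp t (x :: B')) P0]].
Proof.
move et: (qApp t B) => t0 H; case: H et.
- by move=> t1 B1 /qApp_eq[? ?]; constructor 1; exists t1, B1.
- by move=> h t1 B1 /qApp_eq[? ?]; constructor 2; exists h, t1, B1.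
- by move=> a h t1; shape_discr.
- by move=> t1 P1 _; shape_discr.
- by move=> t1 P1 B1 H /qApp_eq[-> ?]; constructor 3; exists P1, B1.
- by move=> t1 v P1 B1 H /qApp_eq[-> ?]; constructor 4; exists v, B1, P1.
- by move=> b t1 P1 _; shape_discr.
Qed.

Lemma qstep_inv_var x P : ~ qstep (qVar x) P.
Proof.
move et: (qVar x) => t0 H; case: H et.
- by move=> t1 B; shape_discr.
- by move=> h t1 B; shape_discr.
- by move=> a h t1; shape_discr.
- by move=> t1 P1 _; shape_discr.
- by move=> t1 P1 B _; shape_discr.
- by move=> t1 v P1 B _; shape_discr.
- by move=> b t1 P1 _; shape_discr.
Qed.

(** * Predicates invariant under reduction *)

Definition red1 (t u : rterm) : Prop := exists2 P, qstep t P & P u.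
Definition reach : rterm -> rterm -> Prop := clos_refl_trans _ red1.

(* N plays the part of "s is in the normal form of _" for a fixed s. *)
Definition invariant_at (N : rterm -> Prop) (t : rterm) : Prop :=
  forall P, qstep t P -> (N t <-> exists2 x, P x & N x).

Definition hinv (N : rterm -> Prop) (t : rterm) : Prop :=
  forall u, reach t u -> invariant_at N u.

(** What an induction on the reducts of t provides: invariance everywhere below t, but not yet at t
    itself, where it expresses local confluence. *)
Definition shinv (N : rterm -> Prop) (t : rterm) : Prop :=
  forall u, red1 t u -> hinv N u.

Lemma hinv_at N t : hinv N t -> invariant_at N t.
Proof. by apply; exact: rt_refl. Qed.

Lemma hinv_red N t u : hinv N t -> red1 t u -> hinv N u.
Proof. by move=> H tu v uv; apply: H; apply: rt_trans uv; apply: rt_step. Qed.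

Lemma hinv_shinv N t : invariant_at N t -> shinv N t -> hinv N t.
Proof.
move=> H1 H2 u tu; have := clos_rt_rt1n _ _ _ _ tu.
case=> [//|v w tv vw]; exact: (H2 _ tv _ (clos_rt1n_rt _ _ _ _ vw)).
Qed.

Definition stepctx (K : rterm -> rterm) : Prop :=
  forall t P, qstep t P -> qstep (K t) (img K P).

Lemma stepctx_lam : stepctx qLam.
Proof. by move=> t P; constructor. Qed.

Lemma stepctx_mu b : stepctx (qMu b).
Proof. by move=> t P; constructor. Qed.

Lemma stepctx_fun B : stepctx (qApp^~ B).
Proof. by move=> t P; constructor. Qed.

Lemma stepctx_bag t B : stepctx (fun x => qApp t (x :: B)).
Proof. by move=> v P; constructor. Qed.

Lemma red1_ctx K t u : stepctx K -> red1 t u -> red1 (K t) (K u).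
Proof. by move=> hK [P H Pu]; exists (img K P); [exact: hK | exists u]. Qed.

Lemma reach_ctx K t u : stepctx K -> reach t u -> reach (K t) (K u).
Proof.
move=> hK; elim=> [x y H|x|x y z _ H1 _ H2]; first by apply: rt_step; apply: red1_ctx.
  exact: rt_refl.
exact: rt_trans H1 H2.
Qed.

Lemma ex_img N K P : (exists2 x, img K P x & N x) <-> exists2 x, P x & N (K x).
Proof. by split=> [[x [y Py ->]]|[y Py Ny]]; [exists y | exists (K y) => //; exists y]. Qed.

Lemma hinv_ctx N K t : stepctx K -> hinv N (K t) -> hinv (N \o K) t.
Proof.
move=> hK H u tu P HP; have := H _ (reach_ctx hK tu) _ (hK _ _ HP).
by rewrite ex_img.
Qed.

Lemma shinv_ctx N K t : stepctx K -> shinv N (K t) -> shinv (N \o K) t.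
Proof. by move=> hK H u tu; apply: hinv_ctx => //; apply: H; apply: red1_ctx. Qed.

(** A step from t to P may be made before or after any substitution, as far as N can tell. *)
Definition compat (t : rterm) (P : rterm -> Prop) : Prop := forall s E N,
  (forall u, sub s t E u -> hinv N u) ->
  (exists2 u, sub s t E u & N u) <->
  (exists2 p, P p & exists2 u, sub s p E u & N u).

(** The variant for the named body of a mu abstraction. Q relates names as well as terms, because
    merging two mu abstractions changes the name of the body. *)
Definition compatn (h : nat) (t : rterm) (Q : nat -> rterm -> Prop) : Prop :=
  forall s E N,
  (forall u, subn s h t E u -> hinv N (qMu (nr s h) u)) ->
  (exists2 u, subn s h t E u & N (qMu (nr s h) u)) <->
  (exists h' p, Q h' p /\ exists2 u, subn s h' p E u & N (qMu (nr s h') u)).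

Lemma compatn_in h t P : compat t P -> compatn h t (fun h' t' => h' = h /\ P t').
Proof.
move=> c s E N HN; case ah: (ap s h); last first.
  have := c s E (N \o qMu (nr s h)).
  have -> : (exists2 u, sub s t E u & (N \o qMu (nr s h)) u) <->
            (exists2 u, subn s h t E u & N (qMu (nr s h) u)).
    split=> -[u H Nu]; exists u => //; first exact: subn_keep.
    by move/subn_inv: H; rewrite ah.
  move=> ->; last first.
    move=> u H; apply: hinv_ctx; first exact: stepctx_mu.
    by apply: HN; apply: subn_keep.
  split=> [[p Pp [u H Nu]]|[h' [p [[-> Pp] [u H Nu]]]]].
    by exists h, p; split=> //; exists u => //; apply: subn_keep.
  exists p => //; exists u => //.
  by move/subn_inv: H; rewrite ah.
(* If h is applied, the weak composition of E is fixed first, so that the application to D becomes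
   part of the test on t. *)
have key D E0 : perm_eq E (E0 ++ tag (inr h) D) ->
    (exists2 u, sub s t E0 u & N (qMu (nr s h) (qApp u D))) <->
    (exists2 p, P p & exists2 u, sub s p E0 u & N (qMu (nr s h) (qApp u D))).
  move=> pE; apply: (c s E0 (fun u => N (qMu (nr s h) (qApp u D)))) => u H.
  apply: (hinv_ctx (N := N \o qMu (nr s h)) (K := qApp^~ D)); first exact: stepctx_fun.
  apply: hinv_ctx; first exact: stepctx_mu.
  by apply: HN; apply: subn_app H.
split=> [[w0 /subn_inv]|[h' [p [[-> Pp] [w0 /subn_inv]]]]]; rewrite ah.
  move=> [E0 [D [u [pE H ->]]]] Nu.
  have [|p Pp [u' H' Nu']] := (key D E0 pE).1; first by exists u.
  by exists h, p; split=> //; exists (qApp u' D) => //; apply: subn_app H'.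
move=> [E0 [D [u [pE H ->]]]] Nu.
have [|u' H' Nu'] := (key D E0 pE).2; first by exists p => //; exists u.
by exists (qApp u' D) => //; apply: subn_app H'.
Qed.

Lemma ex_eq (N : rterm -> Prop) t : (exists2 x, x = t & N x) <-> N t.
Proof. by split=> [[x ->]|Nt]; [|exists t]. Qed.

Lemma hinv_rho N a h t : hinv N (qMu a (qMu h t)) ->
  N (qMu a (qMu h t)) <-> N (rho_term a h t).
Proof. by move=> I; rewrite (hinv_at I (qstep_rho a h t)) ex_eq. Qed.

(* If the name a is applied, the redex is first hidden by the application of
   the inner mu, whose reduction uncovers it. *)
Lemma compatn_rho a h t : compatn a (qMu h t)
  (fun h' t' => h' = unbind a h /\ t' = qren id (unbind a) t).
Proof.
move=> s E N HN; set a' := nr s a; set h1 := nr (upn s) h.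
have nrE : nr s (unbind a h) = unbind a' h1 by rewrite /h1 /a'; case: (h).
have R : (exists h' p, (h' = unbind a h /\ p = qren id (unbind a) t) /\
           exists2 u, subn s h' p E u & N (qMu (nr s h') u)) <->
         exists2 u, subn s (unbind a h) (qren id (unbind a) t) E u
           & N (qMu (unbind a' h1) u).
  split=> [[_ [_ [[-> ->] [u H]]]]|[u H Nu]]; first by rewrite nrE; exists u.
  by exists (unbind a h), (qren id (unbind a) t); split=> //; exists u; rewrite ?nrE.
rewrite {}R; case ah: (ap s a).
  split=> [[w0 /subn_inv]|[u /rho_before[E0 [D [pE /(rho_after_snap _ _ _ _ _ ah)]]]]].
    rewrite ah => -[E0 [D [_ [pE /sub_inv_mu[t1 H1 ->] ->]]]] Nu.
    have I : hinv N (qMu a' (qApp (qMu h1 t1) D)).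
      by apply: HN; apply: subn_app pE _ => //; constructor.
    have S : qstep (qMu a' (qApp (qMu h1 t1) D)) (img (qMu a') (mu_set h1 t1 D)).
      by apply: stepctx_mu; constructor.
    move: Nu; rewrite (hinv_at I S) ex_img => -[_ [w Hw ->]].
    rewrite hinv_rho; last first.
      apply: (hinv_red I); exists (img (qMu a') (mu_set h1 t1 D)) => //.
      by exists (qMu h1 w) => //; exists w.
    move=> Nu; exists (qren id (unbind a') w) => //.
    apply/rho_before; exists E0, D; split=> //; apply/rho_after_snap => //.
    by exists w => //; apply/snap_after; exists t1.
  move=> [w /snap_after[t1 H1 H2] ->] Nu.
  have H : subn s a (qMu h t) E (qApp (qMu h1 t1) D).
    by apply: subn_app pE _ => //; constructor.
  exists (qApp (qMu h1 t1) D) => //.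
  have I := HN _ H.
  have S : qstep (qMu a' (qApp (qMu h1 t1) D)) (img (qMu a') (mu_set h1 t1 D)).
    by apply: stepctx_mu; constructor.
  rewrite (hinv_at I S) ex_img; exists (qMu h1 w); first by exists w.
  apply/hinv_rho => //; apply: (hinv_red I).
  exists (img (qMu a') (mu_set h1 t1 D)) => //.
  by exists (qMu h1 w) => //; exists w.
split=> [[w0 /subn_inv]|[u /rho_before[E0 [D [pE H]]] Nu]].
  rewrite ah => /sub_inv_mu[t1 H1 ->].
  rewrite hinv_rho; last by apply: HN; apply: subn_keep => //; constructor.
  move=> Nu; exists (qren id (unbind a') t1) => //.
  apply/rho_before; exists E, [::]; rewrite cats0; split=> //; rewrite cats0.
  by apply/rho_after => //; exists t1.
(* As s does not apply a, no item of key [inr a] can be consumed, hence D is empty. *)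
case: D pE H => [|d D] pE H; last first.
  have /= := subn_valid H (e := (inr 0, d)).
  by rewrite ah mem_cat mem_head orbT => /(_ isT).
move: H; rewrite cats0 => /(rho_after _ _ _ _ ah)[t1 H1 eu]; subst u.
have H : subn s a (qMu h t) E (qMu h1 t1).
  apply: subn_keep => //; constructor; apply: subn_perm H1.
  by apply: perm_map; rewrite perm_sym; move: pE; rewrite cats0.
exists (qMu h1 t1) => //; apply/hinv_rho => //.
exact: HN.
Qed.

(** The substituted beta and mu redexes are again redexes, and invariance allows them to be
    contracted. Both sides then range over one substitution along the composite, with E shared
    between bag and body. In the congruence cases the weak composition is fixed and the surrounding
    term absorbed into N. *)
Lemma qstep_compat t P : qstep t P -> compat t P.
Proof.
elim=> {t P}.
- move=> t B s E N HN; split=> [[w0 /sub_inv_app]|[p Pp [v Hv Nv]]].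
    move=> [E0 [E1 [_ [D [pE /sub_inv_lam[t1 H1 ->] H2 ->]]]]] Nu.
    have I : hinv N (qApp (qLam t1) D) by apply: HN; apply: sub_app pE _ H2; constructor.
    move: Nu; rewrite (hinv_at I (qstep_beta _ _)) => -[v Hv Nv].
    have [|p a1 a2] := (beta_before s t E B v).2; last by exists p => //; exists v.
    exists E1, E0, D; split=> //; first by rewrite perm_sym perm_catC perm_sym.
    by apply/beta_after; exists t1.
  have [|X [R [D [pE H2 /beta_after[t1 H1 Hv1]]]]] := (beta_before s t E B v).1.
    by exists p.
  have H : sub s (qApp (qLam t) B) E (qApp (qLam t1) D).
    apply: (sub_app (E0 := R) (E1 := X)) H2; last by constructor.
    by rewrite perm_sym perm_catC perm_sym.
  exists (qApp (qLam t1) D) => //.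
  by rewrite (hinv_at (HN _ H) (qstep_beta _ _)); exists v.
- move=> h t B s E N HN; split=> [[w0 /sub_inv_app]|[_ [p Pp ->] [_ /sub_inv_mu[v Hv ->] Nv]]].
    move=> [E0 [E1 [_ [D [pE /sub_inv_mu[t1 H1 ->] H2 ->]]]]] Nu.
    have I : hinv N (qApp (qMu (nr (upn s) h) t1) D).
      by apply: HN; apply: sub_app pE _ H2; constructor.
    move: Nu; rewrite (hinv_at I (qstep_mu _ _ _)) => -[_ [v Hv ->] Nv].
    have [|p a1 a2] := (snap_before s h t E B v).2; last first.
      exists (qMu h p); first by exists p.
      by exists (qMu (nr (upn s) h) v) => //; constructor.
    exists E1, E0, D; split=> //; first by rewrite perm_sym perm_catC perm_sym.
    by apply/snap_after; exists t1.
  have [|X [R [D [pE H2 /snap_after[t1 H1 Hv1]]]]] := (snap_before s h t E B v).1.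
    by exists p.
  have H : sub s (qApp (qMu h t) B) E (qApp (qMu (nr (upn s) h) t1) D).
    apply: (sub_app (E0 := R) (E1 := X)) H2; last by constructor.
    by rewrite perm_sym perm_catC perm_sym.
  exists (qApp (qMu (nr (upn s) h) t1) D) => //.
  rewrite (hinv_at (HN _ H) (qstep_mu _ _ _)); exists (qMu (nr (upn s) h) v) => //.
  by exists v.
- move=> a h t s E N HN.
  have := @compatn_rho a h t (upn s) (ritems id succn E) N.
  have -> : (exists2 u, subn (upn s) a (qMu h t) (ritems id succn E) u
               & N (qMu (nr (upn s) a) u)) <->
            (exists2 u, sub s (qMu a (qMu h t)) E u & N u).
    split=> [[u H Nu]|[_ /sub_inv_mu[u H ->] Nu]]; last by exists u.
    by exists (qMu (nr (upn s) a) u) => //; constructor.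
  move=> -> => [|u H]; last by apply: HN; constructor.
  rewrite ex_eq; split=> [[_ [_ [[-> ->] [u H Nu]]]]|[_ /sub_inv_mu[u H ->] Nu]].
    by exists (qMu (nr (upn s) (unbind a h)) u) => //; constructor.
  by exists (unbind a h), (qren id (unbind a) t); split=> //; exists u.
- move=> t P _ IH s E N HN; rewrite ex_img.
  have := IH (upv s) (ritems succn id E) (N \o qLam).
  have L p : (exists2 u, sub (upv s) p (ritems succn id E) u & (N \o qLam) u) <->
      (exists2 u, sub s (qLam p) E u & N u).
    split=> [[u H Nu]|[_ /sub_inv_lam[u H ->] Nu]]; last by exists u.
    by exists (qLam u) => //; constructor.
  rewrite L => -> => [|u H].
    by split=> -[p Pp Np]; exists p => //; apply/L.
  by apply: hinv_ctx; [exact: stepctx_lam | apply: HN; constructor].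
- move=> t P B _ IH s E N HN; rewrite ex_img.
  have key E0 E1 D : perm_eq E (E0 ++ E1) -> subs s B E1 D ->
      (exists2 u, sub s t E0 u & N (qApp u D)) <->
      (exists2 p, P p & exists2 u, sub s p E0 u & N (qApp u D)).
    move=> pE H; apply: (IH s E0 (N \o qApp^~ D)) => u Hu.
    by apply: hinv_ctx; [exact: stepctx_fun | apply: HN; apply: sub_app pE _ H].
  split=> [[w0 /sub_inv_app]|[p Pp [w0 /sub_inv_app]]].
    move=> [E0 [E1 [u [D [pE H1 H2 ->]]]]] Nu.
    have [|p Pp [v Hv Nv]] := (key E0 E1 D pE H2).1; first by exists u.
    by exists p => //; exists (qApp v D) => //; apply: (sub_app pE Hv H2).
  move=> [E0 [E1 [u [D [pE H1 H2 ->]]]]] Nu.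
  have [|v Hv Nv] := (key E0 E1 D pE H2).2; first by exists p => //; exists u.
  by exists (qApp v D) => //; apply: (sub_app pE Hv H2).
- move=> t v P B _ IH s E N HN; rewrite ex_img.
  have perm3 (X E0 E1 F G : seq item) : perm_eq X (E0 ++ E1) -> perm_eq E1 (F ++ G) ->
      perm_eq X (E0 ++ (F ++ G)).
    by move=> p q; rewrite (permPl p) perm_cat2l.
  have key E0 F G u D : perm_eq E (E0 ++ (F ++ G)) -> sub s t E0 u -> subs s B G D ->
      (exists2 w, sub s v F w & N (qApp u (w :: D))) <->
      (exists2 p, P p & exists2 w, sub s p F w & N (qApp u (w :: D))).
    move=> pE H1 H2; apply: (IH s F (fun w => N (qApp u (w :: D)))) => w Hw.
    apply: (hinv_ctx (K := fun w => qApp u (w :: D))); first exact: stepctx_bag.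
    by apply: HN; apply: sub_app pE H1 _; apply: subs_cons Hw H2.
  split=> [[w0 /sub_inv_app]|[p Pp [w0 /sub_inv_app]]].
    move=> [E0 [E1 [u [_ [pE H1 /subs_inv_cons[F [G [w [D [pE1 H2 H3 ->]]]]] ->]]]]] Nu.
    have pE' := perm3 _ _ _ _ _ pE pE1.
    have [|p Pp [w' Hw Nw]] := (key _ _ _ _ _ pE' H1 H3).1; first by exists w.
    exists p => //; exists (qApp u (w' :: D)) => //.
    by apply: sub_app pE' H1 _; apply: subs_cons Hw H3.
  move=> [E0 [E1 [u [_ [pE H1 /subs_inv_cons[F [G [w [D [pE1 H2 H3 ->]]]]] ->]]]]] Nu.
  have pE' := perm3 _ _ _ _ _ pE pE1.
  have [|w' Hw Nw] := (key _ _ _ _ _ pE' H1 H3).2; first by exists p => //; exists w.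
  exists (qApp u (w' :: D)) => //.
  by apply: sub_app pE' H1 _; apply: subs_cons Hw H3.
- move=> b t P _ IH s E N HN; rewrite ex_img.
  have := @compatn_in b t P IH (upn s) (ritems id succn E) N.
  have L p : (exists2 u, subn (upn s) b p (ritems id succn E) u
               & N (qMu (nr (upn s) b) u)) <->
            (exists2 u, sub s (qMu b p) E u & N u).
    split=> [[u H Nu]|[_ /sub_inv_mu[u H ->] Nu]]; last by exists u.
    by exists (qMu (nr (upn s) b) u) => //; constructor.
  rewrite L => -> => [|u H]; last by apply: HN; constructor.
  split=> [[_ [p [[-> Pp] H]]]|[p Pp H]]; first by exists p => //; apply/L.
  by exists b, p; split=> //; apply/L.
Qed.

(** All summands of the reduct are mu abstractions, whether the step is inside or merges two of
    them; the critical pairs can treat both kinds of steps at once through Q. *)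
Lemma qstep_mu_compatn b t P : qstep (qMu b t) P ->
  exists2 Q, compatn b t Q & forall x, P x <-> exists h' t', Q h' t' /\ x = qMu h' t'.
Proof.
move=> /qstep_inv_mu[[h [t' [-> ->]]]|[P0 H ->]].
  exists (fun h' u => h' = unbind b h /\ u = qren id (unbind b) t').
    exact: compatn_rho.
  move=> x; split=> [->|[_ [_ [[-> ->]]]] //].
  by exists (unbind b h), (qren id (unbind b) t').
exists (fun h' t' => h' = b /\ P0 t'); first exact: compatn_in (qstep_compat H).
move=> x; split=> [[y Py ->]|[_ [y [[-> Py] ->]]]]; last by exists y.
by exists b, y.
Qed.

(* Contexts that may rename the term put in their hole. *)
Definition semctx (K : rterm -> rterm) : Prop := forall f g t P N,
  qstep t P -> hinv N (K (qren f g t)) ->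
  N (K (qren f g t)) <-> exists2 p, P p & N (K (qren f g p)).

(** A renaming is a substitution without items, so this is an instance of [qstep_compat]. *)
Lemma semctx_id : semctx id.
Proof.
move=> f g t P N H HN.
have r x : (exists2 u, sub (rens f g) x [::] u & N u) <-> N (qren f g x).
  split=> [[u /(sub_isren _ _ _ (isren_rens f g))[_ ->]] //|Nx].
  by exists (qren f g x) => //; apply/(sub_isren _ _ _ (isren_rens f g)).
have := qstep_compat H (s := rens f g) (E := [::]) (N := N).
rewrite r => -> => [|u /(sub_isren _ _ _ (isren_rens f g))[_ ->] //].
by split=> -[p Pp Np]; exists p => //; apply/r.
Qed.

Lemma semctx_step K L : stepctx L -> semctx K -> semctx (L \o K).
Proof.
move=> hL hK f g t P N H HN.
exact: (hK f g t P (N \o L) H (hinv_ctx hL HN)).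
Qed.

Lemma semctx_ren K f g : semctx K -> semctx (K \o qren f g).
Proof.
move=> hK f' g' t P N H; rewrite /= qren_comp => HN; rewrite (hK _ _ _ _ _ H HN).
by split=> -[p Pp Np]; exists p => //; move: Np; rewrite qren_comp.
Qed.

Lemma semctxE K t P N : semctx K -> qstep t P -> hinv N (K t) ->
  N (K t) <-> exists2 p, P p & N (K p).
Proof.
have idE x : qren id id x = x by apply: qren_id.
move=> hK H; rewrite -{1 2}(idE t) => HN; rewrite (hK _ _ _ _ _ H HN).
by split=> -[p Pp]; [rewrite idE|rewrite -{1}(idE p)] => Np; exists p.
Qed.

(** Linearity: each item is used exactly once, so a summand is a context K around any chosen item,
    and K depends only on where that item went. Binders crossed on the way shift the item, hence the
    renamings in [semctx]. *)
Definition hole_for (t : rterm) : Prop := forall s E u k v E',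
  sub s t E u -> perm_eq E ((k, v) :: E') ->
  exists K, [/\ semctx K, u = K v
    & forall p, sub s t ((k, p) :: E') (K p)].

Lemma subs_hole_aux B : (forall v, v \in B -> hole_for v) ->
  forall s E D k v E', subs s B E D -> perm_eq E ((k, v) :: E') ->
  exists K D1 D2, [/\ semctx K, D = D1 ++ K v :: D2
    & forall p, subs s B ((k, p) :: E') (D1 ++ K p :: D2)].
Proof.
elim: B => [|w B IH] HB s E D k v E'; first by move=> /subs_inv_nil[-> ->] /perm_size.
move=> /subs_inv_cons[E0 [E1 [u [D' [pE H1 H2 ->]]]]] p.
have {}p : perm_eq ((k, v) :: E') (E0 ++ E1) by rewrite -(permPl p).
case: (perm_cons_cat p) => [[X pX pE']|[X pX pE']].
  have [K [hK -> HK]] := HB w (mem_head _ _) _ _ _ _ _ _ H1 pX.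
  exists K, [::], D'; split=> // q; apply: (subs_cons _ (HK q) H2).
  by rewrite /= perm_cons.
have [K [D1 [D2 [hK -> HK]]]] :=
  IH (fun w wB => HB w (mem_behead (s := _ :: B) wB)) _ _ _ _ _ _ H2 pX.
exists K, (u :: D1), D2; split=> // q; apply: (subs_cons _ H1 (HK q)).
by rewrite perm_sym perm_catC /= perm_cons perm_catC perm_sym.
Qed.

Lemma subn_hole_aux t : hole_for t -> forall s h E u k v E',
  subn s h t E u -> perm_eq E ((k, v) :: E') ->
  exists K, [/\ semctx K, u = K v
    & forall p, subn s h t ((k, p) :: E') (K p)].
Proof.
move=> IH s h E u k v E' /subn_inv; case: ifP => ah; last first.
  move=> H p; have [K [hK -> HK]] := IH _ _ _ _ _ _ H p.
  by exists K; split=> // q; apply: subn_keep.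
move=> [E0 [D [u' [pE H ->]]]] p.
have {}p : perm_eq ((k, v) :: E') (E0 ++ tag (inr h) D) by rewrite -(permPl p).
case: (perm_cons_cat p) => [[X pX pE']|[X pX pE']].
  have [K [hK -> HK]] := IH _ _ _ _ _ _ H pX.
  exists ((qApp^~ D) \o K); split=> //; first exact/semctx_step/hK/stepctx_fun.
  by move=> q; apply: (subn_app _ _ (HK q)); rewrite //= perm_cons.
have : (k, v) \in tag (inr h) D by rewrite (perm_mem pX) mem_head.
move=> /mapP[d dD [? ?]]; subst.
have pD := perm_to_rem dD.
exists (fun x => qApp u' (x :: rem d D)); split.
- exact: (semctx_step (K := id) (stepctx_bag u' (rem d D)) semctx_id).
- exact: qApp_perm.
- move=> q; apply: (subn_app _ _ H) => //.
  rewrite /= perm_sym perm_catC /= perm_cons perm_catC perm_sym (permPl pE').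
  rewrite perm_cat2l -(perm_cons (inr h, d)) -(permPl pX).
  exact: (perm_map _ pD).
Qed.

Lemma sub_hole t : hole_for t.
Proof.
elim/rterm_ind: t => [x|t IH|t B IH IHB|h t IH] s E u k v E'.
- move=> /sub_inv_var; case e: (vr s x) => [y|]; first by move=> [-> _] /perm_size.
  move=> -> p; have := perm_size p; case: E' p => // p _.
  have : (k, v) \in [:: (inl x, u)] by rewrite (perm_mem p) mem_head.
  rewrite inE => /eqP[-> ->]; exists id; split=> //; first exact: semctx_id.
  by move=> q; constructor.
- move=> /sub_inv_lam[u' H ->] /(perm_map (ritem succn id)) /= p.
  have [K [hK -> HK]] := IH _ _ _ _ _ _ H p.
  exists (qLam \o (K \o qshv)); split=> //.
    exact/semctx_step/semctx_ren/hK/stepctx_lam.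
  by move=> q; apply: sub_lam; exact: (HK (qshv q)).
- move=> /sub_inv_app[E0 [E1 [u' [D [pE H1 H2 ->]]]]] p.
  have {}p : perm_eq ((k, v) :: E') (E0 ++ E1) by rewrite -(permPl p).
  case: (perm_cons_cat p) => [[X pX pE']|[X pX pE']].
    have [K [hK -> HK]] := IH _ _ _ _ _ _ H1 pX.
    exists ((qApp^~ D) \o K); split=> //; first exact/semctx_step/hK/stepctx_fun.
    by move=> q; apply: (sub_app _ (HK q) H2); rewrite /= perm_cons.
  have [K [D1 [D2 [hK -> HK]]]] := subs_hole_aux IHB H2 pX.
  have pD y : perm_eq (D1 ++ y :: D2) (y :: D1 ++ D2) by rewrite perm_catC /= perm_cons perm_catC.
  exists ((fun y => qApp u' (y :: D1 ++ D2)) \o K); split.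
  + exact/semctx_step/hK/stepctx_bag.
  + exact: qApp_perm.
  + move=> q; rewrite /= -(qApp_perm _ (pD _)); apply: (sub_app _ H1 (HK q)).
    by rewrite perm_sym perm_catC /= perm_cons perm_catC perm_sym.
- move=> /sub_inv_mu[u' H ->] /(perm_map (ritem id succn)) /= p.
  have [K [hK -> HK]] := subn_hole_aux IH H p.
  exists (qMu (nr (upn s) h) \o (K \o qshn)); split=> //.
    exact/semctx_step/semctx_ren/hK/stepctx_mu.
  by move=> q; apply: sub_mu; exact: (HK (qshn q)).
Qed.

Lemma item_compat s t k v E P N : qstep v P ->
  (forall u, sub s t ((k, v) :: E) u -> hinv N u) ->
  (exists2 u, sub s t ((k, v) :: E) u & N u) <->
  (exists2 p, P p & exists2 u, sub s t ((k, p) :: E) u & N u).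
Proof.
move=> H HN; split=> [[u Hu]|[p Pp [u Hu]]];
  have [K [hK -> HK]] := sub_hole Hu (perm_refl _).
  move/(semctxE hK H (HN _ (HK v))) => [p Pp Np].
  by exists p => //; exists (K p).
by move=> Np; exists (K v) => //; apply/(semctxE hK H (HN _ (HK v))); exists p.
Qed.

Lemma itemn_compat s h t k v E P N : qstep v P ->
  (forall u, subn s h t ((k, qshn v) :: E) u -> hinv N u) ->
  (exists2 u, subn s h t ((k, qshn v) :: E) u & N u) <->
  (exists2 p, P p & exists2 u, subn s h t ((k, qshn p) :: E) u & N u).
Proof.
move=> H HN; split=> [[u Hu]|[p Pp [u Hu]]];
  have [K [hK -> HK]] := subn_hole_aux (@sub_hole t) Hu (perm_refl _).
  move/(semctxE (semctx_ren (f := id) (g := succn) hK) H (HN _ (HK (qshn v)))) => [p Pp Np].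
  by exists p => //; exists (K (qshn p)).
move=> Np; exists (K (qshn v)) => //.
by apply/(semctxE (semctx_ren (f := id) (g := succn) hK) H (HN _ (HK (qshn v)))); exists p.
Qed.

(** * Critical pairs and local confluence *)

Lemma beta_set_perm t B B' u : perm_eq B B' -> beta_set t B u -> beta_set t B' u.
Proof. by move=> p; apply: sub_perm; apply: perm_map. Qed.

Lemma mu_set_perm h t B B' u : perm_eq B B' -> mu_set h t B u -> mu_set h t B' u.
Proof.
move=> p [w H ->]; exists w => //; apply: subn_perm H.
by do 2 apply: perm_map.
Qed.

(** After a step in the body or in the bag the term is still a beta redex, and it is a strict
    reduct, so N allows it to be contracted. What remains is [qstep_compat] for the body and
    [item_compat] for the bag. *)
Lemma beta_confl t B P N : shinv N (qApp (qLam t) B) -> qstep (qApp (qLam t) B) P ->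
  (exists2 u, beta_set t B u & N u) <-> (exists2 u, P u & N u).
Proof.
move=> HN; have I u : beta_set t B u -> hinv N u.
  by move=> Hu; apply: HN; exists (beta_set t B) => //; constructor.
case/qstep_inv_app.
- move=> [t0 [B' [/qLam_inj <- p ->]]]; split=> -[u Hu Nu]; exists u => //.
    exact: beta_set_perm Hu.
  by apply: beta_set_perm Hu; rewrite perm_sym.
- by move=> [h [t0 [B' [e _ _]]]]; move: e; shape_discr.
- move=> [_ [B' [/qstep_inv_lam[P0 H ->] p ->]]]; rewrite ex_img ex_img.
  rewrite (qstep_compat H I); split=> -[x Px Hx]; exists x => //.
    have I' : hinv N (qApp (qLam x) B').
      rewrite -(qApp_perm _ p); apply: HN; apply: (red1_ctx (K := qApp^~ B)).
        exact: stepctx_fun.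
      by apply: (red1_ctx stepctx_lam); exists P0.
    rewrite (hinv_at I' (qstep_beta _ _)); case: Hx => u Hu Nu; exists u => //.
    exact: beta_set_perm Hu.
  have I' : hinv N (qApp (qLam x) B').
    rewrite -(qApp_perm _ p); apply: HN; apply: (red1_ctx (K := qApp^~ B)).
      exact: stepctx_fun.
    by apply: (red1_ctx stepctx_lam); exists P0.
  move: Hx; rewrite (hinv_at I' (qstep_beta _ _)) => -[u Hu Nu]; exists u => //.
  by apply: beta_set_perm Hu; rewrite perm_sym.
- move=> [v [B' [P0 [H p ->]]]]; rewrite ex_img.
  have -> : (exists2 u, beta_set t B u & N u) <-> (exists2 u, beta_set t (v :: B') u & N u).
    split=> -[u Hu Nu]; exists u => //; apply: beta_set_perm Hu => //.
    by rewrite perm_sym.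
  rewrite (item_compat H) => [|u Hu]; last first.
    by apply: I; apply: (beta_set_perm (B := v :: B')) Hu; rewrite perm_sym.
  have I' x : P0 x -> hinv N (qApp (qLam t) (x :: B')).
    move=> Px; apply: HN; rewrite (qApp_perm _ p).
    by apply: (red1_ctx (stepctx_bag _ _)); exists P0.
  by split=> -[x Px Hx]; exists x => //; apply/(hinv_at (I' x Px) (qstep_beta _ _)).
Qed.

Lemma mu_confl h t B P N : shinv N (qApp (qMu h t) B) -> qstep (qApp (qMu h t) B) P ->
  (exists2 u, mu_set h t B u & N u) <-> (exists2 u, P u & N u).
Proof.
move=> HN; have I u : mu_set h t B u -> hinv N u.
  by move=> Hu; apply: HN; exists (mu_set h t B) => //; constructor.
have muE h' t' B' : (exists2 u, mu_set h' t' B' u & N u) <->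
    exists2 w, subn (snap 0) h' t' (tag (inr 0) (map qshn B')) w & N (qMu h' w).
  split=> [[_ [w Hw ->] Nw]|[w Hw Nw]]; first by exists w.
  by exists (qMu h' w) => //; exists w.
case/qstep_inv_app.
- by move=> [t0 [B' [e _ _]]]; move: e; shape_discr.
- move=> [h' [t0 [B' [/qMu_inj[<- <-] p ->]]]]; split=> -[u Hu Nu]; exists u => //.
    exact: mu_set_perm Hu.
  by apply: mu_set_perm Hu; rewrite perm_sym.
- move=> [P1 [B' [H p ->]]]; rewrite ex_img.
  have [Q HQ QE] := qstep_mu_compatn H.
  have I' x : P1 x -> hinv N (qApp x B').
    move=> Px; rewrite -(qApp_perm _ p); apply: HN; apply: (red1_ctx (K := qApp^~ B)).
      exact: stepctx_fun.
    by exists P1.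
  rewrite muE (HQ (snap 0)) => [|u Hu]; last by apply: I; exists u.
  split=> [[h' [t' [Qt Hx]]]|[x Px]].
    have Px : P1 (qMu h' t') by apply/QE; exists h', t'.
    exists (qMu h' t') => //; rewrite (hinv_at (I' _ Px) (qstep_mu _ _ _)).
    by move/muE: Hx => [u Hu Nu]; exists u => //; apply: mu_set_perm Hu.
  have [h' [t' [Qt ex]]] := (QE x).1 Px; subst x.
  rewrite (hinv_at (I' _ Px) (qstep_mu _ _ _)) => -[u Hu Nu].
  exists h', t'; split=> //; apply/muE; exists u => //.
  by apply: mu_set_perm Hu; rewrite perm_sym.
- move=> [v [B' [P0 [H p ->]]]]; rewrite ex_img.
  have -> : (exists2 u, mu_set h t B u & N u) <-> (exists2 u, mu_set h t (v :: B') u & N u).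
    split=> -[u Hu Nu]; exists u => //; apply: mu_set_perm Hu => //.
    by rewrite perm_sym.
  rewrite muE (itemn_compat (N := N \o qMu h) H) => [|u Hu]; last first.
    apply: hinv_ctx; first exact: stepctx_mu.
    apply: I; apply: (mu_set_perm (B := v :: B')); first by rewrite perm_sym.
    by exists u.
  have I' x : P0 x -> hinv N (qApp (qMu h t) (x :: B')).
    move=> Px; apply: HN; rewrite (qApp_perm _ p).
    by apply: (red1_ctx (stepctx_bag _ _)); exists P0.
  split=> -[x Px Hx]; exists x => //.
    by apply/(hinv_at (I' x Px) (qstep_mu _ _ _))/muE.
  by move/(hinv_at (I' x Px) (qstep_mu _ _ _))/muE: Hx.
Qed.

Lemma rho_confl a h t P N : shinv N (qMu a (qMu h t)) -> qstep (qMu a (qMu h t)) P ->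
  N (rho_term a h t) <-> (exists2 u, P u & N u).
Proof.
move=> HN; have I : hinv N (rho_term a h t).
  by apply: HN; exists (eq^~ (rho_term a h t)) => //; constructor.
case/qstep_inv_mu => [[h' [t' [/qMu_inj[<- <-] ->]]]|[P0 H ->]]; first by rewrite ex_eq.
rewrite ex_img; have [Q HQ QE] := qstep_mu_compatn H.
have I' x : P0 x -> hinv N (qMu a x).
  by move=> Px; apply: HN; apply: (red1_ctx (stepctx_mu _)); exists P0.
(* The contraction is written as a substitution without items to make [compatn] applicable to it. *)
have rhoE h' t' : (exists2 u, subn (srho a) h' t' [::] u & N (qMu (nr (srho a) h') u)) <->
    N (rho_term a h' t').
  split=> [[u /subn_srho[_ ->]] //|Nu].
  by exists (qren id (unbind a) t') => //; apply/subn_srho.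
rewrite -rhoE HQ => [|u /subn_srho[_ ->] //].
split=> [[h' [t' [Qt /rhoE Nt]]]|[x Px]].
  have Px : P0 (qMu h' t') by apply/QE; exists h', t'.
  by exists (qMu h' t') => //; apply/hinv_rho => //; exact: I'.
have [h' [t' [Qt ex]]] := (QE x).1 Px; subst x.
move/(hinv_rho (I' _ Px)) => Nt; exists h', t'; split=> //; exact/rhoE.
Qed.

Lemma perm_swap (T : eqType) (x y : T) (X : seq T) :
  perm_eq (x :: y :: X) (y :: x :: X).
Proof. by apply/permP => q /=; rewrite addnCA. Qed.

Lemma local_confluence t P1 P2 N : shinv N t -> qstep t P1 -> qstep t P2 ->
  (exists2 u, P1 u & N u) <-> (exists2 u, P2 u & N u).
Proof.
elim/rterm_ind: t P1 P2 N => [x|t IH|t B IH IHB|b t IH] P1 P2 N HN H1 H2.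
- by have := qstep_inv_var H1.
- have [Q1 S1 ->] := qstep_inv_lam H1; have [Q2 S2 ->] := qstep_inv_lam H2.
  rewrite !ex_img; apply: (IH Q1 Q2 (N \o qLam)) => //.
  exact: (shinv_ctx stepctx_lam).
(* Disjoint steps: each is performed after the other, which invariance at strict reducts permits. *)
- have fun_bag Q B1 v B2 R : qstep t Q -> qstep v R -> perm_eq B B1 ->
      perm_eq B (v :: B2) ->
      (exists2 u, Q u & N (qApp u B1)) <-> (exists2 u, R u & N (qApp t (u :: B2))).
    move=> S1 S2 p1 p2.
    have I1 x : Q x -> hinv N (qApp x (v :: B2)).
      move=> Qx; rewrite -(qApp_perm _ p2); apply: HN.
      by apply: (red1_ctx (stepctx_fun B)); exists Q.
    have I2 x : R x -> hinv N (qApp t (x :: B2)).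
      move=> Rx; apply: HN; rewrite (qApp_perm _ p2).
      by apply: (red1_ctx (stepctx_bag _ _)); exists R.
    have p : perm_eq B1 (v :: B2) by rewrite -(permPl p1).
    split=> -[x Qx].
      rewrite (qApp_perm _ p) (hinv_at (I1 _ Qx) (stepctx_bag x B2 S2)) ex_img.
      move=> [y Ry Ny]; exists y => //.
      by rewrite (hinv_at (I2 _ Ry) (stepctx_fun _ S1)) ex_img; exists x.
    rewrite (hinv_at (I2 _ Qx) (stepctx_fun _ S1)) ex_img => -[y Qy Ny].
    exists y => //; rewrite (qApp_perm _ p) (hinv_at (I1 _ Qy) (stepctx_bag y B2 S2)).
    by rewrite ex_img; exists x.
  case: (qstep_inv_app H1).
  + move=> [t0 [B' [? p ?]]]; subst.
    by apply: beta_confl; rewrite -?(qApp_perm _ p).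
  + move=> [h [t0 [B' [? p ?]]]]; subst.
    by apply: mu_confl; rewrite -?(qApp_perm _ p).
  + move=> [Q1 [B1 [S1 p1 ?]]]; subst P1; rewrite ex_img.
    case: (qstep_inv_app H2).
    * move=> [t0 [B' [? p ?]]]; subst; apply: iff_sym.
      rewrite -(ex_img N (qApp^~ B1)).
      by apply: beta_confl; rewrite -(qApp_perm _ p).
    * move=> [h [t0 [B' [? p ?]]]]; subst; apply: iff_sym.
      rewrite -(ex_img N (qApp^~ B1)).
      by apply: mu_confl; rewrite -(qApp_perm _ p).
    * move=> [Q2 [B2 [S2 p2 ->]]]; rewrite ex_img.
      have p : perm_eq B2 B1 by rewrite -(permPl p2).
      rewrite (IH Q1 Q2 (N \o qApp^~ B1)) //.
        by split=> -[x Qx Nx]; exists x => //; move: Nx; rewrite /= (qApp_perm _ p).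
      by apply: (shinv_ctx (stepctx_fun B1)); rewrite -(qApp_perm _ p1).
    * move=> [v [B2 [Q2 [S2 p2 ->]]]]; rewrite ex_img.
      exact: fun_bag S1 S2 p1 p2.
  + move=> [v1 [B1 [Q1 [S1 p1 ?]]]]; subst P1; rewrite ex_img.
    case: (qstep_inv_app H2).
    * move=> [t0 [B' [? p ?]]]; subst; apply: iff_sym.
      rewrite -(ex_img N (fun x => qApp (qLam t0) (x :: B1))).
      by apply: beta_confl; rewrite -(qApp_perm _ p).
    * move=> [h [t0 [B' [? p ?]]]]; subst; apply: iff_sym.
      rewrite -(ex_img N (fun x => qApp (qMu h t0) (x :: B1))).
      by apply: mu_confl; rewrite -(qApp_perm _ p).
    * move=> [Q2 [B2 [S2 p2 ->]]]; rewrite ex_img; apply: iff_sym.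
      exact: fun_bag S2 S1 p2 p1.
    * move=> [v2 [B2 [Q2 [S2 p2 ->]]]]; rewrite ex_img.
      have p : perm_eq (v1 :: B1) ([:: v2] ++ B2) by rewrite -(permPl p1).
      have v1B : v1 \in B by rewrite (perm_mem p1) mem_head.
      (* Either both steps act on the same item, and the induction hypothesis for it applies, or v1
         is among the other items B2 and the steps commute. *)
      case: (perm_cons_cat p) => [[X pX pB]|[X pX pB]].
        move: (perm_size pX); case: X pX pB => // pX pB _.
        have : v1 \in [:: v2] by rewrite (perm_mem pX) mem_head.
        rewrite inE => /eqP ?; subst v2.
        rewrite (IHB v1 v1B Q1 Q2 (fun x => N (qApp t (x :: B1)))) //.
          split=> -[x Qx Nx]; exists x => //; move: Nx;
            by rewrite (@qApp_perm t (x :: B1) (x :: B2)) // perm_cons.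
        by apply: (shinv_ctx (stepctx_bag t B1)); rewrite -(qApp_perm _ p1).
      have I1 x : Q1 x -> hinv N (qApp t (x :: B1)).
        move=> Qx; apply: HN; rewrite (qApp_perm _ p1).
        by apply: (red1_ctx (stepctx_bag _ _)); exists Q1.
      have I2 x : Q2 x -> hinv N (qApp t (x :: B2)).
        move=> Qx; apply: HN; rewrite (qApp_perm _ p2).
        by apply: (red1_ctx (stepctx_bag _ _)); exists Q2.
      have e1 x : qApp t (x :: B1) = qApp t (v2 :: x :: X).
        apply: qApp_perm; rewrite perm_sym (permPl (perm_swap v2 x X)) perm_cons perm_sym.
        exact: pB.
      have e2 x : qApp t (x :: B2) = qApp t (v1 :: x :: X).
        apply: qApp_perm; rewrite perm_sym (permPl (perm_swap v1 x X)) perm_cons perm_sym.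
        exact: pX.
      have sw x y : qApp t (y :: x :: X) = qApp t (x :: y :: X).
        by apply: qApp_perm; exact: perm_swap.
      split=> -[x Qx].
        have := I1 _ Qx; rewrite e1 => I.
        rewrite (hinv_at I (stepctx_bag t (x :: X) S2)) ex_img => -[y Qy Ny].
        exists y => //; have := I2 _ Qy; rewrite e2 => I'.
        rewrite (hinv_at I' (stepctx_bag t (y :: X) S1)) ex_img; exists x => //.
        by rewrite sw.
      have := I2 _ Qx; rewrite e2 => I.
      rewrite (hinv_at I (stepctx_bag t (x :: X) S1)) ex_img => -[y Qy Ny].
      exists y => //; have := I1 _ Qy; rewrite e1 => I'.
      rewrite (hinv_at I' (stepctx_bag t (y :: X) S2)) ex_img; exists x => //.
      by rewrite sw.
- case: (qstep_inv_mu H1) => [[h [t' [? ?]]]|[Q1 S1 ?]]; subst.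
    by rewrite ex_eq; apply: rho_confl.
  case: (qstep_inv_mu H2) => [[h [t' [? ?]]]|[Q2 S2 ?]]; subst.
    by rewrite ex_eq; apply: iff_sym; apply: rho_confl.
  by rewrite !ex_img; apply: (IH Q1 Q2 (N \o qMu b)) => //; apply: (shinv_ctx (stepctx_mu b)).
Qed.


(** * Strong normalisation *)

Fixpoint rcnt (cl cm : nat) (t : rawterm) : nat :=
  match t with
  | RVar _ => 0
  | RLam t => cl + rcnt cl cm t
  | RApp t B => rcnt cl cm t + sumn (map (rcnt cl cm) B)
  | RMu _ t => cm + rcnt cl cm t
  end.

(* An application under d abstractions mu weighs K ^ (e - d). *)
Fixpoint rwgt (K e : nat) (t : rawterm) : nat :=
  match t with
  | RVar _ => 0
  | RLam t => rwgt K e t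
  | RApp t B => K ^ e + rwgt K e t + sumn (map (rwgt K e) B)
  | RMu _ t => rwgt K e.-1 t
  end.

Lemma sumn_canon (F : rawterm -> nat) B :
  foldr (fun u Q => F (canon u) = F u /\ Q) True B ->
  sumn (map F (sort raw_le (map canon B))) = sumn (map F B).
Proof.
move=> H; have -> : map F B = map F (map canon B).
  by rewrite -map_comp; apply/esym/(eq_foldr_map (h := F \o canon)).
by apply: perm_sumn; apply: perm_map; rewrite perm_sort.
Qed.

Lemma rcnt_canon cl cm t : rcnt cl cm (canon t) = rcnt cl cm t.
Proof.
elim/rawterm_nested_ind: t => //= [t ->|t B -> IHB|b t ->] //.
by rewrite sumn_canon.
Qed.

Lemma rwgt_canon K e t : rwgt K e (canon t) = rwgt K e t.
Proof.
elim/rawterm_nested_ind: t e => //= t B IH IHB e.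
rewrite IH sumn_canon //.
by apply: foldr_conj_mono IHB => u.
Qed.

Definition qcnt cl cm (t : rterm) : nat := rcnt cl cm (repr t).
Definition qwgt K e (t : rterm) : nat := rwgt K e (repr t).

Lemma cls_rcnt cl cm t : qcnt cl cm (cls t) = rcnt cl cm t.
Proof. by rewrite /qcnt -rcnt_canon canon_repr rcnt_canon. Qed.

Lemma cls_rwgt K e t : qwgt K e (cls t) = rwgt K e t.
Proof. by rewrite /qwgt -rwgt_canon canon_repr rwgt_canon. Qed.

Lemma qcntE cl cm :
  (forall x, qcnt cl cm (qVar x) = 0) *
  (forall t, qcnt cl cm (qLam t) = cl + qcnt cl cm t) *
  (forall t B, qcnt cl cm (qApp t B) = qcnt cl cm t + sumn (map (qcnt cl cm) B)) *
  (forall b t, qcnt cl cm (qMu b t) = cm + qcnt cl cm t).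
Proof. by do !split=> *; rewrite cls_rcnt //= -map_comp. Qed.

Lemma qwgtE K e :
  (forall x, qwgt K e (qVar x) = 0) *
  (forall t, qwgt K e (qLam t) = qwgt K e t) *
  (forall t B, qwgt K e (qApp t B) = K ^ e + qwgt K e t + sumn (map (qwgt K e) B)) *
  (forall b t, qwgt K e (qMu b t) = qwgt K e.-1 t).
Proof. by do !split=> *; rewrite cls_rwgt //= -map_comp. Qed.

Lemma qcnt_ren cl cm f g t : qcnt cl cm (qren f g t) = qcnt cl cm t.
Proof.
elim/rterm_ind: t f g => [x|t IH|t B IH IHB|b t IH] f g; rewrite qrenE !qcntE ?IH //.
rewrite -map_comp; congr (_ + sumn _); apply/eq_in_map => v vB; exact: IHB.
Qed.

Lemma qwgt_ren K e f g t : qwgt K e (qren f g t) = qwgt K e t.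
Proof.
elim/rterm_ind: t e f g => [x|t IH|t B IH IHB|b t IH] e f g; rewrite qrenE !qwgtE ?IH //.
rewrite -map_comp; congr (_ + sumn _); apply/eq_in_map => v vB; exact: IHB.
Qed.

Lemma leq_sumn (T : eqType) (F G : T -> nat) (B : seq T) :
  (forall v, v \in B -> F v <= G v) -> sumn (map F B) <= sumn (map G B).
Proof.
elim: B => //= v B IH H; apply: leq_add; first exact/H/mem_head.
by apply: IH => w wB; apply: H; rewrite in_cons wB orbT.
Qed.

Lemma qwgt_mono K e e' t : 0 < K -> e <= e' -> qwgt K e t <= qwgt K e' t.
Proof.
move=> K0; elim/rterm_ind: t e e' => [x|t IH|t B IH IHB|b t IH] e e' le; rewrite !qwgtE //.
- exact: IH.
- apply: leq_add; last by apply: leq_sumn => v vB; apply: IHB.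
  by apply: leq_add; [apply: leq_pexp2l | apply: IH].
- by apply: IH; lia.
Qed.

Definition isum (F : rterm -> nat) (E : seq item) : nat := sumn (map (fun e => F e.2) E).

Lemma isum_cat F E1 E2 : isum F (E1 ++ E2) = isum F E1 + isum F E2.
Proof. by rewrite /isum map_cat sumn_cat. Qed.

Lemma isum_perm F E1 E2 : perm_eq E1 E2 -> isum F E1 = isum F E2.
Proof. by move=> p; apply: perm_sumn; apply: perm_map. Qed.

Lemma isum_tag F k B : isum F (tag k B) = sumn (map F B).
Proof. by rewrite /isum -map_comp. Qed.

Lemma isum_ren (F : rterm -> nat) f g E : (forall t, F (qren f g t) = F t) ->
  isum F (ritems f g E) = isum F E.
Proof. by move=> H; rewrite /isum -map_comp; congr sumn; apply: eq_map => e /=. Qed.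

(** An exact count, since every item is used once and the only new constructors are applications,
    which count for nothing. *)
Lemma sub_cnt cl cm s t E u : sub s t E u ->
  qcnt cl cm u = qcnt cl cm t + isum (qcnt cl cm) E.
Proof.
elim/rterm_ind: t s E u => [x|t IH|t B IH IHB|b t IH] s E u.
- move=> /sub_inv_var; case: (vr s x) => [y [-> ->]|->]; rewrite !qcntE //.
  by rewrite /isum /= addn0.
- move=> /sub_inv_lam[u' /IH + ->]; rewrite !qcntE => ->.
  by rewrite isum_ren ?addnA //; exact: qcnt_ren.
- move=> /sub_inv_app[E0 [E1 [u' [D [pE /IH e H ->]]]]].
  rewrite !qcntE e (isum_perm _ pE) isum_cat.
  suff -> : sumn (map (qcnt cl cm) D) = sumn (map (qcnt cl cm) B) + isum (qcnt cl cm) E1 by lia.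
  elim: B IHB {e pE} E1 D H => [|v B IHB'] IHB E1 D; first by move=> /subs_inv_nil[-> ->].
  move=> /subs_inv_cons[X [Y [w [D' [p H1 H2 ->]]]]] /=.
  rewrite (IHB' _ _ _ H2) => [|z zB]; last by apply: IHB; rewrite in_cons zB orbT.
  by rewrite (IHB v (mem_head _ _) _ _ _ H1) (isum_perm _ p) isum_cat; lia.
- move=> /sub_inv_mu[u' /subn_inv + ->]; rewrite !qcntE.
  rewrite -(isum_ren E (qcnt_ren cl cm id succn)).
  case: ifP => [_ [E0 [D [u'' [p /IH e ->]]]]|_ /IH -> //]; last by lia.
  by rewrite qcntE (isum_perm _ p) isum_cat isum_tag e; lia.
Qed.

Lemma subn_cnt cl cm s h t E u : subn s h t E u ->
  qcnt cl cm u = qcnt cl cm t + isum (qcnt cl cm) E.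
Proof.
move/subn_inv; case: ifP => [_ [E0 [D [u' [p /(sub_cnt cl cm) e ->]]]]|_ /(sub_cnt cl cm) //].
by rewrite qcntE (isum_perm _ p) isum_cat isum_tag e; lia.
Qed.

(** Each mu abstraction of t names one subterm, around which at most one application is created, of
    weight at most [K ^ e]; the last summand pays for these. Items moved under mu abstractions do
    not gain weight. *)
Definition wgt_for K (t : rterm) : Prop := forall s e E u, sub s t E u ->
  qwgt K e u <= qwgt K e t + isum (qwgt K e) E + qcnt 0 1 t * K ^ e.

Lemma subn_wgt_aux K t : 0 < K -> wgt_for K t -> forall s h e E u, subn s h t E u ->
  qwgt K e u <= qwgt K e t + isum (qwgt K e) E + (qcnt 0 1 t).+1 * K ^ e.
Proof.
move=> K0 IH s h e E u /subn_inv; rewrite mulSn.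
case: ifP => [_ [E0 [D [u' [p /(IH _ e) l ->]]]]|_ /(IH _ e) l]; last by lia.
by rewrite qwgtE (isum_perm _ p) isum_cat isum_tag; lia.
Qed.

Lemma sub_wgt K t : 0 < K -> wgt_for K t.
Proof.
move=> K0; elim/rterm_ind: t => [x|t IH|t B IH IHB|b t IH] s e E u.
- move=> /sub_inv_var; case: (vr s x) => [y [-> ->]|->]; rewrite !qwgtE //.
  by rewrite /isum /=; lia.
- move=> /sub_inv_lam[u' /(IH _ e) + ->]; rewrite !qwgtE !qcntE isum_ren //.
  exact: qwgt_ren.
- move=> /sub_inv_app[E0 [E1 [u' [D [pE /(IH _ e) l H ->]]]]].
  rewrite !qwgtE !qcntE (isum_perm _ pE) isum_cat mulnDl.
  suff : sumn (map (qwgt K e) D) <= sumn (map (qwgt K e) B) + isum (qwgt K e) E1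
           + sumn (map (qcnt 0 1) B) * K ^ e by lia.
  elim: B IHB {l pE} E1 D H => [|v B IHB'] IHB E1 D; first by move=> /subs_inv_nil[-> ->].
  move=> /subs_inv_cons[X [Y [w [D' [p H1 H2 ->]]]]] /=.
  have l1 := IHB v (mem_head _ _) _ e _ _ H1.
  have l2 := IHB' (fun z zB => IHB z (mem_behead (s := _ :: B) zB)) _ _ H2.
  by rewrite (isum_perm _ p) isum_cat mulnDl; lia.
- move=> /sub_inv_mu[u' /(subn_wgt_aux K0 IH e.-1) + ->]; rewrite !qwgtE !qcntE.
  rewrite isum_ren; last exact: qwgt_ren.
  have l1 : isum (qwgt K e.-1) E <= isum (qwgt K e) E.
    by apply: leq_sumn => i _; apply: qwgt_mono => //; lia.
  have l2 : (qcnt 0 1 t).+1 * K ^ e.-1 <= (1 + qcnt 0 1 t) * K ^ e.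
    by rewrite add1n leq_mul2l leq_pexp2l ?orbT //; lia.
  by lia.
Qed.

Lemma subn_wgt K s h t e E u : 0 < K -> subn s h t E u ->
  qwgt K e u <= qwgt K e t + isum (qwgt K e) E + (qcnt 0 1 t).+1 * K ^ e.
Proof. by move=> K0; apply: (subn_wgt_aux K0 (sub_wgt K0)). Qed.

(* Every rule but mu erases an abstraction; the mu rule preserves the number of
   abstractions mu, and replaces an application by at most that many of them,
   each under one more mu. *)
Lemma qstep_decr t P v : qstep t P -> P v ->
  qcnt 1 1 v < qcnt 1 1 t \/
  [/\ qcnt 1 1 v = qcnt 1 1 t, qcnt 0 1 v = qcnt 0 1 t
    & forall K e, qcnt 0 1 t < K -> qcnt 0 1 t <= e -> qwgt K e v < qwgt K e t].
Proof.
move=> H; elim: H v => {t P}.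
- move=> t B v /(sub_cnt 1 1) ->; left.
  by rewrite !qcntE isum_tag; lia.
- move=> h t B _ [w Hw ->]; right.
  have F c c' : map (qcnt c c') (map qshn B) = map (qcnt c c') B.
    by rewrite -map_comp; apply: eq_map => b /=; rewrite qcnt_ren.
  rewrite !qcntE !(subn_cnt _ _ Hw) !isum_tag !F; split; [lia|lia|].
  (* The redex contains a mu abstraction, so the exponent is positive and its predecessor under that
     abstraction is not truncated. *)
  move=> K [|e] l1 l2; first by lia.
  rewrite !qwgtE /=.
  have K0 : 0 < K by lia.
  have := subn_wgt e K0 Hw; rewrite isum_tag.
  have -> : map (qwgt K e) (map qshn B) = map (qwgt K e) B.
    by rewrite -map_comp; apply: eq_map => b /=; rewrite qwgt_ren.
  have l3 : sumn (map (qwgt K e) B) <= sumn (map (qwgt K e.+1) B).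
    by apply: leq_sumn => b _; apply: qwgt_mono.
  (* The erased application weighs [K ^ e.+1], which exceeds the new applications: at most one for
     each mu abstraction of the redex, including the contracted one. *)
  have : (qcnt 0 1 t).+1 * K ^ e < K * K ^ e by rewrite ltn_mul2r expn_gt0 K0 /=; lia.
  by rewrite -expnS; lia.
- by move=> a h t _ ->; left; rewrite !qcntE qcnt_ren; lia.
- move=> t P _ IH _ [v /IH + ->]; rewrite !qcntE => -[l|[e1 e2 l]]; [left; lia|right].
  by split; [lia|lia|move=> K e l1 l2; rewrite !qwgtE; apply: l; lia].
- move=> t P B _ IH _ [v /IH + ->]; rewrite !qcntE => -[l|[e1 e2 l]]; [left; lia|right].
  split; [lia|lia|move=> K e l1 l2; rewrite !qwgtE].
  by have := l K e; lia.
- move=> t v P B _ IH _ [w /IH + ->]; rewrite !qcntE /= => -[l|[e1 e2 l]]; [left; lia|right].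
  split; [lia|lia|move=> K e l1 l2; rewrite !qwgtE /=].
  by have := l K e; lia.
- move=> b t P _ IH _ [v /IH + ->]; rewrite !qcntE => -[l|[e1 e2 l]]; [left; lia|right].
  by split; [lia|lia|move=> K e l1 l2; rewrite !qwgtE; apply: l; lia].
Qed.

Lemma red1_acc t : Acc (fun u t => red1 t u) t.
Proof.
(* Lexicographic order. Base and exponent are the least that [qstep_decr] admits; when the number of
   abstractions does not drop, neither of them changes and the two weights are comparable. *)
suff H n w u : qcnt 1 1 u = n -> qwgt (qcnt 0 1 u).+1 (qcnt 0 1 u) u = w ->
    Acc (fun u t => red1 t u) u by exact: H erefl erefl.
elim/ltn_ind: n w u => n IHn; elim/ltn_ind=> w IHw u en ew.
constructor=> v [P H Pv]; case: (qstep_decr H Pv) => [l|[e1 e2 l]].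
  by apply: (IHn (qcnt 1 1 v)) erefl erefl; lia.
apply: (IHw (qwgt (qcnt 0 1 v).+1 (qcnt 0 1 v) v)) erefl; last by lia.
by rewrite -ew e2; apply: l.
Qed.

(** * Normal forms *)

Definition qnormal (t : rterm) : Prop := forall P, ~ qstep t P.

(** Membership in the normal form, witnessed by some choice of steps; [nfmE] shows that any other
    step would do. *)
Inductive nfm : rterm -> rterm -> Prop :=
| nfm_nf t : qnormal t -> nfm t t
| nfm_step t P v s : qstep t P -> P v -> nfm v s -> nfm t s.

Lemma nfm_normal t s : qnormal t -> nfm t s -> s = t.
Proof. by move=> n H; case: H n => // {}t P v s' H _ _ /(_ P). Qed.

(** Newman's argument: below t the predicate is invariant by induction, and local confluence moves
    the witness from the step chosen in [nfm] to the given one. *)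
Lemma nfm_hinv s t : hinv (nfm^~ s) t.
Proof.
elim: (red1_acc t) => {}t _ IH; apply: hinv_shinv => // P H.
split=> [Hn|[v Pv Hv]]; last exact: nfm_step H Pv Hv.
case: Hn H IH => [{}t n /n //|{}t P' v {}s H' Pv Hv H IH].
by apply/(local_confluence IH H' H); exists v.
Qed.

Lemma nfmE s t P : qstep t P -> nfm t s <-> exists2 v, P v & nfm v s.
Proof. exact: (hinv_at (@nfm_hinv s t)). Qed.

Lemma normal_or_step t : qnormal t \/ exists P, qstep t P.
Proof.
case: (classic (exists P, qstep t P)) => H; [by right|left=> P HP].
by apply: H; exists P.
Qed.

(** The induction reduces only the term in the hole, although [K t] may have other redexes:
    invariance allows this order of reduction. Once t is normal, it is its own normal form. *)
Lemma nfm_ctx K t s : semctx K ->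
  nfm (K t) s <-> exists2 t', nfm t t' & nfm (K t') s.
Proof.
move=> hK; elim: (red1_acc t) => {}t _ IH.
case: (normal_or_step t) => [n|[P H]].
  split=> [Hs|[t' /(nfm_normal n) -> //]].
  by exists t => //; constructor.
rewrite (semctxE hK H (@nfm_hinv s (K t))).
split=> [[p Pp]|[t' /(nfmE _ H)[p Pp Hp] Hs]].
  rewrite IH => [[t' H1 H2]|]; last by exists P.
  by exists t' => //; apply/(nfmE _ H); exists p.
exists p => //; rewrite IH; last by exists P.
by exists t'.
Qed.


(** * The reduction of raw terms *)

Lemma splits_sound (T : eqType) (B : seq T) p : p \in splits B -> perm_eq B (p.1 ++ p.2).
Proof.
elim: B p => [|v B IH] p /=; first by rewrite inE => /eqP ->.
rewrite mem_cat => /orP[|] /mapP[q /IH H ->] /=; first by rewrite perm_cons.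
by rewrite perm_sym perm_catC /= perm_cons perm_catC perm_sym.
Qed.

(** The enumeration distributes positions of a list; taking h to be [cls], it still reaches every
    decomposition of the multiset of classes up to permutation. *)
Lemma splits_complete (T U : eqType) (h : T -> U) B A1 A2 :
  perm_eq (map h B) (A1 ++ A2) ->
  exists2 p, p \in splits B & perm_eq (map h p.1) A1 /\ perm_eq (map h p.2) A2.
Proof.
elim: B A1 A2 => [|v B IH] A1 A2 /=.
  by move=> /perm_nil_cat[-> ->]; exists ([::], [::]).
case/perm_cons_cat => [[A' p1 p2]|[A' p1 p2]].
  have [q qB [q1 q2]] := IH _ _ p2.
  exists (v :: q.1, q.2); first by rewrite mem_cat; apply/orP; left; apply/mapP; exists q.
  by split=> //=; rewrite perm_sym (permPl p1) perm_cons perm_sym.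
have [q qB [q1 q2]] := IH _ _ p2.
exists (q.1, v :: q.2); first by rewrite mem_cat; apply/orP; right; apply/mapP; exists q.
by split=> //=; rewrite perm_sym (permPl p1) perm_cons perm_sym.
Qed.

(* [F] computes, on raw terms, the substitution of t along s restricted to items
   of key k. *)
Definition computes (F : seq rawterm -> seq rawterm) (s : lsubst) (k : key)
    (t : rterm) : Prop :=
  forall B u, (exists2 r, r \in F B & u = cls r) <-> sub s t (tag k (map cls B)) u.

Lemma computes_bags G s k vs :
  (forall v, v \in vs -> computes (G v) s k (cls v)) ->
  forall B D, (exists2 D0, (exists2 Bs, Bs \in wcs (size vs) B
      & D0 \in bags_of [seq p.1 p.2 | p <- zip (map G vs) Bs]) & D = map cls D0) <->
    subs s (map cls vs) (tag k (map cls B)) D.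
Proof.
elim: vs => [|v vs IH] Hvs B D /=.
  split=> [[D0 [Bs]]|/subs_inv_nil[]].
    case: B => //=; rewrite inE => /eqP -> /=; rewrite inE => /eqP -> ->.
    exact: subs_nil.
  by case: B => // _ ->; exists [::] => //; exists [::].
have {}IH := IH (fun w wB => Hvs w (mem_behead (s := v :: vs) wB)).
have {}Hvs := Hvs v (mem_head _ _).
split=> [[D0 [Bs /allpairsPdep[p [Bs' [pB BsB ->]]] /=]]|].
  move=> /allpairsPdep[d [D' [dF DD ->]]] ->.
  apply: (subs_cons (E0 := tag k (map cls p.1)) (E1 := tag k (map cls p.2))).
  - by rewrite -!map_cat; do 2 apply: perm_map; apply: splits_sound.
  - by apply/Hvs; exists d.
  - by apply/IH; exists D' => //; exists Bs'.
move=> /subs_inv_cons[E0 [E1 [u [D' [p H1 H2 ->]]]]].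
have [A pA /esym/map_eq_cat[A0 [A1 [? ? ?]]]] := perm_map_eq p; subst.
have [q qB [q1 q2]] := splits_complete pA.
rewrite perm_sym in q1; rewrite perm_sym in q2.
have [r rF ->] := (Hvs _ _).2 (sub_perm (perm_map _ q1) H1).
have [D0 [Bs BsB DD] ->] := (IH _ _).2 (subs_perm_items (perm_map _ q2) H2).
exists (r :: D0) => //; exists (q.1 :: Bs).
  by apply/allpairsPdep; exists q, Bs.
by apply/allpairsPdep; exists r, D0.
Qed.

Lemma computes_distribute F G s k t vs :
  computes F s k (cls t) -> (forall v, v \in vs -> computes (G v) s k (cls v)) ->
  computes (distribute F (map G vs)) s k (qApp (cls t) (map cls vs)).
Proof.
move=> HF /computes_bags HG B u; rewrite /distribute size_map.
split=> [[r /flatten_mapP[Bs /allpairsPdep[p [Bs' [pB BsB ->]]] /=]]|].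
  move=> /allpairsPdep[d [D [dF DD ->]]] ->; rewrite cls_qApp.
  apply: (sub_app (E0 := tag k (map cls p.1)) (E1 := tag k (map cls p.2))).
  - by rewrite -!map_cat; do 2 apply: perm_map; apply: splits_sound.
  - by apply/HF; exists d.
  - by apply/HG; exists D => //; exists Bs'.
move=> /sub_inv_app[E0 [E1 [u' [D' [p H1 H2 ->]]]]].
have [A pA /esym/map_eq_cat[A0 [A1 [? ? ?]]]] := perm_map_eq p; subst.
have [q qB [q1 q2]] := splits_complete pA.
rewrite perm_sym in q1; rewrite perm_sym in q2.
have [r rF ->] := (HF _ _).2 (sub_perm (perm_map _ q1) H1).
have [D0 [Bs BsB DD] ->] := (HG _ _).2 (subs_perm_items (perm_map _ q2) H2).
exists (RApp r D0); last by rewrite cls_qApp.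
apply/flatten_mapP; exists (q.1 :: Bs); first by apply/allpairsPdep; exists q, Bs.
by apply/allpairsPdep; exists r, D0.
Qed.

(** Substitutions contain functions and are compared pointwise; the transport is [sub_ren] along the
    identity. *)
Lemma sub_ext s s' t E u : vr s =1 vr s' -> nr s =1 nr s' -> ap s =1 ap s' ->
  sub s t E u -> sub s' t E u.
Proof.
move=> e1 e2 e3 H; have q : sq id id s s'.
  by split=> x; rewrite -?e1 -?e2 -?e3 //; case: (vr s x).
have := sub_ren q H; rewrite !qren_id // map_id_in // => -[[x|a] v] _;
  by rewrite /ritem /= qren_id.
Qed.

Lemma subn_ext s s' h t E u : vr s =1 vr s' -> nr s =1 nr s' -> ap s =1 ap s' ->
  subn s h t E u -> subn s' h t E u.
Proof.
move=> e1 e2 e3 /subn_inv; case: ifP => ah.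
  move=> [E0 [D [u' [p H ->]]]]; apply: subn_app p _; first by rewrite -e3.
  exact: sub_ext H.
by move=> H; apply: subn_keep; [rewrite -e3 | apply: sub_ext H].
Qed.

Lemma ritems_cls f g k B : ritems f g (tag k (map cls B)) =
  tag (kmap f g k) (map cls (map (rren f g) B)).
Proof.
rewrite ritems_tag; congr (tag _ _); rewrite -!map_comp.
by apply: eq_map => v /=; rewrite cls_rren.
Qed.

Lemma foldr_conj_mem (Q : rawterm -> Prop) B :
  foldr (fun u X => Q u /\ X) True B -> forall v, v \in B -> Q v.
Proof.
elim: B => //= u B IH [Qu /IH{}IH] v.
by rewrite in_cons => /predU1P[->|/IH].
Qed.

(** Unlike [sbeta], it leaves a gap at x, as [lsub] does. *)
Definition slsub x := LSubst (fun y => if y == x then None else Some y) id (fun=> false).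

Lemma upn_id a : up id a = a.
Proof. by case: a. Qed.

Lemma sub_mu_id s h t E u : nr (upn s) h = h ->
  subn (upn s) h t (ritems id succn E) u -> sub s (qMu h t) E (qMu h u).
Proof. by move=> e; rewrite -{3}e; constructor. Qed.

Lemma computes_map_lam F s k t :
  computes F (upv s) (kshv k) (cls t) ->
  computes (fun B => [seq RLam u | u <- F (map (rren succn id) B)]) s k (cls (RLam t)).
Proof.
move=> H B u; rewrite cls_qLam; split=> [[_ /mapP[r rF ->] ->]|].
  by rewrite cls_qLam; apply: sub_lam; rewrite ritems_cls; apply/H; exists r.
move=> /sub_inv_lam[u' + ->]; rewrite ritems_cls => /H[r rF ->].
by exists (RLam r); [apply: map_f | rewrite cls_qLam].
Qed.

Lemma computes_ext F s s' k t : vr s =1 vr s' -> nr s =1 nr s' -> ap s =1 ap s' ->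
  computes F s k t -> computes F s' k t.
Proof.
move=> e1 e2 e3 H B u; rewrite H; split; first exact: sub_ext.
by apply: sub_ext => x; rewrite (e1, e2, e3).
Qed.

Lemma lsub_computes x t : computes (lsub x t) (slsub x) (inl x) (cls t).
Proof.
elim/rawterm_nested_ind: t x => [y|t IH|t vs IH IHvs|b t IH] x.
- move=> B u /=; split=> [|/sub_inv_var /=]; case: eqVneq => [->|ne].
  + case: B => [|v [|? ?]] [r] //; rewrite inE => /eqP -> -> /=.
    by apply: sub_hit; rewrite /= eqxx.
  + case: B => [|? ?] [r] //; rewrite inE => /eqP -> -> /=.
    by apply: sub_keep; rewrite /= (negbTE ne).
  + by case: B => [|v [|? ?]] // [<-]; exists v; rewrite ?inE.
  + by case: B => [|? ?] [] // _ ->; exists (RVar y); rewrite ?inE.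
- apply: computes_map_lam; apply: computes_ext (IH x.+1) => // -[|y] //=.
  by rewrite eqSS; case: eqP.
- rewrite cls_qApp; apply: computes_distribute; first exact: IH.
  by move=> v vB; apply: (foldr_conj_mem IHvs vB x).
- move=> B u; rewrite cls_qMu /=.
  have H E w : sub (upn (slsub x)) (cls t) E w <-> sub (slsub x) (cls t) E w.
    by split; apply: sub_ext => // y /=; rewrite ?upn_id //; case: y.
  split=> [[_ /mapP[r rF ->] ->]|/sub_inv_mu[u' /subn_inv]].
    rewrite cls_qMu; apply: sub_mu_id; [exact: upn_id | apply: subn_keep].
      by case: (b).
    by apply/H; rewrite ritems_cls; apply/IH; exists r.
  rewrite [nr _ b]upn_id ifF; last by case: (b).
  move=> /H; rewrite ritems_cls => /IH[r rF ->] ->.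
  by exists (RMu b r); [apply: map_f | rewrite cls_qMu].
Qed.

Lemma nap_named_computes a h t F : computes F (snap a) (inr a) (cls t) ->
  forall B u, (exists2 r, r \in nap_named F a h B & u = cls r) <->
    subn (snap a) h (cls t) (tag (inr a) (map cls B)) u.
Proof.
move=> HF B u; rewrite /nap_named; case: eqVneq => [->|ne]; last first.
  rewrite HF; split=> [H|/subn_inv /=]; last by rewrite (negbTE ne).
  by apply: subn_keep; rewrite //= (negbTE ne).
split=> [[_ /allpairsPdep[p [r [pB rF ->]]] ->]|/subn_inv /=].
  rewrite cls_qApp; apply: (subn_app (E0 := tag (inr a) (map cls p.1))).
  - by rewrite /= eqxx.
  - by rewrite -!map_cat; do 2 apply: perm_map; apply: splits_sound.
  - by apply/HF; exists r.
rewrite eqxx => -[E0 [D [u' [p H1 ->]]]].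
have [A pA /esym/map_eq_cat[A0 [A1 [? ? eD]]]] := perm_map_eq p; subst.
have {}eD : D = A1 by apply: inj_map eD => x y [].
have [q qB [q1 q2]] := splits_complete pA; subst.
rewrite perm_sym in q1.
have [r rF ->] := (HF _ _).2 (sub_perm (perm_map _ q1) H1).
exists (RApp r q.2); first by apply/allpairsPdep; exists q, r.
by rewrite cls_qApp; apply: qApp_perm; rewrite perm_sym.
Qed.

Lemma nap_computes a t : computes (nap a t) (snap a) (inr a) (cls t).
Proof.
elim/rawterm_nested_ind: t a => [y|t IH|t vs IH IHvs|b t IH] a.
- move=> B u /=; split=> [[r]|/sub_inv_var /=].
    by case: B => [|? ?] //; rewrite inE => /eqP -> -> /=; apply: sub_keep.
  by case: B => [|? ?] [] // _ ->; exists (RVar y); rewrite ?inE.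
- by apply: computes_map_lam; apply: computes_ext (IH a) => // -[].
- rewrite cls_qApp; apply: computes_distribute; first exact: IH.
  by move=> v vB; apply: (foldr_conj_mem IHvs vB a).
- move=> B u; rewrite cls_qMu /=.
  have H E w : subn (upn (snap a)) b (cls t) E w <-> subn (snap a.+1) b (cls t) E w.
    by split; apply: subn_ext => // y /=; rewrite ?upn_id //; case: y.
  have HN := nap_named_computes b (IH a.+1).
  split=> [[_ /mapP[r rF ->] ->]|/sub_inv_mu[u']].
    rewrite cls_qMu; apply: sub_mu_id; first exact: upn_id.
    by apply/H; rewrite ritems_cls; apply/HN; exists r.
  rewrite [nr _ b]upn_id => /H; rewrite ritems_cls => /HN[r rF ->] ->.
  by exists (RMu b r); [apply: map_f | rewrite cls_qMu].
Qed.

(** The raw beta rule substitutes shifted items and then lowers all variables; as [predn] undoes the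
    shift of the items, the composition law identifies this with [sbeta]. *)
Lemma sub_sbetaE t B u : sub sbeta t (tag (inl 0) B) u <->
  exists2 v, sub (slsub 0) t (tag (inl 0) (map qshv B)) v & u = qren predn id v.
Proof.
have c : iscomp (slsub 0) (rens predn id) sbeta by split=> // -[].
have phi v D w : sub (rens predn id) (qshv v) D w <-> D = [::] /\ w = v.
  by rewrite (@sub_after_ren _ _ id id _ (rens id id)) // qren_id.
have eE : tag (inl 0) (map qshv B) = map (kitem id qshv) (tag (inl 0) B).
  by rewrite -!map_comp.
split=> [H|[v H ->]].
  have cE : comp (slsub 0) (rens predn id) (tag (inl 0) (map qshv B)) [::] (tag (inl 0) B).
    rewrite eE -[X in comp _ _ _ _ X]map_kitem_id; apply: comp_map_old.
      by move=> v; apply/phi.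
    by move=> e /mapP[b _ ->].
  have [v H1 /(sub_isren _ _ _ (isren_rens predn id))[_ ->]] := sub_bwd c cE H.
  by exists v.
have H2 : sub (rens predn id) v [::] (qren predn id v).
  exact/(sub_isren _ _ _ (isren_rens predn id)).
have [X cX] := sub_fwd c H H2; apply: sub_perm.
rewrite -(map_kitem_id (tag _ B)) -[X in perm_eq _ X]cats0.
rewrite eE in cX.
apply: (comp_inert_inv (k := inl 0) (k' := inl 0) (B := [::]) _ _ cX) => [w D w' /phi //|].
by move=> [[|x]|a].
Qed.

Lemma mem_map_cls (f : rawterm -> rawterm) T x :
  (x \in map cls (map f T)) <-> exists2 r, r \in T & x = cls (f r).
Proof.
split=> [/mapP[_ /mapP[r rT ->] ->]|[r rT ->]]; first by exists r.
by do 2 apply: map_f.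
Qed.

Lemma img_cls K (f : rawterm -> rawterm) (P : rterm -> Prop) T : (forall r, cls (f r) = K (cls r)) ->
  (forall x, P x <-> x \in map cls T) ->
  forall x, img K P x <-> x \in map cls (map f T).
Proof.
move=> fK PT x; rewrite mem_map_cls; split=> [[v /PT/mapP[r rT ->] ->]|[r rT ->]].
  by exists r.
by exists (cls r); [apply/PT; apply: map_f | rewrite fK].
Qed.

Lemma raw_step_qstep t T : raw_step t T ->
  exists2 P, qstep (cls t) P & forall x, P x <-> x \in map cls T.
Proof.
elim=> {t T}.
- move=> t B; rewrite cls_qApp cls_qLam; eexists; first exact: qstep_beta.
  move=> x; rewrite mem_map_cls /beta_set sub_sbetaE.
  have -> : map qshv (map cls B) = map cls (map (rren succn id) B).
    by rewrite -!map_comp; apply: eq_map => v /=; rewrite cls_rren.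
  split=> [[v /lsub_computes[r rT ->] ->]|[r rT ->]].
    by exists r => //; rewrite cls_rren.
  by exists (cls r); [apply/lsub_computes; exists r | rewrite cls_rren].
- move=> b t B; rewrite cls_qApp cls_qMu; eexists; first exact: qstep_mu.
  move=> x; rewrite mem_map_cls /mu_set.
  have -> : map qshn (map cls B) = map cls (map (rren id succn) B).
    by rewrite -!map_comp; apply: eq_map => v /=; rewrite cls_rren.
  have HN := nap_named_computes b (nap_computes 0 t).
  split=> [[v /HN[r rT ->] ->]|[r rT ->]].
    by exists r => //; rewrite cls_qMu.
  by exists (cls r); [apply/HN; exists r | rewrite cls_qMu].
- move=> a h t; rewrite !cls_qMu; eexists; first exact: qstep_rho.
  move=> x /=; rewrite inE cls_qMu cls_rren; split=> [->|/eqP //].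
  exact: eqxx.
- move=> t T _ [P H PT]; rewrite cls_qLam; eexists; first exact: qstep_in_lam H.
  by apply: img_cls => // r; rewrite cls_qLam.
- move=> t T B _ [P H PT]; rewrite cls_qApp; eexists; first exact: qstep_in_fun H.
  by apply: img_cls => // r; rewrite cls_qApp.
- move=> t B1 v V B2 _ [P H PT]; rewrite cls_qApp.
  have p w : perm_eq (map cls (B1 ++ w :: B2)) (cls w :: map cls (B1 ++ B2)).
    by rewrite -map_cons; apply: perm_map; rewrite perm_catC /= perm_cons perm_catC.
  rewrite (qApp_perm _ (p v)); eexists; first exact: qstep_in_bag H.
  by apply: img_cls => // r; rewrite cls_qApp (qApp_perm _ (p r)).
- move=> b t T _ [P H PT]; rewrite cls_qMu; eexists; first exact: qstep_in_mu H.
  by apply: img_cls => // r; rewrite cls_qMu.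
Qed.

(** Ensures that every reducible class has a reducible representative; [raw_step_qstep] then
    describes the reduct obtained. *)
Lemma qstep_raw t P : qstep t P -> exists t0 T0, t = cls t0 /\ raw_step t0 T0.
Proof.
elim=> {t P}.
- move=> t B; exists (RApp (RLam (repr t)) (map repr B)).
  by eexists; split; [rewrite cls_qApp map_clsK | exact: step_lam].
- move=> h t B; exists (RApp (RMu h (repr t)) (map repr B)).
  by eexists; split; [rewrite cls_qApp map_clsK | exact: step_mu].
- move=> a h t; exists (RMu a (RMu h (repr t))).
  by eexists; split; [rewrite cls_qMu | exact: step_rho].
- move=> t P _ [t0 [T0 [-> H]]]; exists (RLam t0).
  by eexists; split; [rewrite cls_qLam | exact: step_in_lam H].
- move=> t P B _ [t0 [T0 [-> H]]]; exists (RApp t0 (map repr B)).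
  by eexists; split; [rewrite cls_qApp map_clsK | exact: step_in_fun H].
- move=> t v P B _ [t0 [T0 [-> H]]]; exists (RApp (repr t) (t0 :: map repr B)).
  eexists; split; first by rewrite cls_qApp /= map_clsK clsK.
  exact: (@step_in_bag _ [::]) H.
- move=> b t P _ [t0 [T0 [-> H]]]; exists (RMu b t0).
  by eexists; split; [rewrite cls_qMu | exact: step_in_mu H].
Qed.

(** * Sums *)

Local Open Scope fset_scope.

Lemma res_step_qstep t T : res_step t T ->
  exists2 P, qstep t P & forall x, P x <-> x \in T.
Proof.
move=> [t0 [T0 [-> /raw_step_qstep[P H PT] ->]]]; exists P => // x.
rewrite PT; split=> [/mapP[r rT ->]|/imfsetP[r /= rT ->]]; last exact: map_f.
by apply/imfsetP; exists r.
Qed.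

Lemma qstep_res t P : qstep t P -> exists T, res_step t T.
Proof.
move=> /qstep_raw[t0 [T0 [-> H]]].
by exists [fset cls u | u in T0]; exists t0, T0.
Qed.

Lemma sum_step_nfm S S' s : sum_step S S' ->
  (exists2 t, t \in S & nfm t s) <-> (exists2 t, t \in S' & nfm t s).
Proof.
case=> t T S0 /res_step_qstep[P H PT] _; split=> -[u].
  rewrite in_fset1U => /orP[/eqP ->|uS Hu]; last by exists u; rewrite // in_fsetU uS orbT.
  by move/(nfmE _ H) => [v /PT vT Hv]; exists v; rewrite // in_fsetU vT.
rewrite in_fsetU => /orP[uT Hu|uS Hu]; last by exists u; rewrite // in_fset1U uS orbT.
exists t; first by rewrite in_fset1U eqxx.
by apply/(nfmE _ H); exists u => //; apply/PT.
Qed.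

Lemma sum_steps_nfm S S' s : clos_refl_trans rsum sum_step S S' ->
  (exists2 t, t \in S & nfm t s) <-> (exists2 t, t \in S' & nfm t s).
Proof.
elim=> [S1 S2 H|S1|S1 S2 S3 _ H1 _ H2]; [exact: sum_step_nfm|by []|].
by rewrite H1.
Qed.

Lemma sum_normalP S : sum_normal S <-> forall t, t \in S -> qnormal t.
Proof.
split=> [n t tS P /qstep_res[T HT]|n S' H].
  (* Removing t from S makes it disjoint from the rest, as [SumStep] requires. *)
  apply: (n (T `|` (S `\ t))); rewrite -{1}(fsetD1K tS); constructor=> //.
  by rewrite !inE eqxx.
case: H n => t T S0 /res_step_qstep[P H _] _ n.
by apply: (n t _ P H); rewrite in_fset1U eqxx.
Qed.

(** Having a summand t with [nfm t s] is preserved both ways by the reduction of sums, and in a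
    normal sum it means containing s. *)
Lemma is_nf_nfm t S s : is_nf t S -> (s \in S <-> nfm t s).
Proof.
move=> [/(@sum_steps_nfm _ _ s) H /sum_normalP n].
have <- : (exists2 x, x \in [fset t] & nfm x s) <-> nfm t s.
  split=> [[x] |Ht]; first by rewrite inE => /eqP ->.
  by exists t; rewrite ?inE.
rewrite H; split=> [sS|[x xS /(nfm_normal (n x xS)) -> //]].
by exists s => //; constructor; exact: n.
Qed.

(** The summands in Ls are normalised one by one, those in A being tolerated. The hypothesis allows
    an arbitrary rest S0, since reducts of earlier summands may coincide with terms still
    present. *)
Lemma sum_normalize (A : rterm -> Prop) (Ls : seq rterm) :
  (forall t, t \in Ls -> forall S0 : rsum, exists2 R : rsum,
     clos_refl_trans rsum sum_step (t |` S0) R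
     & forall x, x \in R -> qnormal x \/ x \in S0) ->
  forall S : rsum, (forall x, x \in S -> [\/ qnormal x, A x | x \in Ls]) ->
  exists2 R : rsum, clos_refl_trans rsum sum_step S R
    & forall x, x \in R -> qnormal x \/ A x.
Proof.
elim: Ls => [|t Ls IH] HL S HS.
  exists S; first exact: rt_refl.
  by move=> x /HS[|| //]; [left|right].
have {}IH := IH (fun u uL => HL u (mem_behead (s := t :: Ls) uL)).
case tS: (t \in S); last first.
  apply: IH => x xS; case: (HS x xS) => [||]; [by constructor 1|by constructor 2|].
  rewrite in_cons => /orP[/eqP ex|]; last by constructor 3.
  by rewrite -ex xS in tS.
have [R1 HR1 n1] := HL t (mem_head _ _) (S `\ t).
have [|R HR n] := IH R1.
  move=> x /n1[|]; first by constructor 1.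
  rewrite !inE => /andP[/negbTE xt /HS[||]]; [by constructor 1|by constructor 2|].
  by rewrite in_cons xt; constructor 3.
exists R => //; apply: rt_trans HR.
by rewrite -(fsetD1K tS).
Qed.

Lemma sum_normalize1 t (S0 : rsum) : exists2 R : rsum,
  clos_refl_trans rsum sum_step (t |` S0) R & forall x, x \in R -> qnormal x \/ x \in S0.
Proof.
elim: (red1_acc t) S0 => {}t _ IH S0.
(* If t is already in S0, adding it changes nothing, and it may remain as a member of S0. *)
case: (boolP (t \in S0)) => tS0.
  exists S0; last by right.
  rewrite (_ : t |` S0 = S0); first exact: rt_refl.
  by apply/fsetUidPr; rewrite fsub1set.
case: (normal_or_step t) => [n|[P /qstep_res[T HT]]].
  exists (t |` S0); first exact: rt_refl.
  by move=> x; rewrite in_fset1U => /orP[/eqP ->|]; [left|right].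
have [P' H PT] := res_step_qstep HT.
have [u|x|R HR n] := @sum_normalize (fun x => x \in S0) T _ (T `|` S0).
- by move=> uT S1; apply: IH; exists P' => //; apply/PT.
- by rewrite in_fsetU => /orP[|]; [constructor 3|constructor 2].
exists R => //; apply: rt_trans HR; apply: rt_step.
exact: SumStep.
Qed.

Lemma is_nf_ex t : exists S, is_nf t S.
Proof.
have [R HR n] := sum_normalize1 t fset0.
exists R; split; first by rewrite fsetU0 in HR.
apply/sum_normalP => x /n[] //; by rewrite inE.
Qed.

(** * Monotonicity *)

Lemma NFT_nfm M s : NFT M s <-> exists2 t, taylor M t & nfm (cls t) s.
Proof.
split=> [[t [S [Ht n sS]]]|[t Ht Hs]]; first by exists t => //; apply/(is_nf_nfm s n).
have [S n] := is_nf_ex (cls t).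
by exists t, S; split=> //; apply/(is_nf_nfm s n).
Qed.

(** Filling a hole under a binder renames the filled term in order to capture; this moves the
    renaming into the resource context. *)
Lemma taylor_ren M f g t :
  taylor (ren f g M) t <-> exists2 t0, taylor M t0 & t = rren f g t0.
Proof.
elim: M f g t => [x|M IH|M IHM N IHN|b M IH] f g t /=.
- by split=> [->|[_ -> ->] //]; exists (RVar x).
- split=> [[_ /IH[t0 Ht ->] ->]|[_ [t0 Ht ->] ->]]; first by exists (RLam t0) => //; exists t0.
  by exists (rren (up f) g t0) => //; apply/IH; exists t0.
- split=> [[_ [B [/IHM[t0 Ht ->] HB ->]]]|[_ [t0 [B [Ht HB ->]] ->]]].
    suff [B0 HB0 ->] : exists2 B0, (forall v, v \in B0 -> taylor N v) & B = map (rren f g) B0.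
      by exists (RApp t0 B0) => //; exists t0, B0.
    elim: B HB => [|v B IHB] HB; first by exists [::].
    have [B0 HB0 ->] := IHB (fun w wB => HB w (mem_behead (s := v :: B) wB)).
    have [v0 Hv ->] := (IHN _ _ _).1 (HB v (mem_head _ _)).
    exists (v0 :: B0) => // w; rewrite in_cons => /orP[/eqP ->|/HB0 //]; exact: Hv.
  exists (rren f g t0), (map (rren f g) B); split=> //; first by apply/IHM; exists t0.
  by move=> _ /mapP[v /HB Hv ->]; apply/IHN; exists v.
- split=> [[_ /IH[t0 Ht ->] ->]|[_ [t0 Ht ->] ->]]; first by exists (RMu b t0) => //; exists t0.
  by exists (rren f (up g) t0) => //; apply/IH; exists t0.
Qed.

Lemma taylor_le_ctx K M N t s : semctx K -> taylor_le M N -> taylor M t ->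
  nfm (K (cls t)) s -> exists2 u, taylor N u & nfm (K (cls u)) s.
Proof.
move=> hK MN Ht /(nfm_ctx _ _ hK)[t' Ht' Hs].
have [|u Hu Hu'] := (NFT_nfm N t').1; first by apply: MN; apply/NFT_nfm; exists t.
by exists u => //; apply/(nfm_ctx _ _ hK); exists t'.
Qed.

(** Approximants of M are exchanged one at a time, each time in a context with a single hole; [pre]
    holds those already replaced, and the summand s stays the same. *)
Lemma taylor_le_bag M N t s pre B : taylor_le M N -> (forall v, v \in B -> taylor M v) ->
  nfm (qApp t (pre ++ map cls B)) s ->
  exists2 D, (forall v, v \in D -> taylor N v) & nfm (qApp t (pre ++ map cls D)) s.
Proof.
move=> MN; elim: B pre => [|v B IH] pre HB; first by exists [::].
have p (w : rterm) (X : seq rterm) : perm_eq (pre ++ w :: X) (w :: pre ++ X).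
  by rewrite perm_catC /= perm_cons perm_catC.
rewrite /= (qApp_perm _ (p _ _)) => Hs.
have hK := semctx_step (K := id) (stepctx_bag t (pre ++ map cls B)) semctx_id.
have [u Hu] := taylor_le_ctx hK MN (HB v (mem_head _ _)) Hs.
move=> /(IH (cls u :: pre) (fun w wB => HB w (mem_behead (s := v :: B) wB)))[D HD Hs'].
exists (u :: D); last by rewrite /= (qApp_perm _ (p _ _)).
by move=> w; rewrite in_cons => /orP[/eqP ->|/HD].
Qed.

(** Induction on C, using at each binder or application that the immediate subcontexts are already
    monotone. In an application the function is exchanged first with its bag kept, then the items of
    the bag. *)
Theorem theorem3p2 (C : ctx) (M N : term) :
  taylor_le M N -> taylor_le (fill C M) (fill C N).
Proof.
move=> MN; elim: C => [x|//|x C IH|C IHC D IHD|a b C IH] //= s /NFT_nfm[r + Hs].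
- move=> [_ /taylor_ren[t Ht ->] et]; move: Hs; rewrite et cls_qLam cls_rren.
  have hK := semctx_step stepctx_lam (semctx_ren (f := bind x) (g := id) semctx_id).
  move=> /(taylor_le_ctx hK IH Ht)[u Hu Hs].
  apply/NFT_nfm; exists (RLam (rren (bind x) id u)); last by rewrite cls_qLam cls_rren.
  by exists (rren (bind x) id u) => //; apply/taylor_ren; exists u.
- move=> [t [B [Ht HB et]]]; move: Hs; rewrite et cls_qApp.
  have hK := semctx_step (stepctx_fun (map cls B)) semctx_id.
  move=> /(taylor_le_ctx hK IHC Ht)[u Hu].
  move=> /(taylor_le_bag (pre := [::]) IHD HB)[B' HB' Hs].
  by apply/NFT_nfm; exists (RApp u B'); [exists u, B' | rewrite cls_qApp].
- move=> [_ /taylor_ren[t Ht ->] et]; move: Hs; rewrite et cls_qMu cls_rren.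
  have hK := semctx_step (stepctx_mu (bind a b)) (semctx_ren (f := id) (g := bind a) semctx_id).
  move=> /(taylor_le_ctx hK IH Ht)[u Hu Hs].
  apply/NFT_nfm; exists (RMu (bind a b) (rren id (bind a) u)); last by rewrite cls_qMu cls_rren.
  by exists (rren id (bind a) u) => //; apply/taylor_ren; exists u.
Qed.
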